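(* Let $n\in\mathbb N$, $1\le p\le q<\infty$, and let $\alpha,\beta>-1$ satisfy $$\frac qp\le\frac{\beta+2}{\alpha+2}.$$ Let $g$ be analytic in $\mathbb D$. Then the following are equivalent: (i) $T_{g,n}:A_\alpha^p\to A_\beta^q$ is bounded; (ii) the measure $d\mu_n(z)=|g'(z)|^q(1-|z|^2)^{\beta+nq}\,dA(z)$ is a $(p,q)$-Carleson measure for $A_\alpha^p$. Moreover, $T_{g,n}:A_\alpha^p\to A_\beta^q$ is compact if and only if $\mu_n$ is a vanishing $(p,q)$-Carleson measure.
   Context: $\mathbb D=\{z\in\mathbb C:|z|<1\}$, $\mathbb T=\partial\mathbb D$, $dA=\frac1\pi\,dx\,dy$. For $\alpha>-1$ and $1\le p<\infty$, the weighted Bergman space $A_\alpha^p$ consists of analytic $f$ in $\mathbb D$ with $\|f\|_{A_\alpha^p}^p=\int_{\mathbb D}|f(z)|^p(\alpha+1)(1-|z|^2)^\alpha\,dA(z)<\infty$. For analytic $f,g$ in $\mathbb D$ and $n\in\mathbb N=\{1,2,\dots\}$, $$T_{g,n}[f](z)=\int_0^z\int_0^{t_1}\cdots\int_0^{t_{n-1}} f(t_n)g'(t_n)\,dt_n\cdots dt_1,\quad z\in\mathbb D,$$ an $n$-fold iterated integral, equivalently $T_{g,n}[f](z)=\frac1{(n-1)!}\int_0^z(z-t)^{n-1}f(t)g'(t)\,dt$. For an arc $I\subset\mathbb T$, $|I|$ is its arc length divided by $2\pi$, and $S(I)=\{re^{i\theta}: e^{i\theta}\in I,\ 1-|I|\le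 r<1\}$. A positive Borel measure $\mu$ on $\mathbb D$ is a $(p,q)$-Carleson measure for $A_\alpha^p$ if there is $C>0$ with $\int_{\mathbb D}|f|^q\,d\mu\le C\|f\|_{A_\alpha^p}^q$ for all $f\in A_\alpha^p$. It is a vanishing $(p,q)$-Carleson measure if for every $\varepsilon>0$ there is $\delta>0$ such that $\int_{S(I)}|f|^q\,d\mu\le\varepsilon\|f\|_{A_\alpha^p}^q$ for all arcs $I$ with $|I|<\delta$ and all $f\in A_\alpha^p$ with $\|f\|_{A_\alpha^p}\le1$. *)

(* Defs.v *)
From HB Require Import structures.
From mathcomp Require Import all_boot all_order all_algebra.
From mathcomp Require Import all_classical all_reals all_analysis.
From mathcomp Require Import measurable_realfun.
From mathcomp.real_closed Require Import complex.
From mathcomp Require Import ring lra.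
Import Order.TTheory GRing.Theory Num.Theory.
Import numFieldNormedType.Exports.

Set Implicit Arguments.
Unset Strict Implicit.
Unset Printing Implicit Defensive.

Local Open Scope classical_set_scope.
Local Open Scope ring_scope.

(** * Analytic functions on the unit disc *)

(* The real modulus |z|; the library's `|z| takes its values in R[i]. *)
Notation cabs := ComplexField.Normc.normc.

Definition udisc (R : realType) : set R[i] := [set z | cabs z < 1].

(* [R[i]^o] is R[i] as a normed space over itself, so [derivable] is complex
   differentiability. *)
Definition analytic (R : realType) (f : R[i] -> R[i]) : Prop :=
  forall z, udisc z -> derivable (f : R[i]^o -> R[i]^o) z 1.

Definition cderiv (R : realType) (f : R[i] -> R[i]) : R[i] -> R[i] :=
  derive1 (f : R[i] -> R[i]^o).

(** * Area measure *)

Definition plane (R : realType) : Type :=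
  (measurableTypeR R * measurableTypeR R)%type.
HB.instance Definition _ (R : realType) := Measurable.on (plane R).

Definition cplx (R : realType) (w : plane R) : R[i] := Complex w.1 w.2.

Definition disc (R : realType) : set (plane R) := @cplx R @^-1` @udisc R.

(* dx dy / pi *)
Definition dA (R : realType) : {measure set (plane R) -> \bar R} :=
  mscale (NngNum (ltW (divr_gt0 ltr01 (pi_gt0 R))))
    (lebesgue_measure \x lebesgue_measure)%E.

Section mdensity.
Context d (T : measurableType d) (R : realType).
Variables (mu : {measure set T -> \bar R}) (D : set T) (h : T -> R).
Hypotheses (mD : measurable D) (mh : measurable_fun D h).
Hypothesis h0 : forall x, D x -> 0 <= h x.

(* h dmu restricted to D, as a measure on all of T *)
Definition mdensity of measurable D & measurable_fun D h &
    (forall x, D x -> 0 <= h x) : set T -> \bar R :=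
  fun A => (\int[mu]_(x in A `&` D) (h x)%:E)%E.

Let nu := mdensity mD mh h0.

Let nu0 : nu set0 = 0%E.
Proof. by rewrite /nu /mdensity set0I integral_set0. Qed.

Let nu_ge0 A : (0 <= nu A)%E.
Proof. by apply: integral_ge0 => x [_ Dx]; rewrite lee_fin h0. Qed.

Let nu_sigma : semi_sigma_additive nu.
Proof.
move=> F mF tF mUF.
have mh' A : measurable A -> measurable_fun (A `&` D) (fun x => (h x)%:E).
  move=> mA; apply/measurable_EFinP.
  by apply: measurable_funS mh => // x [].
have mFD k : measurable (F k `&` D) by exact: measurableI.
have -> : nu (\bigcup_n F n) = (\sum_(0 <= i <oo) nu (F i))%E.
  rewrite /nu /mdensity setI_bigcupl ge0_integral_bigcup//.
  - by rewrite -setI_bigcupl; exact: mh'.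
  - by move=> x [k _ [_ Dx]]; rewrite lee_fin h0.
  - move=> i j _ _ [x [[Fi _] [Fj _]]]; apply: tF => //.
    by exists x.
apply: is_cvg_ereal_nneg_natsum_cond => k _ _; exact: nu_ge0.
Qed.

HB.instance Definition _ := isMeasure.Build _ _ _ nu nu0 nu_ge0 nu_sigma.

End mdensity.

(** * Measurability of |f'| on the disc *)

Section meas.
Variable R : realType.
Implicit Types (f : R[i] -> R[i]) (z h : R[i]).

Lemma cabsE z : `|z| = (cabs z)%:C%C.
Proof. by []. Qed.

Lemma cabsD z h : cabs (z + h) <= cabs z + cabs h.
Proof. exact: (@le_normcD R). Qed.

Lemma cabsM z h : cabs (z * h) = cabs z * cabs h.
Proof. exact: ComplexField.Normc.normcM. Qed.

Lemma cabsN z : cabs (- z) = cabs z.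
Proof. exact: (@normcN R). Qed.

Lemma cabsV z : cabs z^-1 = (cabs z)^-1.
Proof. exact: ComplexField.Normc.normcV. Qed.

Lemma cabs_ge0 z : 0 <= cabs z.
Proof. by case: z => a b; exact: sqrtr_ge0. Qed.

Lemma cabs_real (x : R) : cabs x%:C%C = `|x|.
Proof. by rewrite /= expr0n /= addr0 sqrtr_sqr. Qed.

Lemma cabs_dist z h : `|cabs z - cabs h| <= cabs (z - h).
Proof.
rewrite ler_norml; apply/andP; split.
  have := cabsD z (h - z); rewrite subrKC -(cabsN (h - z)) opprB; lra.
by have := cabsD h (z - h); rewrite subrKC; lra.
Qed.

Lemma cabs_box (x y : R) : cabs (Complex x y) <= `|x| + `|y|.
Proof.
have -> : Complex x y = x%:C%C + Complex 0 y.
  by apply/eqP; rewrite eq_complex /= addr0 add0r !eqxx.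
apply: le_trans (cabsD _ _) _.
by rewrite cabs_real lerD2l /= expr0n /= add0r sqrtr_sqr.
Qed.

Local Arguments ComplexField.Normc.normc : simpl never.

Lemma cderivP f z : derivable (f : R[i]^o -> R[i]^o) z 1 ->
  forall e : R, 0 < e -> exists2 d : R, 0 < d & forall h, h != 0 ->
    cabs h < d -> cabs (h^-1 * (f (h + z) - f z) - cderiv f z) < e.
Proof.
move=> df e e0.
have -> : cderiv f z = 'D_1 (f : R[i]^o -> R[i]^o) z by rewrite /cderiv derive1E.
move/cvgrPdist_lt: df.
have e0' : (0 : R[i]) < e%:C%C by rewrite ltcR.
move=> /(_ _ e0') [[d dI] /= d0 H].
move: d0; rewrite ltcE /= => /andP[/eqP dI0 d0].
exists d => // h h0 hd.
have hb : ball_ Num.norm 0 (Complex d dI) h.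
  by rewrite /ball_ /= sub0r normrN cabsE ltcE /= dI0 eqxx.
have := H h hb h0.
by rewrite -ltcR -cabsE -normrN opprB [h%:A]mulr1.
Qed.

Lemma analytic_cts f z : derivable (f : R[i]^o -> R[i]^o) z 1 ->
  forall e : R, 0 < e -> exists2 d : R, 0 < d & forall v,
    cabs (v - z) < d -> cabs (f v - f z) < e.
Proof.
move=> df e e0; have [d d0 H] := cderivP df ltr01.
set K := cabs (cderiv f z) + 1.
have K0 : 0 < K by rewrite ltr_wpDl// cabs_ge0.
exists (Num.min d (e / K)); first by rewrite lt_min d0 divr_gt0.
move=> v; rewrite lt_min => /andP[vd vK].
have [->|vz] := eqVneq v z; first by rewrite subrr ComplexField.Normc.normc0.
have hn0 : v - z != 0 by rewrite subr_eq0.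
have := H _ hn0 vd; rewrite subrK => H1.
have H2 : cabs ((v - z)^-1 * (f v - f z)) < K.
  rewrite -[X in cabs X](subrK (cderiv f z)).
  by apply: le_lt_trans (cabsD _ _) _; rewrite /K addrC ltrD2l.
rewrite -[f v - f z](mulVKf hn0) cabsM.
have v0 : 0 < cabs (v - z).
  rewrite lt_neqAle cabs_ge0 andbT eq_sym; apply: contraNneq hn0.
  by move=> /ComplexField.Normc.eq0_normc ->.
apply: lt_trans (_ : cabs (v - z) * K < e); first by rewrite ltr_pM2l.
by rewrite -ltr_pdivlMr.
Qed.

Lemma plane_open_measurable (O : set (plane R)) :
  (forall w, O w -> exists2 e : R, 0 < e & forall v : plane R,
     `|v.1 - w.1| < e -> `|v.2 - w.2| < e -> O v) -> measurable O.
Proof.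
move=> HO.
pose box (r : (rat * rat) * (rat * rat)) : set (plane R) :=
  `]ratr r.1.1, ratr r.1.2[ `*` `]ratr r.2.1, ratr r.2.2[.
pose F r := if `[< box r `<=` O >] then box r else set0.
have -> : O = \bigcup_r F r.
  apply/seteqP; split => [w Ow|w [r _]]; last first.
    by rewrite /F; case: asboolP => // sub wb; exact: sub.
  have [e e0 He] := HO _ Ow.
  have [a1 /itvP a1P] := @rat_in_itvoo R (w.1 - e) w.1 ltac:(lra).
  have [b1 /itvP b1P] := @rat_in_itvoo R w.1 (w.1 + e) ltac:(lra).
  have [a2 /itvP a2P] := @rat_in_itvoo R (w.2 - e) w.2 ltac:(lra).
  have [b2 /itvP b2P] := @rat_in_itvoo R w.2 (w.2 + e) ltac:(lra).
  exists ((a1, b1), (a2, b2)) => //; rewrite /F.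
  rewrite asboolT; last first.
    move=> v [] /=; rewrite !in_itv /= => /andP[v1 v1'] /andP[v2 v2'].
    apply: He.
      rewrite ltr_norml.
      have : w.1 - e < ratr a1 by rewrite a1P.
      have : ratr b1 < w.1 + e by rewrite b1P.
      by lra.
    rewrite ltr_norml.
    have : w.2 - e < ratr a2 by rewrite a2P.
    have : ratr b2 < w.2 + e by rewrite b2P.
    by lra.
  by split; rewrite /= in_itv /= ?a1P ?b1P ?a2P ?b2P.
apply: countable_bigcupT_measurable; first exact: countableP.
move=> r; rewrite /F; case: ifP => // _.
by apply: measurableX; exact: measurable_itv.
Qed.

Lemma plane_cts_measurable (O : set (plane R)) (F : plane R -> R) :
  measurable O ->
  (forall w, O w -> exists2 e : R, 0 < e & forall v : plane R,
     `|v.1 - w.1| < e -> `|v.2 - w.2| < e -> O v) ->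
  (forall w, O w -> forall t : R, 0 < t -> exists2 e : R, 0 < e &
     forall v : plane R,
     `|v.1 - w.1| < e -> `|v.2 - w.2| < e -> `|F v - F w| < t) ->
  measurable_fun O F.
Proof.
move=> mO oO cF.
move=> _; apply: (measurability _ (RGenOInfty.measurableE R)) => //.
move=> _ [_ [a ->] <-]; apply: plane_open_measurable => w [Ow].
rewrite /= in_itv /= andbT => aF.
have [e1 e10 H1] := oO _ Ow.
have [e2 e20 H2] := cF _ Ow (F w - a) ltac:(lra).
exists (Num.min e1 e2); first by rewrite lt_min e10 e20.
move=> v; rewrite !lt_min => /andP[? ?] /andP[? ?]; split; first exact: H1.
rewrite /= in_itv /= andbT.
have : `|F v - F w| < F w - a by exact: H2.
rewrite ltr_norml; lra.
Qed.

Lemma cplx_near (w : plane R) (e : R) : 0 < e -> exists2 d : R, 0 < d &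
  forall v : plane R, `|v.1 - w.1| < d -> `|v.2 - w.2| < d ->
    cabs (cplx v - cplx w) < e.
Proof.
move=> e0; exists (e / 2); first lra.
move=> v v1 v2; apply: le_lt_trans (_ : cabs (Complex (v.1 - w.1) (v.2 - w.2)) < e).
  by [].
by apply: le_lt_trans (cabs_box _ _) _; lra.
Qed.

Definition disc_r (r : R) : set (plane R) := [set w | cabs (cplx w) < r].

Lemma disc_r_open (r : R) w : disc_r r w -> exists2 e : R, 0 < e & forall v : plane R,
     `|v.1 - w.1| < e -> `|v.2 - w.2| < e -> disc_r r v.
Proof.
rewrite /disc_r /= => wr.
have [d d0 H] := @cplx_near w (r - cabs (cplx w)) ltac:(lra).
exists d => // v v1 v2; have := H v v1 v2.
have := cabsD (cplx v - cplx w) (cplx w); rewrite subrK; lra.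
Qed.

Lemma measurable_disc_r r : measurable (disc_r r).
Proof. by apply: plane_open_measurable => w; exact: disc_r_open. Qed.

Lemma measurable_disc : measurable (disc (R := R)).
Proof. exact: (measurable_disc_r 1). Qed.

Lemma measurable_cabs :
  measurable_fun (disc (R := R)) (fun w => cabs (cplx w)).
Proof.
apply: plane_cts_measurable; [exact: measurable_disc|exact: (@disc_r_open 1)|].
move=> w _ t t0; have [d d0 H] := @cplx_near w _ t0; exists d => // v v1 v2.
by apply: le_lt_trans (cabs_dist _ _) _; exact: H.
Qed.

Lemma measurable_cabs_cderiv f : analytic f ->
  measurable_fun (disc (R := R)) (fun w => cabs (cderiv f (cplx w))).
Proof.
move=> af.
pose rho m : R := 1 - m.+1%:R^-1.
have -> : disc (R := R) = \bigcup_m disc_r (rho m).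
  apply/seteqP; split => [w|w [m _]]; rewrite /disc /udisc /disc_r /rho /=.
    move=> w1; have w0 : 0 < 1 - cabs (cplx w) by lra.
    have [m _ mw] := @near_infty_natSinv_lt R (PosNum w0).
    exists m => //; rewrite /disc_r /=.
    by have /= := mw m (leqnn m); rewrite !ltrBrDl addrC.
  by move=> /lt_le_trans; apply; rewrite gerBl invr_ge0.
apply/measurable_fun_bigcup; first by move=> m; exact: measurable_disc_r.
move=> m.
pose c k : R[i] := ((k + m).+2%:R^-1 : R)%:C%C.
have cE k : cabs (c k) = (k + m).+2%:R^-1 by rewrite cabs_real ger0_norm// invr_ge0.
have c_neq0 k : c k != 0.
  by apply/eqP => /(congr1 (@complex.Re R)) /= /eqP; rewrite invr_eq0 pnatr_eq0.
apply: (@measurable_fun_cvg _ _ _ _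
  (fun k w => cabs ((c k)^-1 * (f (c k + cplx w) - f (cplx w))))).
- move=> k.
  apply: plane_cts_measurable; [exact: measurable_disc_r|exact: disc_r_open|].
  move=> w wm t t0.
  have c_lt : cabs (c k) < m.+1%:R^-1.
    by rewrite cE ltf_pV2 ?posrE ?ltr0n// ltr_nat !ltnS leq_addl.
  have c0 : 0 < cabs (c k) by rewrite cE invr_gt0 ltr0n.
  have u1 : udisc (cplx w).
    move: wm; rewrite /udisc /disc_r /rho /= => /lt_le_trans; apply.
    by rewrite gerBl invr_ge0.
  have u2 : udisc (c k + cplx w).
    apply: le_lt_trans (cabsD _ _) _.
    move: wm; rewrite /disc_r /rho /= ltrBrDl; apply: le_lt_trans.
    by rewrite lerD2r ltW.
  set t' := t * cabs (c k) / 2.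
  have t'0 : 0 < t' by rewrite divr_gt0// mulr_gt0.
  have [d1 d10 H1] := analytic_cts (af _ u1) t'0.
  have [d2 d20 H2] := analytic_cts (af _ u2) t'0.
  have [d d0 H] := @cplx_near w (Num.min d1 d2) ltac:(by rewrite lt_min d10 d20).
  exists d => // v v1 v2.
  have := H v v1 v2; rewrite lt_min => /andP[/H1 A /[dup] B0].
  have -> : cplx v - cplx w = c k + cplx v - (c k + cplx w).
    by rewrite opprD addrACA subrr add0r.
  move=> /H2 B.
  apply: le_lt_trans (cabs_dist _ _) _.
  rewrite -mulrBr cabsM cabsV ltr_pdivrMl//.
  set x := f (c k + cplx v) in B *; set y := f (c k + cplx w) in B *.
  have -> : x - f (cplx v) - (y - f (cplx w)) = (x - y) + - (f (cplx v) - f (cplx w)).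
    by ring.
  apply: le_lt_trans (cabsD _ _) _; rewrite cabsN.
  have -> : cabs (c k) * t = t' + t' by rewrite /t'; lra.
  exact: ltrD.
- move=> w wm.
  have u1 : udisc (cplx w).
    move: wm; rewrite /udisc /disc_r /rho /= => /lt_le_trans; apply.
    by rewrite gerBl invr_ge0.
  apply/cvgrPdist_lt => e e0.
  have [d d0 H] := cderivP (af _ u1) e0.
  have [N _ NP] := @near_infty_natSinv_lt R (PosNum d0).
  exists N => // k /= Nk.
  rewrite distrC; apply: le_lt_trans (cabs_dist _ _) _.
  apply: H => //; rewrite cE.
  have /= := NP k.+1 (leqW Nk); apply: le_lt_trans.
  by rewrite lef_pV2 ?posrE ?ltr0n// ler_nat !ltnS leq_addr.
Qed.

End meas.

(** * Weighted Bergman spaces *)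

Section bergman.
Variable R : realType.
Implicit Types (a p q b : R) (f g : R[i] -> R[i]) (n : nat).

Definition bergman_int a p f : \bar R :=
  (\int[dA R]_(w in disc (R := R))
     (cabs (f (cplx w)) `^ p
      * ((a + 1) * (1 - cabs (cplx w) ^+ 2) `^ a))%:E)%E.

Definition bergman a p : set (R[i] -> R[i]) :=
  [set f | analytic f /\ (bergman_int a p f < +oo)%E].

Definition bergman_norm a p f : \bar R := (bergman_int a p f `^ p^-1)%E.

(** * The operator T_{g,n} *)

(* Line integral along the segment [0, z]. *)
Definition seg_int f (z : R[i]) : R[i] :=
  z * Complex
    (\int[lebesgue_measure]_(s in `[0, 1]) complex.Re (f (s%:C%C * z)))
    (\int[lebesgue_measure]_(s in `[0, 1]) complex.Im (f (s%:C%C * z))).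

Definition Tgn g n f : R[i] -> R[i] :=
  iter n seg_int (fun t => f t * cderiv g t).

(** * Bounded and compact operators between Bergman spaces *)

Definition maps_into (T : (R[i] -> R[i]) -> (R[i] -> R[i])) a p b q : Prop :=
  forall f, bergman a p f -> bergman b q (T f).

(* Functions R[i] -> R[i] stand for their restrictions to the disc: analyticity,
   [bergman_norm] and the values of [Tgn] on the disc only depend on those. *)
Definition bounded_op (T : (R[i] -> R[i]) -> (R[i] -> R[i])) a p b q : Prop :=
  maps_into T a p b q /\
  exists C : R, forall f, bergman a p f ->
    (bergman_norm b q (T f) <= C%:E * bergman_norm a p f)%E.

Definition compact_op (T : (R[i] -> R[i]) -> (R[i] -> R[i])) a p b q : Prop :=
  maps_into T a p b q /\
  forall u : nat -> R[i] -> R[i],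
    (forall k, bergman a p (u k)) ->
    (exists M : R, forall k, (bergman_norm a p (u k) <= M%:E)%E) ->
    exists (phi : nat -> nat) (F : R[i] -> R[i]),
      [/\ {homo phi : i j / (i < j)%N}, bergman b q F &
        bergman_norm b q (fun z => T (u (phi k)) z - F z) @[k --> \oo]
          --> 0%E].

(** * Carleson measures *)

(* The arc {e^{i t} : t in J}, J an interval from [arc_lo] to [arc_hi].  The
   booleans are mathcomp's [BSide] flags and choose the kind of each endpoint:
   [true] is closed for the lower bound and open for the upper one. *)
Record arc := Arc {
  arc_lb : bool; arc_lo : R; arc_rb : bool; arc_hi : R;
  arc_lt : arc_lo < arc_hi;
  arc_le : arc_hi <= arc_lo + 2 * pi }.

Definition expi (t : R) : R[i] := Complex (cos t) (sin t).

Definition arc_set (I : arc) : set R[i] :=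
  expi @` [set` Interval (BSide (arc_lb I) (arc_lo I))
                         (BSide (arc_rb I) (arc_hi I))].

Definition arc_len (I : arc) : R := (arc_hi I - arc_lo I) / (2 * pi).

Definition carleson_box (I : arc) : set R[i] :=
  [set z | exists (r t : R),
     [/\ arc_set I (expi t), 1 - arc_len I <= r, r < 1 &
         z = r%:C%C * expi t]].

Definition carleson a p q (mu : {measure set (plane R) -> \bar R}) : Prop :=
  exists2 C : R, 0 < C & forall f, bergman a p f ->
    (\int[mu]_(w in disc (R := R)) (cabs (f (cplx w)) `^ q)%:E
      <= C%:E * bergman_norm a p f `^ q)%E.

Definition vanishing_carleson a p q
    (mu : {measure set (plane R) -> \bar R}) : Prop :=
  forall eps : R, 0 < eps -> exists2 delta : R, 0 < delta &
    forall I : arc, arc_len I < delta ->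
    forall f, bergman a p f -> (bergman_norm a p f <= 1)%E ->
    (\int[mu]_(w in @cplx R @^-1` carleson_box I) (cabs (f (cplx w)) `^ q)%:E
      <= eps%:E * bergman_norm a p f `^ q)%E.

(** * The measure mu_n *)

Definition mun_density g n b q (w : plane R) : R :=
  cabs (cderiv g (cplx w)) `^ q
  * (1 - cabs (cplx w) ^+ 2) `^ (b + n%:R * q).

Lemma measurable_mun_density g n b q : analytic g ->
  measurable_fun (disc (R := R)) (mun_density g n b q).
Proof.
move=> ag; apply: measurable_funM.
  apply: (measurableT_comp (measurable_powR q)).
  exact: measurable_cabs_cderiv.
apply: (measurableT_comp (measurable_powR (b + n%:R * q))).
apply: measurable_funB => //; apply: measurable_funX.
exact: measurable_cabs.
Qed.

Lemma mun_density_ge0 g n b q (w : plane R) :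
  disc w -> 0 <= mun_density g n b q w.
Proof. by move=> _; rewrite mulr_ge0// powR_ge0. Qed.

Definition mun g n b q (ag : analytic g) :
    {measure set (plane R) -> \bar R} :=
  mdensity (dA R) (@measurable_disc R)
    (measurable_mun_density n b q ag) (@mun_density_ge0 g n b q).

End bergman.

(* Main.v *)
(* Write d(z) = 1 - |z|.  For analytic F the integral of |F|^q d^b (when F(0) = ... =
   F^(n-1)(0) = 0) is comparable to that of |F^(n)|^q d^(b+nq).  One bound is Cauchy's
   estimate on the discs of radius d(z)/2, averaged by Fubini; the other is Hoelder's
   inequality along radii, again followed by Fubini.  Since T_{g,n} f has n-th derivative
   f g' and vanishes to order n at 0, the norm of T_{g,n} f in A_beta^q is comparable to
   the norm of f in L^q(mu_n), which gives the first equivalence.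

   For the second one, both sides are equivalent to the convergence to 0, as t -> 0, of
   the integral of |f|^q over {d < t} with respect to mu_n, uniformly for f in the unit
   ball of A_alpha^p.
   - If this holds, a bounded sequence converges locally uniformly along a subsequence
     by Montel's theorem, hence in L^q(mu_n), and its image under T_{g,n} converges.
   - If T_{g,n} is compact and T_{g,n} u_k converges to F in A_beta^q, then u_k g' is
     asymptotic to F^(n), whose integral over {d < t} tends to 0.
   - Carleson boxes of short arcs lie in {d < t}.  Conversely, if mu_n is vanishing
     Carleson, the functions (1 - conj(w) z)^-m show that mu_n of the disc of radius
     about d(w) around w is o(d(w)^((2 + alpha) q / p)) as |w| -> 1, and covering
     {d < t} by such discs, on which |f|^q is controlled by the mean value inequality
     and the growth of f, yields the uniform smallness. *)
Require Import Defs.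
From HB Require Import structures.
From mathcomp Require Import all_boot all_order all_algebra.
From mathcomp Require Import all_classical all_reals all_analysis.
From mathcomp Require Import measurable_realfun.
From mathcomp.real_closed Require Import complex.
From mathcomp Require Import ring lra.
Import Order.TTheory GRing.Theory Num.Theory.
Import numFieldNormedType.Exports.

Set Implicit Arguments.
Unset Strict Implicit.
Unset Printing Implicit Defensive.

Local Open Scope classical_set_scope.
Local Open Scope ring_scope.

Local Arguments ComplexField.Normc.normc : simpl never.

(** * Integrals along segments and rectangles *)

(** All comparisons hold up to unspecified constants, and this freedom shapes the tools. Cauchy's
    theory is built on rectangles, whose sides reduce to integrals of real functions over intervals;
    the factor 2 lost in bounding a complex integral through its two components is harmless. Mean
    value inequalities need no circles: Cauchy's formula on a rectangle suffices once its sides are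
    moved to where the function is small on average. Jensen's and Hoelder's inequalities are both
    obtained from the pointwise bound x <= lam + lam^(1-q) x^q, with the threshold lam adjusted
    afterwards. Derivatives and primitives are taken one at a time, the weight exponent going from b
    to b + q at each step. The delicate direction is the primitive. The substitution w = t z has the
    Jacobian t^(-2), so only the outer half of each radius is averaged, and the inner half is
    bounded by the pointwise growth of the function. The small exponent eta in Hoelder's inequality
    makes the kernel integrable along the radius, and its loss eta (q - 1) must stay below b + 1 for
    the remaining weight to be integrable. *)

Section cint.
Variable R : realType.
Implicit Types (a b c t s e : R) (z w : R[i]) (phi psi : R -> R[i]).
Local Notation mu := (@lebesgue_measure R).
Local Notation Re := (@complex.Re R).
Local Notation Im := (@complex.Im R).

Lemma normr_Re_le z : `|Re z| <= cabs z.
Proof.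
by case: z => x y /=; rewrite -sqrtr_sqr ler_wsqrtr// lerDl sqr_ge0.
Qed.

Lemma normr_Im_le z : `|Im z| <= cabs z.
Proof.
by case: z => x y /=; rewrite -sqrtr_sqr ler_wsqrtr// lerDr sqr_ge0.
Qed.

Lemma cabs_le_ReIm z : cabs z <= `|Re z| + `|Im z|.
Proof. by case: z => x y; exact: cabs_box. Qed.

Definition ccont_at phi t := forall e, 0 < e ->
  exists2 d : R, 0 < d & forall s, `|s - t| < d -> cabs (phi s - phi t) < e.

(** Continuity is two-sided at the end points as well, so it restricts to subintervals without
    one-sided limits. *)
Definition ccont a b phi := forall t, a <= t <= b -> ccont_at phi t.

Definition cint a b phi : R[i] :=
  Complex (\int[mu]_(t in `[a, b]) Re (phi t)) (\int[mu]_(t in `[a, b]) Im (phi t)).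

Lemma eps_cont_integrable a b (h : R -> R) :
  (forall t, a <= t <= b -> forall e, 0 < e ->
    exists2 d : R, 0 < d & forall s, `|s - t| < d -> `|h s - h t| < e) ->
  mu.-integrable `[a, b] (EFin \o h).
Proof.
move=> ch; apply: continuous_compact_integrable; first exact: segment_compact.
apply: continuous_in_subspaceT => t; rewrite inE /= in_itv /= => tab.
apply/cvgrPdist_lt => e e0; have [d d0 H] := ch t tab e e0.
near=> s; rewrite distrC; apply: H; rewrite distrC; near: s.
exact: cvgr_dist_lt.
Unshelve. all: by end_near. Qed.

Lemma ccontS a b c d phi : a <= c -> d <= b -> ccont a b phi -> ccont c d phi.
Proof.
by move=> ac db H t /andP[ct td]; apply: H; rewrite (le_trans ac ct) (le_trans td db).
Qed.

Lemma ccont_integrable a b phi : ccont a b phi ->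
  [/\ mu.-integrable `[a, b] (EFin \o (fun t => Re (phi t))),
      mu.-integrable `[a, b] (EFin \o (fun t => Im (phi t))) &
      mu.-integrable `[a, b] (EFin \o (fun t => cabs (phi t)))].
Proof.
move=> cp; split; apply: eps_cont_integrable => t tab e e0;
  have [d d0 H] := cp t tab e e0; exists d => // s /H {H};
  apply: le_lt_trans.
- by apply: le_trans (normr_Re_le _); case: (phi s) (phi t) => ? ? [].
- by apply: le_trans (normr_Im_le _); case: (phi s) (phi t) => ? ? [].
- exact: cabs_dist.
Qed.

Lemma ccontD a b phi psi : ccont a b phi -> ccont a b psi ->
  ccont a b (fun t => phi t + psi t).
Proof.
move=> cp cq t tab e e0; have e20 : 0 < e / 2 by lra.
have [d1 d10 H1] := cp t tab _ e20; have [d2 d20 H2] := cq t tab _ e20.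
exists (Num.min d1 d2); first by rewrite lt_min d10.
move=> s; rewrite lt_min => /andP[/H1 A /H2 B]; rewrite opprD addrACA.
by apply: le_lt_trans (cabsD _ _) _; lra.
Qed.

Lemma ccontZ a b z phi : ccont a b phi -> ccont a b (fun t => z * phi t).
Proof.
move=> cp t tab e e0.
have K0 : 0 < cabs z + 1 by rewrite ltr_wpDl// cabs_ge0.
have [d d0 H] := cp t tab _ (divr_gt0 e0 K0); exists d => // s /H.
rewrite ltr_pdivlMr// -mulrBr cabsM; apply: le_lt_trans.
by rewrite mulrC ler_wpM2l ?cabs_ge0// lerDl.
Qed.

Lemma cintD a b phi psi : ccont a b phi -> ccont a b psi ->
  cint a b (fun t => phi t + psi t) = cint a b phi + cint a b psi.
Proof.
move=> /ccont_integrable[p1 p2 _] /ccont_integrable[q1 q2 _].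
apply/eqP; rewrite eq_complex /=; apply/andP; split; apply/eqP.
  rewrite -RintegralD//; apply: eq_Rintegral => t _.
  by case: (phi t) (psi t) => ? ? [].
rewrite -RintegralD//; apply: eq_Rintegral => t _.
by case: (phi t) (psi t) => ? ? [].
Qed.

Lemma cintZ a b z phi : ccont a b phi ->
  cint a b (fun t => z * phi t) = z * cint a b phi.
Proof.
case: z => x y /ccont_integrable[p1 p2 _].
have ir (k : R) h : mu.-integrable `[a, b] (EFin \o h) ->
    mu.-integrable `[a, b] (EFin \o (fun t => k * h t)).
  move=> ih; have -> : EFin \o (fun t => k * h t) = (fun t => k%:E * (EFin \o h) t)%E.
    by apply/funext => t /=; rewrite EFinM.
  exact: integrableZl.
apply/eqP; rewrite eq_complex /=; apply/andP; split; apply/eqP.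
  rewrite -!RintegralZl// -RintegralB//; [|exact: ir|exact: ir].
  by apply: eq_Rintegral => t _; case: (phi t).
rewrite -!RintegralZl// -RintegralD//; [|exact: ir|exact: ir].
by apply: eq_Rintegral => t _; case: (phi t).
Qed.

Lemma eq_cint a b phi psi : (forall t, a <= t <= b -> phi t = psi t) ->
  cint a b phi = cint a b psi.
Proof.
move=> H; congr Complex; apply: eq_Rintegral => t; rewrite inE /= in_itv /= => /H ->//.
Qed.

Lemma Rintegral_split a b c (h : R -> R) : a <= b -> b <= c ->
  mu.-integrable `[a, c] (EFin \o h) ->
  \int[mu]_(t in `[a, c]) h t = \int[mu]_(t in `[a, b]) h t + \int[mu]_(t in `[b, c]) h t.
Proof.
move=> ab bc ih; apply/eqP; rewrite addrC -subr_eq; apply/eqP.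
rewrite Rintegral_itvB ?bnd_simp// Rintegral_itv_obnd_cbnd//.
by apply: integrableS ih => // x; rewrite /= !in_itv /=; lra.
Qed.

Lemma cint_split a b c phi : a <= b -> b <= c -> ccont a c phi ->
  cint a c phi = cint a b phi + cint b c phi.
Proof.
move=> ab bc /ccont_integrable[p1 p2 _].
by apply/eqP; rewrite eq_complex /= -!Rintegral_split// !eqxx.
Qed.

(** The real and the imaginary part are bounded separately, which costs the factor 2; sharp
    constants never matter below. *)
Lemma cabs_cint_le a b phi : ccont a b phi ->
  ((cabs (cint a b phi))%:E <= 2%:E * \int[mu]_(t in `[a, b]) (cabs (phi t))%:E)%E.
Proof.
move=> /ccont_integrable[p1 p2 p3].
have F : ((\int[mu]_(t in `[a, b]) cabs (phi t))%:E
   = \int[mu]_(t in `[a, b]) (cabs (phi t))%:E)%E.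
  by rewrite /Rintegral fineK//; exact: integrable_fin_num p3.
rewrite -F -EFinM lee_fin; apply: le_trans (cabs_le_ReIm _) _ => /=.
rewrite mulr_natl mulr2n; apply: lerD.
  apply: le_trans (le_normr_Rintegral _ p1) _ => //.
  apply: le_Rintegral => //; first exact: integrable_norm p1.
  by move=> t _; exact: normr_Re_le.
apply: le_trans (le_normr_Rintegral _ p2) _ => //.
apply: le_Rintegral => //; first exact: integrable_norm p2.
by move=> t _; exact: normr_Im_le.
Qed.

Lemma cabs_cint_bound a b phi M : a <= b -> ccont a b phi ->
  (forall t, a <= t <= b -> cabs (phi t) <= M) ->
  cabs (cint a b phi) <= 2 * M * (b - a).
Proof.
move=> ab cp H; rewrite -lee_fin; apply: le_trans (cabs_cint_le cp) _.
rewrite -mulrA EFinM lee_pmul2l//.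
have [_ _ /integrableP[mp _]] := ccont_integrable cp.
apply: (@le_trans _ _ (\int[mu]_(t in `[a, b]) M%:E)%E).
  apply: ge0_le_integral; first by [].
  - by move=> t _; rewrite lee_fin cabs_ge0.
  - by [].
  - by [].
  - by move=> t; rewrite /= in_itv /= => /H; rewrite lee_fin.
rewrite integral_cst//= lebesgue_measure_itv /= lte_fin.
move: ab; rewrite le_eqVlt => /predU1P[->|ab]; first by rewrite ltxx mule0 subrr mulr0.
by rewrite ab -EFinB -EFinM.
Qed.

(** The difference quotient is multiplied out and the inequality is not strict, so that [s = t]
    needs no separate case. *)
Definition path_diff (Phi : R -> R[i]) t z := forall e, 0 < e ->
  exists2 d : R, 0 < d & forall s, `|s - t| < d ->
    cabs (Phi s - Phi t - (s - t)%:C%C * z) <= e * `|s - t|.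

Lemma path_diff_Re Phi t z : path_diff Phi t z ->
  is_derive t 1 (fun s => Re (Phi s)) (Re z) /\
  is_derive t 1 (fun s => Im (Phi s)) (Im z).
Proof.
move=> H.
have K (P : R[i] -> R) : {morph P : x y / x - y} ->
   (forall (x : R) w, P (x%:C%C * w) = x * P w) -> (forall w, `|P w| <= cabs w) ->
   is_derive t 1 (fun s => P (Phi s)) (P z).
  move=> PB PZ Pn.
  have : (fun h => h^-1 *: (((fun s => P (Phi s)) \o shift t) (h *: 1) - P (Phi t)))
      @ 0^' --> P z.
    apply/cvgrPdist_le => e e0; have [d d0 Hd] := H _ e0.
    near=> h.
    have h0 : h != 0 by near: h; exact: nbhs_dnbhs_neq.
    have hd : `|h| < d.
      near: h; apply: dnbhs0_lt => //.
    rewrite /= /shift /= scaler1.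
    have hn : 0 < `|h| by rewrite normr_gt0.
    rewrite -(ler_pM2l hn) -normrM.
    rewrite mulrBr /GRing.scale /= mulrA divff// mul1r distrC.
    have := Hd (h + t); rewrite addrK => /(_ hd); rewrite [X in _ <= X -> _]mulrC; apply: le_trans.
    by rewrite -PZ -!PB Pn.
  by move=> /[dup] /cvgP c1 /cvg_lim <-.
split; apply: K => //.
- by case=> ? ? [].
- by move=> x [] ? ? /=; ring.
- exact: normr_Re_le.
- by case=> ? ? [].
- by move=> x [] ? ? /=; ring.
- exact: normr_Im_le.
Unshelve. all: by end_near. Qed.

(** Componentwise, this is the real fundamental theorem of calculus. [K] treats both components at
    once, through an additive projection [P] with |P w| <= |w|. *)
Lemma cint_FTC a b Phi phi : a <= b -> ccont a b phi ->
  (forall t, a <= t <= b -> path_diff Phi t (phi t)) ->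
  cint a b phi = Phi b - Phi a.
Proof.
rewrite le_eqVlt => /predU1P[<- _ _|ab cp dP].
  by rewrite subrr /cint !set_itv1 !Rintegral_set1.
have K (P : R[i] -> R) : (forall w, `|P w| <= cabs w) -> {morph P : x y / x - y} ->
    (forall t, a <= t <= b -> is_derive t 1 (fun s => P (Phi s)) (P (phi t))) ->
   \int[mu]_(t in `[a, b]) P (phi t) = P (Phi b) - P (Phi a).
  move=> Pn PB dPP; rewrite /Rintegral (@continuous_FTC2 _ _ (fun s => P (Phi s)))//.
  - apply: continuous_in_subspaceT => t; rewrite inE /= in_itv /= => tab.
    apply/cvgrPdist_lt => e e0; have [d d0 H] := cp t tab e e0.
    near=> s; rewrite distrC -PB; apply: le_lt_trans (Pn _) _; apply: H.
    by rewrite distrC; near: s; exact: cvgr_dist_lt.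
  - have cP t : a <= t <= b -> {for t, continuous (fun s => P (Phi s))}.
      move=> /dPP [d1 _]; apply: differentiable_continuous; exact/derivable1_diffP.
    split.
    + move=> t; rewrite in_itv /= => /andP[at_ tb].
      by have [] := dPP t ltac:(lra).
    + by apply: cvg_at_right_filter; apply: cP; lra.
    + by apply: cvg_at_left_filter; apply: cP; lra.
  - move=> t; rewrite in_itv /= => /andP[at_ tb].
    have [_ <-] := dPP t ltac:(lra).
    by rewrite derive1E.
have dP' t (tab : a <= t <= b) := path_diff_Re (dP t tab).
have ReB : {morph Re : x y / x - y} by case=> ? ? [].
have ImB : {morph Im : x y / x - y} by case=> ? ? [].
apply/eqP; rewrite eq_complex /=; apply/andP; split; apply/eqP.
  by rewrite (K Re normr_Re_le ReB (fun t tab => (dP' t tab).1)) ReB.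
by rewrite (K Im normr_Im_le ImB (fun t tab => (dP' t tab).2)) ImB.
Unshelve. all: by end_near. Qed.

End cint.

(** * Complex differentiability and integrals around rectangles *)

Section rectangle.
Variable R : realType.
Implicit Types (a b c d t s e x y : R) (z w h l : R[i]) (f F : R[i] -> R[i]).
Local Notation "'j" := (Complex 0 1 : R[i]).

(** An explicit remainder bound with the derivative as a parameter: it allows [h = 0], and it makes
    sense before [l] is identified with [cderiv f z]. *)
Definition cdiff f z l := forall e, 0 < e -> exists2 d : R, 0 < d &
  forall h, cabs h < d -> cabs (f (z + h) - f z - h * l) <= e * cabs h.

Definition ccts f z := forall e, 0 < e -> exists2 d : R, 0 < d &
  forall h, cabs h < d -> cabs (f (z + h) - f z) < e.

Lemma cdiff_is_derive f z l : cdiff f z l ->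
  is_derive (z : R[i]^o) 1 (f : R[i]^o -> R[i]^o) l.
Proof.
move=> H.
have : (fun h : R[i]^o => h^-1 *: (((f : R[i]^o -> R[i]^o) \o shift (z : R[i]^o)) (h *: (1 : R[i]^o)) - f z))
      @ (0 : R[i]^o)^' --> (l : R[i]^o).
  apply/cvgrPdist_lt => e.
  case: e => e e'; rewrite ltcE /= => /andP[/eqP -> e0].
  have e20 : 0 < e / 2 by lra.
  have [d d0 Hd] := H _ e20; exists d%:C%C => /=; first by rewrite ltcR.
  move=> h /=; rewrite sub0r normrN cabsE ltcR => hd h0.
  rewrite [h%:A]mulr1 cabsE ltcR -cabsN opprB.
  have hn : 0 < cabs h.
    rewrite lt_neqAle cabs_ge0 andbT eq_sym; apply: contraNneq h0.
    by move=> /ComplexField.Normc.eq0_normc ->.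
  rewrite -(ltr_pM2l hn) -cabsM mulrBr /GRing.scale /= mulrA divff// mul1r.
  rewrite addrC; apply: le_lt_trans (_ : cabs h * (e / 2) < _); last first.
    by rewrite ltr_pM2l//; lra.
  have := Hd h hd; rewrite addrC [X in _ <= X -> _]mulrC; apply: le_trans.
  by rewrite le_eqVlt; apply/orP; left; apply/eqP; congr cabs; rewrite [z + h]addrC; ring.
by move=> /[dup] /cvgP c1 /cvg_lim <-.
Qed.

Lemma derivable_cdiff f z : derivable (f : R[i]^o -> R[i]^o) z 1 ->
  cdiff f z (cderiv f z).
Proof.
move=> /cderivP H e e0; have [d d0 Hd] := H e e0; exists d => // h hd.
have [->|h0] := eqVneq h 0.
  by rewrite addr0 mul0r !subrr ComplexField.Normc.normc0 mulr0.
have := Hd h h0 hd; rewrite addrC => /ltW K.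
rewrite [X in _ <= X]mulrC; apply: le_trans (ler_wpM2l (cabs_ge0 h) K).
rewrite -cabsM le_eqVlt; apply/orP; left; apply/eqP; congr cabs.
by rewrite (addrC h z); field.
Qed.

Lemma cdiff_derivable f z l : cdiff f z l ->
  derivable (f : R[i]^o -> R[i]^o) z 1.
Proof. by move=> /cdiff_is_derive []. Qed.

Lemma cdiff_cderiv f z l : cdiff f z l -> cderiv f z = l.
Proof. by move=> /cdiff_is_derive [_]; rewrite /cderiv derive1E. Qed.

Lemma is_derive_cdiff f z l : is_derive (z : R[i]^o) 1 (f : R[i]^o -> R[i]^o) l ->
  cdiff f z l.
Proof.
move=> [d1 d2]; have -> : l = cderiv f z by rewrite /cderiv derive1E.
exact: derivable_cdiff.
Qed.

Lemma cdiff_ccts f z l : cdiff f z l -> ccts f z.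
Proof.
move=> /cdiff_derivable /analytic_cts H e /H[d d0 Hd]; exists d => // h hd.
by apply: Hd; rewrite addrC addKr.
Qed.

Lemma cdiffM f g z l m : cdiff f z l -> cdiff g z m ->
  cdiff (fun w => f w * g w) z (f z * m + l * g z).
Proof.
move=> df dg; apply: (@is_derive_cdiff (fun w => f w * g w)).
have H1 := cdiff_is_derive df; have H2 := cdiff_is_derive dg.
have := @is_deriveM _ R[i]^o f g z 1 l m H1 H2.
by move=> /is_derive_eq; apply; rewrite /GRing.scale /= (mulrC l).
Qed.

Lemma cdiffD f g z l m : cdiff f z l -> cdiff g z m ->
  cdiff (fun w => f w + g w) z (l + m).
Proof.
move=> /cdiff_is_derive H1 /cdiff_is_derive H2; apply: is_derive_cdiff.
Qed.

Lemma cdiff_id z : cdiff id z 1.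
Proof. apply: is_derive_cdiff. Qed.

Lemma cdiff_cst k z : cdiff (fun=> k) z 0.
Proof. apply: is_derive_cdiff. Qed.

Lemma cdiffV f z l : cdiff f z l -> f z != 0 ->
  cdiff (fun w => (f w)^-1) z (- (f z) ^- 2 * l).
Proof.
move=> /cdiff_is_derive [d1 d2] fz; apply: is_derive_cdiff; split.
  exact: (@derivableV R[i] R[i]^o f z 1 fz d1).
by have := @deriveV R[i] R[i]^o f z 1 fz d1; rewrite d2.
Qed.

Lemma ccts_path F (p v : R[i]) t :
  ccts F (p + t%:C%C * v) -> ccont_at (fun s => F (p + s%:C%C * v)) t.
Proof.
move=> H e /H[d d0 Hd]; have K0 : 0 < cabs v + 1 by rewrite ltr_wpDl ?cabs_ge0.
exists (d / (cabs v + 1)); first exact: divr_gt0.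
move=> s; rewrite ltr_pdivlMr// => sd.
have := Hd ((s - t)%:C%C * v); rewrite cabsM cabs_real.
have -> : p + t%:C%C * v + (s - t)%:C%C * v = p + s%:C%C * v.
  by rewrite rmorphB /=; ring.
apply; apply: le_lt_trans sd.
by rewrite ler_wpM2l// lerDl.
Qed.

Lemma cdiff_path F (p v : R[i]) t l :
  cdiff F (p + t%:C%C * v) l -> path_diff (fun s => F (p + s%:C%C * v)) t (v * l).
Proof.
move=> H e e0; have K0 : 0 < cabs v + 1 by rewrite ltr_wpDl ?cabs_ge0.
have [d d0 Hd] := H _ (divr_gt0 e0 K0).
exists (d / (cabs v + 1)); first exact: divr_gt0.
move=> s; rewrite ltr_pdivlMr// => sd.
have := Hd ((s - t)%:C%C * v); rewrite cabsM cabs_real.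
have -> : p + t%:C%C * v + (s - t)%:C%C * v = p + s%:C%C * v.
  by rewrite rmorphB /=; ring.
rewrite mulrA => HH; apply: le_trans (HH _) _.
  by apply: le_lt_trans sd; rewrite ler_wpM2l// lerDl.
rewrite (mulrC (`|_|)) mulrA ler_wpM2r// -mulrA ger_pMr// mulrC ler_pdivrMr//.
by rewrite mul1r lerDl.
Qed.

Lemma hpathE x y : Complex x y = Complex 0 y + x%:C%C * 1.
Proof. by apply/eqP; rewrite eq_complex /=; apply/andP; split; apply/eqP; ring. Qed.

Lemma vpathE x y : Complex x y = x%:C%C + y%:C%C * 'j.
Proof. by apply/eqP; rewrite eq_complex /=; apply/andP; split; apply/eqP; ring. Qed.

(** The counterclockwise integral over the boundary of [a, b] x [c, d]; on the vertical sides dw = i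
    dy. *)
Definition rectint f a b c d : R[i] :=
  cint a b (fun x => f (Complex x c)) - cint a b (fun x => f (Complex x d)) +
  'j * (cint c d (fun y => f (Complex b y)) - cint c d (fun y => f (Complex a y))).

Definition redge a b c d x y :=
  a <= x <= b /\ (y = c \/ y = d) \/ (x = a \/ x = b) /\ c <= y <= d.

Definition rcont f a b c d := forall x y, redge a b c d x y -> ccts f (Complex x y).

Lemma ccts_h f x y : ccts f (Complex x y) -> ccont_at (fun x => f (Complex x y)) x.
Proof.
rewrite hpathE => /ccts_path; congr (ccont_at _ _).
by apply/funext => s; rewrite -hpathE.
Qed.

Lemma ccts_v f x y : ccts f (Complex x y) -> ccont_at (fun y => f (Complex x y)) y.
Proof.
rewrite vpathE => /ccts_path; congr (ccont_at _ _).
by apply/funext => s; rewrite -vpathE.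
Qed.

Lemma rcontE f a b c d : rcont f a b c d ->
  [/\ ccont a b (fun x => f (Complex x c)), ccont a b (fun x => f (Complex x d)),
      ccont c d (fun y => f (Complex a y)) & ccont c d (fun y => f (Complex b y))].
Proof.
by move=> H; split=> t tab; [apply: ccts_h|apply: ccts_h|apply: ccts_v|apply: ccts_v];
  apply: H; [left|left|right|right]; split; auto.
Qed.

Lemma rectintD f g a b c d : rcont f a b c d -> rcont g a b c d ->
  rectint (fun z => f z + g z) a b c d = rectint f a b c d + rectint g a b c d.
Proof.
move=> /rcontE[f1 f2 f3 f4] /rcontE[g1 g2 g3 g4].
by rewrite /rectint !cintD//; ring.
Qed.

Lemma rectintZ f k a b c d : rcont f a b c d ->
  rectint (fun z => k * f z) a b c d = k * rectint f a b c d.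
Proof. by move=> /rcontE[f1 f2 f3 f4]; rewrite /rectint !cintZ//; ring. Qed.

Lemma eq_rectint f g a b c d : a <= b -> c <= d ->
  (forall x y, redge a b c d x y -> f (Complex x y) = g (Complex x y)) ->
  rectint f a b c d = rectint g a b c d.
Proof.
move=> ab cd H; rewrite /rectint; congr (_ - _ + 'j * (_ - _)); apply: eq_cint => t tab;
  apply: H; rewrite /redge; auto.
Qed.

(** The perimeter is 2 ((b - a) + (d - c)), and bounding complex integrals through their components
    costs another factor 2. *)
Lemma rectint_bound f a b c d M : a <= b -> c <= d -> rcont f a b c d ->
  (forall x y, redge a b c d x y -> cabs (f (Complex x y)) <= M) ->
  cabs (rectint f a b c d) <= 4 * M * ((b - a) + (d - c)).
Proof.
move=> ab cd /rcontE[f1 f2 f3 f4] H.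
have H1 : cabs (cint a b (fun x => f (Complex x c))) <= 2 * M * (b - a).
  by apply: cabs_cint_bound => // t tab; apply: H; left; auto.
have H2 : cabs (cint a b (fun x => f (Complex x d))) <= 2 * M * (b - a).
  by apply: cabs_cint_bound => // t tab; apply: H; left; auto.
have H3 : cabs (cint c d (fun y => f (Complex a y))) <= 2 * M * (d - c).
  by apply: cabs_cint_bound => // t tab; apply: H; right; auto.
have H4 : cabs (cint c d (fun y => f (Complex b y))) <= 2 * M * (d - c).
  by apply: cabs_cint_bound => // t tab; apply: H; right; auto.
apply: le_trans (cabsD _ _) _; rewrite cabsM.
have -> : cabs 'j = 1 by rewrite /ComplexField.Normc.normc expr0n /= expr1n add0r sqrtr1.
have := cabsD (cint a b (fun x => f (Complex x c))) (- cint a b (fun x => f (Complex x d))).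
have := cabsD (cint c d (fun y => f (Complex b y))) (- cint c d (fun y => f (Complex a y))).
rewrite !cabsN; lra.
Qed.

(** Each side contributes the difference of [F] at its end points, and the four differences cancel
    around the rectangle. *)
Lemma rectint_prim F f a b c d : a <= b -> c <= d -> rcont f a b c d ->
  (forall x y, redge a b c d x y -> cdiff F (Complex x y) (f (Complex x y))) ->
  rectint f a b c d = 0.
Proof.
move=> ab cd /rcontE[f1 f2 f3 f4] H; rewrite /rectint.
have h y : y = c \/ y = d -> ccont a b (fun x => f (Complex x y)) ->
    cint a b (fun x => f (Complex x y)) = F (Complex b y) - F (Complex a y).
  move=> ycd cf.
  rewrite (@cint_FTC _ _ _ (fun x => F (Complex x y)))// => t tab.
  have K : cdiff F (Complex 0 y + t%:C%C * 1) (f (Complex t y)).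
    by rewrite -hpathE; apply: H; left.
  have -> : (fun x => F (Complex x y)) =
    (fun s => F (Complex 0 y + s%:C%C * 1)) by apply/funext => s; rewrite -hpathE.
  by have := cdiff_path K; rewrite mul1r.
have v x : x = a \/ x = b -> ccont c d (fun y => f (Complex x y)) ->
    'j * cint c d (fun y => f (Complex x y)) = F (Complex x d) - F (Complex x c).
  move=> xab cf; rewrite -cintZ//.
  rewrite (@cint_FTC _ _ _ (fun y => F (Complex x y)))//.
    exact: ccontZ.
  move=> t tab.
  have K : cdiff F (x%:C%C + t%:C%C * 'j) (f (Complex x t)).
    by rewrite -vpathE; apply: H; right.
  have -> : (fun y => F (Complex x y)) =
    (fun s => F (x%:C%C + s%:C%C * 'j)) by apply/funext => s; rewrite -vpathE.
  exact: cdiff_path K.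
rewrite mulrBr !v ?h//; auto; ring.
Qed.

Lemma rectint_splitx f a b c d m : a <= m -> m <= b -> c <= d ->
  (forall x, a <= x <= b -> ccts f (Complex x c) /\ ccts f (Complex x d)) ->
  rectint f a b c d = rectint f a m c d + rectint f m b c d.
Proof.
move=> am mb cd H; rewrite /rectint.
rewrite (@cint_split _ a m b)//; last by move=> t /H[/ccts_h].
rewrite (@cint_split _ a m b (fun x => f (Complex x d)))//; last by move=> t /H[_ /ccts_h].
ring.
Qed.

Lemma rectint_splity f a b c d m : c <= m -> m <= d -> a <= b ->
  (forall y, c <= y <= d -> ccts f (Complex a y) /\ ccts f (Complex b y)) ->
  rectint f a b c d = rectint f a b c m + rectint f a b m d.
Proof.
move=> am mb cd H; rewrite /rectint.
rewrite (@cint_split _ c m d)//; last by move=> t /H[_ /ccts_v].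
rewrite (@cint_split _ c m d (fun x => f (Complex a x)))//; last by move=> t /H[/ccts_v].
ring.
Qed.

End rectangle.

(** * Cauchy's formula *)

Section bisection.
Variable R : realType.
Implicit Types (a b c d x y e w h : R).

(** The supremum of the left end points is a common point. *)
Lemma nested_itv (u v : nat -> R) : (forall k, u k <= v k) ->
  (forall k, u k <= u k.+1) -> (forall k, v k.+1 <= v k) ->
  exists X, forall k, u k <= X <= v k.
Proof.
move=> uv ui vd.
have uim i j : (i <= j)%N -> u i <= u j.
  move=> /subnK <-; elim: (j - i)%N => // n /le_trans; apply; exact: ui.
have vdm i j : (i <= j)%N -> v j <= v i.
  move=> /subnK <-; elim: (j - i)%N => // n; apply: le_trans; exact: vd.
have uvij i j : u i <= v j.
  have [ij|/ltnW ji] := leqP i j; first exact: le_trans (uim _ _ ij) (uv _).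
  exact: le_trans (uv _) (vdm _ _ ji).
exists (sup (range u)) => k; apply/andP; split.
  apply: ub_le_sup; last by exists k.
  by exists (v 0%N) => _ [j _ <-].
apply: ge_sup; first by exists (u 0%N), 0%N.
by move=> _ [j _ <-].
Qed.

Lemma half_pow_small w e : 0 <= w -> 0 < e -> exists K : nat,
  forall k, (K <= k)%N -> w / 2 ^+ k < e.
Proof.
move=> w0 e0; exists (Num.truncn (w / e)).+1 => k Kk.
have K1 : w / e < k%:R.
  apply: lt_le_trans (truncnS_gt _) _; by rewrite ler_nat.
have k2 : k%:R <= 2 ^+ k :> R by rewrite -natrX ler_nat ltnW// ltn_expl.
by rewrite ltr_pdivrMr ?exprn_gt0// mulrC -ltr_pdivrMr//; exact: lt_le_trans k2.
Qed.

Variable Phi : R -> R -> R -> R -> R.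

(* If [Phi > e (w + h)^2] on a rectangle, the same holds on one of its quarters. *)
Lemma rect_bisect a b c d : a <= b -> c <= d ->
  (forall x y w h, 0 <= w -> 0 <= h -> a <= x -> x + w <= b -> c <= y -> y + h <= d ->
    Phi x (x + w) y (y + h) <=
      Phi x (x + w / 2) y (y + h / 2) + Phi (x + w / 2) (x + w) y (y + h / 2) +
      (Phi x (x + w / 2) (y + h / 2) (y + h) + Phi (x + w / 2) (x + w) (y + h / 2) (y + h))) ->
  (forall x y, a <= x <= b -> c <= y <= d -> forall e, 0 < e -> exists2 dl : R, 0 < dl &
    forall a' b' c' d', a <= a' -> a' <= x <= b' -> b' <= b ->
      c <= c' -> c' <= y <= d' -> d' <= d -> b' - a' < dl -> d' - c' < dl ->
      Phi a' b' c' d' <= e * ((b' - a') + (d' - c')) ^+ 2) ->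
  Phi a b c d <= 0.
Proof.
move=> ab cd sub loc; rewrite leNgt; apply/negP => Phi0.
set S := ((b - a) + (d - c)) ^+ 2.
(* If the rectangle is a single point, the local hypothesis applies to the rectangle itself. *)
have [S0|S0] := ltP 0 S; last first.
  have ba : (b - a) + (d - c) = 0.
    by apply/eqP; rewrite -sqrf_eq0 -/S eq_le S0 /S sqr_ge0.
  have [dl dl0 H] := loc a c ltac:(lra) ltac:(lra) 1 ltr01.
  have : Phi a b c d <= 1 * ((b - a) + (d - c)) ^+ 2 by apply: H; lra.
  rewrite ba expr0n mulr0; lra.
(* Half of the ratio, so that [Phi > e * S] holds strictly on the starting rectangle. *)
pose e := Phi a b c d / (2 * S).
have e0 : 0 < e by rewrite divr_gt0// mulr_gt0.
pose w k := (b - a) / 2 ^+ k; pose h k := (d - c) / 2 ^+ k.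
have w0 k : 0 <= w k by rewrite divr_ge0 ?subr_ge0// exprn_ge0.
have h0 k : 0 <= h k by rewrite divr_ge0 ?subr_ge0// exprn_ge0.
have wS k : w k.+1 = w k / 2 by rewrite /w exprS; field; rewrite expf_neq0.
have hS k : h k.+1 = h k / 2 by rewrite /h exprS; field; rewrite expf_neq0.
pose bad k (p : R * R) := e * (w k + h k) ^+ 2 < Phi p.1 (p.1 + w k) p.2 (p.2 + h k).
(* Move to the first quarter found bad, the upper right one being the default. The default is bad
   when the other three are not, because the four bounds e ((w + h) / 2)^2 add up to e (w + h)^2. *)
pose step k (p : R * R) :=
  if bad k.+1 p then p else
  if bad k.+1 (p.1 + w k.+1, p.2) then (p.1 + w k.+1, p.2) else
  if bad k.+1 (p.1, p.2 + h k.+1) then (p.1, p.2 + h k.+1) else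
  (p.1 + w k.+1, p.2 + h k.+1).
pose s := fix s k := if k is k'.+1 then step k' (s k') else (a, c).
have stepP k : [/\ (s k).1 <= (s k.+1).1, (s k.+1).1 + w k.+1 <= (s k).1 + w k,
    (s k).2 <= (s k.+1).2 & (s k.+1).2 + h k.+1 <= (s k).2 + h k].
  have w'0 : 0 <= w k.+1 by []; have h'0 : 0 <= h k.+1 by [].
  have wS' : w k = w k.+1 + w k.+1 by rewrite wS -splitr.
  have hS' : h k = h k.+1 + h k.+1 by rewrite hS -splitr.
  rewrite [s k.+1]/= /step wS' hS'.
  by do 3?[case: ifP => _] => /=; rewrite !addrA ?lerDl ?lexx ?lerD2r ?lerDl //;
    split=> //; rewrite ?addrA ?lerD2r ?lerDl// -?addrA ?lerD2l ?lerDr//.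
have inv k : [/\ a <= (s k).1, (s k).1 + w k <= b, c <= (s k).2 & (s k).2 + h k <= d].
  elim: k => [|k [i1 i2 i3 i4]]; first by rewrite /= /w /h expr0 !divr1 !subrKC; split.
  have [j1 j2 j3 j4] := stepP k; split.
  - exact: le_trans j1.
  - exact: le_trans i2.
  - exact: le_trans j3.
  - exact: le_trans i4.
have badP k : bad k (s k).
  elim: k => [|k IH].
    rewrite /bad /= /w /h expr0 !divr1 !subrKC -/S.
    have -> : e * S = Phi a b c d / 2 by rewrite /e; field; rewrite gt_eqF.
    by rewrite ltr_pdivrMr// ltr_pMr// ltr1n.
  rewrite [s k.+1]/= /step; case: ifPn => // B1; case: ifPn => // B2; case: ifPn => // B3.
  apply/negPn/negP => B4; move: B1 B2 B3 B4 IH.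
  rewrite /bad /= -!leNgt => B1 B2 B3 B4.
  have [i1 i2 i3 i4] := inv k.
  have := sub _ _ _ _ (w0 k) (h0 k) i1 i2 i3 i4.
  move: B1 B2 B3 B4; rewrite !wS !hS.
  have -> x : x + w k / 2 + w k / 2 = x + w k by lra.
  have -> x : x + h k / 2 + h k / 2 = x + h k by lra.
  have -> : (w k / 2 + h k / 2) ^+ 2 = (w k + h k) ^+ 2 / 4 by field.
  lra.
have [X HX] := @nested_itv (fun k => (s k).1) (fun k => (s k).1 + w k)
  ltac:(by move=> k; rewrite lerDl) ltac:(by move=> k; have [] := stepP k)
  ltac:(by move=> k; have [] := stepP k).
have [Y HY] := @nested_itv (fun k => (s k).2) (fun k => (s k).2 + h k)
  ltac:(by move=> k; rewrite lerDl) ltac:(by move=> k; have [] := stepP k)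
  ltac:(by move=> k; have [] := stepP k).
have Xab : a <= X <= b by have := HX 0%N; rewrite /= /w expr0; lra.
have Yab : c <= Y <= d by have := HY 0%N; rewrite /= /h expr0; lra.
have [dl dl0 H] := loc X Y Xab Yab e e0.
have [K1 HK1] := @half_pow_small (b - a) dl ltac:(lra) dl0.
have [K2 HK2] := @half_pow_small (d - c) dl ltac:(lra) dl0.
pose k := maxn K1 K2.
have [i1 i2 i3 i4] := inv k.
have := H _ _ _ _ i1 (HX k) i2 i3 (HY k) i4.
have E1 (u v : R) : u + v - u = v by rewrite addrAC subrr add0r.
rewrite !E1.
move=> /(_ (HK1 _ (leq_maxl _ _)) (HK2 _ (leq_maxr _ _))).
by apply/negP; rewrite -ltNge; exact: badP.
Qed.

End bisection.

(** * Goursat's lemma and the deformation of rectangles *)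

Section cauchy.
Variable R : realType.
Implicit Types (a b c d t s e x y r : R) (z w h l : R[i]) (f F : R[i] -> R[i]).
Local Notation "'j" := (Complex 0 1 : R[i]).

Lemma cabs_small_pt x y x' y' r : `|x' - x| <= r -> `|y' - y| <= r ->
  cabs (Complex x' y' - Complex x y) <= 2 * r.
Proof.
move=> H1 H2; have -> : Complex x' y' - Complex x y = Complex (x' - x) (y' - y).
  by apply/eqP; rewrite eq_complex /= !eqxx.
apply: le_trans (cabs_box _ _) _; lra.
Qed.

Lemma rectint_affine (u v : R[i]) a b c d : a <= b -> c <= d ->
  rectint (fun z => u + v * z) a b c d = 0.
Proof.
move=> ab cd; have dA z : cdiff (fun z => u + v * z) z (0 + (v * 1 + 0 * z)).
  by apply: cdiffD; [exact: cdiff_cst|apply: cdiffM; [exact: cdiff_cst|exact: cdiff_id]].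
apply: (@rectint_prim _ (fun z => u * z + (v / 2) * (z * z))) => //.
  by move=> x y _; exact: cdiff_ccts (dA _).
move=> x y _; set z := Complex x y.
have := cdiffD (cdiffM (cdiff_cst u z) (cdiff_id z))
  (cdiffM (cdiff_cst (v/2) z) (cdiffM (cdiff_id z) (cdiff_id z))).
by congr (cdiff _ _ _); field.
Qed.

Lemma redge_in a b c d x y : a <= b -> c <= d -> redge a b c d x y ->
  a <= x <= b /\ c <= y <= d.
Proof. by move=> ? ? [[? [->|->]]|[[->|->] ?]]; split; lra. Qed.

(** Bisection, applied to the modulus of the integral. Near a point [f] is affine up to a small
    multiple of the distance. The affine part has a primitive and integrates to 0; a remainder
    proportional to the size of the rectangle, on a boundary of comparable length, gives the
    quadratic bound that bisection asks for. *)
Lemma goursat f a b c d : a <= b -> c <= d ->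
  (forall x y, a <= x <= b -> c <= y <= d -> exists l, cdiff f (Complex x y) l) ->
  rectint f a b c d = 0.
Proof.
move=> ab cd H.
have cf x y : a <= x <= b -> c <= y <= d -> ccts f (Complex x y).
  by move=> xab ycd; have [l /cdiff_ccts] := H x y xab ycd.
suff : cabs (rectint f a b c d) <= 0.
  move=> f0; apply/eqP; have := cabs_ge0 (rectint f a b c d); move=> f0'.
  by apply/eqP/ComplexField.Normc.eq0_normc/eqP; rewrite eq_le f0 f0'.
apply: (@rect_bisect _ (fun a b c d => cabs (rectint f a b c d))) => //.
  move=> x y w h w0 h0 ax xb cy yd.
  have E x1 x2 y1 y2 : a <= x1 -> x1 <= x2 -> x2 <= b -> c <= y1 -> y1 <= y2 -> y2 <= d ->
      rectint f x1 x2 y1 y2 = rectint f x1 ((x1 + x2) / 2) y1 y2 + rectint f ((x1 + x2) / 2) x2 y1 y2.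
    move=> *; rewrite -rectint_splitx//; [lra|lra|].
    by move=> t ?; split; apply: cf; lra.
  have E' x1 x2 y1 y2 : a <= x1 -> x1 <= x2 -> x2 <= b -> c <= y1 -> y1 <= y2 -> y2 <= d ->
      rectint f x1 x2 y1 y2 = rectint f x1 x2 y1 ((y1 + y2) / 2) + rectint f x1 x2 ((y1 + y2) / 2) y2.
    move=> *; rewrite -rectint_splity//; [lra|lra|].
    by move=> t ?; split; apply: cf; lra.
  have mx : (x + (x + w)) / 2 = x + w / 2 by lra.
  have my : (y + (y + h)) / 2 = y + h / 2 by lra.
  have := E' x (x + w) y (y + h) ltac:(lra) ltac:(lra) ltac:(lra) ltac:(lra) ltac:(lra) ltac:(lra).
  have := E x (x + w) y (y + h / 2) ltac:(lra) ltac:(lra) ltac:(lra) ltac:(lra) ltac:(lra) ltac:(lra).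
  have := E x (x + w) (y + h / 2) (y + h) ltac:(lra) ltac:(lra) ltac:(lra) ltac:(lra) ltac:(lra) ltac:(lra).
  rewrite mx my => -> -> ->.
  by apply: le_trans (cabsD _ _) _; apply: lerD; exact: cabsD.
move=> x y xab ycd e e0; have [l fl] := H x y xab ycd.
(* With W the half perimeter, the remainder on the boundary is at most (e / 8) * 2 W, which
   [rectint_bound] turns into 4 * (e / 8) * 2 W * W = e W^2. *)
have e160 : 0 < e / 8 by lra.
have [dl dl0 Hd] := fl _ e160; exists (dl / 2); first lra.
move=> a' b' c' d' aa' xab' bb' cc' ycd' dd' wd hd.
have ab' : a' <= b' by lra.
have cd' : c' <= d' by lra.
set z := Complex x y.
pose g w := f w + ((l * z - f z) + - l * w).
have cA w : ccts (fun w => (l * z - f z) + - l * w) w.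
  apply: (@cdiff_ccts _ _ _ (0 + (- l * 1 + 0 * w))).
  by apply: cdiffD; [exact: cdiff_cst|apply: cdiffM; [exact: cdiff_cst|exact: cdiff_id]].
have rf : rcont f a' b' c' d'.
  by move=> x' y' /(redge_in ab' cd')[? ?]; apply: cf; lra.
have -> : rectint f a' b' c' d' = rectint g a' b' c' d'.
  rewrite rectintD; [|by []|by move=> x' y' _; exact: cA].
  by rewrite rectint_affine ?addr0.
have rg : rcont g a' b' c' d'.
  move=> x' y' /(redge_in ab' cd')[? ?].
  have [l' fl'] := H x' y' ltac:(lra) ltac:(lra).
  apply: (@cdiff_ccts _ _ _ (l' + (0 + (- l * 1 + 0 * Complex x' y')))).
  apply: cdiffD => //.
  by apply: cdiffD; [exact: cdiff_cst|apply: cdiffM; [exact: cdiff_cst|exact: cdiff_id]].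
set W := b' - a' + (d' - c').
have -> : e * W ^+ 2 = 4 * (e / 8 * (2 * W)) * W by field.
apply: rectint_bound => //.
move=> x' y' /(redge_in ab' cd')[? ?].
have zz : cabs (Complex x' y' - z) <= 2 * (W / 2) + W.
  apply: le_trans (_ : cabs (Complex (x' - x) (y' - y)) <= _).
    rewrite le_eqVlt; apply/orP; left; apply/eqP; congr cabs.
  apply: le_trans (cabs_box _ _) _.
  have : `|x' - x| <= b' - a' by rewrite ler_norml; lra.
  have : `|y' - y| <= d' - c' by rewrite ler_norml; lra.
  rewrite /W; lra.
have zd : cabs (Complex x' y' - z) < dl.
  apply: le_lt_trans (_ : cabs (Complex (x' - x) (y' - y)) < _).
    rewrite le_eqVlt; apply/orP; left; apply/eqP; congr cabs.
  apply: le_lt_trans (cabs_box _ _) _.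
  have : `|x' - x| <= b' - a' by rewrite ler_norml; lra.
  have : `|y' - y| <= d' - c' by rewrite ler_norml; lra.
  lra.
have := Hd _ zd; rewrite (addrC z) subrK.
have -> : f (Complex x' y') - f z - (Complex x' y' - z) * l = g (Complex x' y').
  by rewrite /g; ring.
move=> /le_trans; apply; rewrite ler_wpM2l//; lra.
Qed.

(** Four cuts leave the square around [z] in the middle and four rectangles that avoid [z], to which
    Goursat's lemma applies; [F] may be singular at [z]. *)
Lemma rectint_deform F a b c d (z : R[i]) t : 0 < t ->
  a <= complex.Re z - t -> complex.Re z + t <= b ->
  c <= complex.Im z - t -> complex.Im z + t <= d ->
  (forall x y, a <= x <= b -> c <= y <= d -> Complex x y != z ->
     exists l, cdiff F (Complex x y) l) ->
  rectint F a b c d = rectint F (complex.Re z - t) (complex.Re z + t)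
                              (complex.Im z - t) (complex.Im z + t).
Proof.
case: z => p q /= t0 ap pb cq qd H.
have cF x y : a <= x <= b -> c <= y <= d -> x != p \/ y != q -> ccts F (Complex x y).
  move=> xab ycd xy; have [|l /cdiff_ccts//] := H x y xab ycd.
  by rewrite eq_complex /= negb_and; apply/orP.
have cFx x y : a <= x <= b -> c <= y <= d -> x < p \/ p < x -> ccts F (Complex x y).
  by move=> ? ? xp; apply: cF => //; left; rewrite neq_lt; apply/orP.
have cFy x y : a <= x <= b -> c <= y <= d -> y < q \/ q < y -> ccts F (Complex x y).
  by move=> ? ? xp; apply: cF => //; right; rewrite neq_lt; apply/orP.
rewrite (@rectint_splitx _ _ a b c d (p - t)); [|lra|lra|lra|]; last first.
  by move=> x xab; split; apply: cFy; lra.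
rewrite (@rectint_splitx _ _ (p - t) b c d (p + t)); [|lra|lra|lra|]; last first.
  by move=> x xab; split; apply: cFy; lra.
rewrite (@rectint_splity _ _ _ (p + t) c d (q - t)); [|lra|lra|lra|]; last first.
  by move=> x xab; split; apply: cFx; lra.
rewrite (@rectint_splity _ _ _ (p + t) (q - t) d (q + t)); [|lra|lra|lra|]; last first.
  by move=> x xab; split; apply: cFx; lra.
have G a' b' c' d' : a <= a' -> a' <= b' -> b' <= b -> c <= c' -> c' <= d' -> d' <= d ->
    b' < p \/ p < a' \/ d' < q \/ q < c' -> rectint F a' b' c' d' = 0.
  move=> *; apply: goursat => // x y xab ycd; apply: H; [lra|lra|].
  rewrite eq_complex /= negb_and !neq_lt; apply/orP.
  have [|[|[|]]] : x < p \/ p < x \/ y < q \/ q < y by lra.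
  - by move=> ->; left.
  - by move=> ->; left; rewrite orbT.
  - by move=> ->; right.
  - by move=> ->; right; rewrite orbT.
have -> : rectint F a (p - t) c d = 0 by apply: G; lra.
have -> : rectint F (p + t) b c d = 0 by apply: G; lra.
have -> : rectint F (p - t) (p + t) c (q - t) = 0 by apply: G; lra.
have -> : rectint F (p - t) (p + t) (q + t) d = 0 by apply: G; lra.
by rewrite !addr0 !add0r.
Qed.

End cauchy.

(** * The Cauchy kernel and Cauchy's integral formula *)

Section kernel.
Variable R : realType.
Implicit Types (a b c d t s e x y r p q M : R) (z w h l : R[i]) (f F : R[i] -> R[i]).
Local Notation "'j" := (Complex 0 1 : R[i]).
Local Notation mu := (@lebesgue_measure R).

Lemma atan_kernel_continuous p t x : 0 < t ->
  {for x, continuous (fun x : R => t / ((x - p) ^+ 2 + t ^+ 2))}.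
Proof.
move=> t0.
have D0 : (x - p) ^+ 2 + t ^+ 2 != 0.
  by rewrite gt_eqF// ltr_wpDl ?sqr_ge0// exprn_gt0.
have cx : {for x, continuous (fun x : R => x - p)}.
  by apply: continuousB; [exact: cvg_id|exact: cvg_cst].
have c1 : {for x, continuous (fun x : R => (x - p) ^+ 2 + t ^+ 2)}.
  by apply: continuousD; [exact: (continuousM cx cx)|exact: cvg_cst].
have c2 : {for x, continuous (fun x : R => ((x - p) ^+ 2 + t ^+ 2)^-1)}.
  exact: (@continuousV _ _ (fun x : R => (x - p) ^+ 2 + t ^+ 2)).
exact: (@continuousM R R (fun=> t) _ x (@cst_continuous _ _ t x) c2).
Qed.

Lemma integral_atan p t a b : 0 < t -> a < b ->
  (\int[mu]_(x in `[a, b]) (t / ((x - p) ^+ 2 + t ^+ 2))%:E =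
   (atan ((b - p) / t) - atan ((a - p) / t))%:E)%E.
Proof.
move=> t0 ab.
have D0 x : (x - p) ^+ 2 + t ^+ 2 != 0.
  by rewrite gt_eqF// ltr_wpDl ?sqr_ge0// exprn_gt0.
have dA x : is_derive x 1 (fun x => atan ((x - p) / t)) (t / ((x - p) ^+ 2 + t ^+ 2)).
  have d1 : is_derive x 1 (fun x : R => (x - p) / t) (t^-1).
    have -> : (fun x : R => (x - p) / t) = (fun x : R => t^-1 *: (x - p)).
      by apply/funext => u; rewrite /GRing.scale /= mulrC.
    by apply: is_derive_eq; rewrite subr0 /GRing.scale /= mulr1.
  have d2 := @is_derive1_comp _ (@atan R) (fun x : R => (x - p) / t) x _ _ (is_derive1_atan _) d1.
  move: d2 => /is_derive_eq; apply; rewrite /GRing.scale /=; field; by rewrite D0 gt_eqF.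
rewrite (@continuous_FTC2 _ _ (fun x => atan ((x - p) / t)))//.
- by apply: continuous_in_subspaceT => x _; exact: atan_kernel_continuous.
- have cA x : {for x, continuous (fun x => atan ((x - p) / t))}.
    have [d1 _] := dA x.
    by apply: differentiable_continuous; exact/derivable1_diffP.
  split; first by move=> x _; have [] := dA x.
    by apply: cvg_at_right_filter; exact: cA.
  by apply: cvg_at_left_filter; exact: cA.
- by move=> x _; have [_ <-] := dA x; rewrite derive1E.
Qed.

(** On a square centred at [z] the integrals of [B] agree on opposite sides and cancel, so that no
    logarithm has to be evaluated. The integrals of [A] are differences of arctangents at 1 and -1,
    and each of the four sides contributes pi / 2. *)
Lemma rectint_kernel z t : 0 < t ->
  rectint (fun w => (w - z)^-1) (complex.Re z - t) (complex.Re z + t)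
    (complex.Im z - t) (complex.Im z + t) = (2 * pi)%:C%C * 'j.
Proof.
case: z => p q /= t0.
pose A p x := t / ((x - p) ^+ 2 + t ^+ 2); pose B p x := (x - p) / ((x - p) ^+ 2 + t ^+ 2).
have Aint m : \int[mu]_(x in `[m - t, m + t]) A m x = pi / 2.
  rewrite /Rintegral /A integral_atan ?gtr0_norm//; last by lra.
  have -> : (m + t - m) / t = 1 by field; rewrite gt_eqF.
  have -> : (m - t - m) / t = - 1 by field; rewrite gt_eqF.
  by rewrite atanN atan1 /=; lra.
have ANint m : \int[mu]_(x in `[m - t, m + t]) (- A m x) = - (pi / 2).
  suff iA : mu.-integrable `[m - t, m + t] (EFin \o A m).
    transitivity (\int[mu]_(x in `[m - t, m + t]) (-1 * A m x)).
      by apply: eq_Rintegral => x _; rewrite mulN1r.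
    by rewrite RintegralZl// Aint mulN1r.
  apply: continuous_compact_integrable; first exact: segment_compact.
  by apply: continuous_in_subspaceT => x _; exact: atan_kernel_continuous.
have inv (x y : R) : x ^+ 2 + y ^+ 2 != 0 -> (Complex x y)^-1 =
    Complex (x / (x ^+ 2 + y ^+ 2)) (- y / (x ^+ 2 + y ^+ 2)) :> R[i].
  by move=> _; apply/eqP; rewrite eq_complex /= !eqxx /= mulNr eqxx.
have sub (x y u v : R) : (Complex x y : R[i]) - Complex u v = Complex (x - u) (y - v).
  by apply/eqP; rewrite eq_complex /= !eqxx.
have D0 x : x ^+ 2 + t ^+ 2 != 0.
  by rewrite gt_eqF// ltr_wpDl ?sqr_ge0// exprn_gt0.
have D0' x : t ^+ 2 + x ^+ 2 != 0 by rewrite addrC.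
have e1 : cint (p - t) (p + t) (fun x => (Complex x (q - t) - Complex p q)^-1) =
   Complex (\int[mu]_(x in `[p - t, p + t]) B p x) (pi / 2).
  rewrite -(Aint p); congr Complex; apply: eq_Rintegral => x _;
   rewrite sub (addrC q) addrK inv ?sqrrN//=.
  by rewrite opprK.
have e2 : cint (p - t) (p + t) (fun x => (Complex x (q + t) - Complex p q)^-1) =
   Complex (\int[mu]_(x in `[p - t, p + t]) B p x) (- (pi / 2)).
  rewrite -(ANint p); congr Complex; apply: eq_Rintegral => x _;
   rewrite sub (addrC q) addrK inv//=.
  by rewrite /A mulNr.
have e3 : cint (q - t) (q + t) (fun y => (Complex (p + t) y - Complex p q)^-1) =
   Complex (pi / 2) (\int[mu]_(x in `[q - t, q + t]) (- B q x)).
  rewrite -(Aint q); congr Complex; apply: eq_Rintegral => x _;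
   rewrite sub (addrC p) addrK inv// (addrC (t ^+ 2))//=.
  by rewrite /B mulNr.
have e4 : cint (q - t) (q + t) (fun y => (Complex (p - t) y - Complex p q)^-1) =
   Complex (- (pi / 2)) (\int[mu]_(x in `[q - t, q + t]) (- B q x)).
  rewrite -(ANint q); congr Complex; apply: eq_Rintegral => x _;
   rewrite sub (addrC p) addrK inv ?sqrrN// (addrC (t ^+ 2))//=.
    by rewrite /A mulNr.
  by rewrite /B mulNr.
rewrite /rectint e1 e2 e3 e4.
by apply/eqP; rewrite eq_complex /=; apply/andP; split; apply/eqP; field.
Qed.

Definition inrect a b c d z t :=
  [/\ a <= complex.Re z - t, complex.Re z + t <= b,
      c <= complex.Im z - t & complex.Im z + t <= d].

Lemma redge_far a b c d z t x y : 0 <= t -> inrect a b c d z t ->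
  redge a b c d x y -> t <= cabs (Complex x y - z).
Proof.
move=> t0 [h1 h2 h3 h4] H.
have [H1|H1] : t <= `|x - complex.Re z| \/ t <= `|y - complex.Im z|.
  have F u : t <= u \/ u <= - t -> t <= `|u|.
    by move=> [H1|H1]; rewrite ler_normr; apply/orP; [left|right; rewrite lerNr].
  by move: H => [[_ [->|->]]|[[->|->] _]]; [right|right|left|left]; apply: F; lra.
- by apply: le_trans H1 (le_trans _ (normr_Re_le _)); case: z {h1 h2 h3 h4}.
- by apply: le_trans H1 (le_trans _ (normr_Im_le _)); case: z {h1 h2 h3 h4}.
Qed.

Definition cdiff_on f a b c d := forall x y, a <= x <= b -> c <= y <= d ->
  exists l, cdiff f (Complex x y) l.

Lemma cdiff_inv_sub z w : w != z -> exists l, cdiff (fun w => (w - z)^-1) w l.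
Proof.
move=> wz; have H : cdiff (fun w => w - z) w (1 + 0).
  by apply: cdiffD; [exact: cdiff_id|exact: cdiff_cst].
by eexists; apply: (cdiffV H); rewrite subr_eq0.
Qed.

Lemma inrect_le a b c d z t : 0 <= t -> inrect a b c d z t -> a <= b /\ c <= d.
Proof. by move=> t0 [? ? ? ?]; split; lra. Qed.

Lemma redge_neq a b c d z t x y : 0 < t -> inrect a b c d z t ->
  redge a b c d x y -> Complex x y != z.
Proof.
move=> t0 ir H; apply/eqP => xz; have := redge_far (ltW t0) ir H.
by rewrite xz subrr ComplexField.Normc.normc0 leNgt t0.
Qed.

(** Replacing [f w] by [f w - f z] leaves a quotient that is bounded near [z]. Its integral can be
    moved to squares of half-side [s] around [z], where it is O(s), so it vanishes; what remains is
    [f z] times the integral of the kernel. *)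
Lemma cauchy_formula f a b c d z t : 0 < t -> inrect a b c d z t ->
  cdiff_on f a b c d ->
  rectint (fun w => f w * (w - z)^-1) a b c d = (2 * pi)%:C%C * 'j * f z.
Proof.
move=> t0 ir H; have [i1 i2 i3 i4] := ir; have [ab cd] := inrect_le (ltW t0) ir.
have Hz : exists l, cdiff f z l by case: z i1 i2 i3 i4 {ir} => p q /= *; apply: H; lra.
pose g w := f w * (w - z)^-1 + - f z * (w - z)^-1.
have dg x y : a <= x <= b -> c <= y <= d -> Complex x y != z ->
    (exists l, cdiff (fun w => f w * (w - z)^-1) (Complex x y) l) /\
    (exists l, cdiff (fun w => - f z * (w - z)^-1) (Complex x y) l).
  move=> xab ycd xz; have [l fl] := H _ _ xab ycd; have [l' fl'] := cdiff_inv_sub xz.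
  split; first by eexists; exact: (cdiffM fl fl').
  by eexists; exact: (cdiffM (cdiff_cst _ _) fl').
have dg' x y : a <= x <= b -> c <= y <= d -> Complex x y != z ->
    exists l, cdiff g (Complex x y) l.
  move=> xab ycd xz; have [[l1 d1] [l2 d2]] := dg _ _ xab ycd xz.
  by eexists; exact: cdiffD d1 d2.
have [r1 r2] : rcont (fun w => f w * (w - z)^-1) a b c d /\
     rcont (fun w => - f z * (w - z)^-1) a b c d.
  by split=> x y Hxy; have [xab ycd] := redge_in ab cd Hxy;
   have [[l1 d1] [l2 d2]] := dg _ _ xab ycd (redge_neq t0 ir Hxy);
   [exact: cdiff_ccts d1|exact: cdiff_ccts d2].
have r3 : rcont (fun w => (w - z)^-1) a b c d.
  by move=> x y Hxy; have [l /cdiff_ccts] := cdiff_inv_sub (redge_neq t0 ir Hxy).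
have E : rectint g a b c d = rectint (fun w => f w * (w - z)^-1) a b c d
    - (2 * pi)%:C%C * 'j * f z.
  have K : rectint (fun w => (w - z)^-1) a b c d = (2 * pi)%:C%C * 'j.
    rewrite (rectint_deform t0 i1 i2 i3 i4); first exact: rectint_kernel.
    by move=> x y _ _ /cdiff_inv_sub.
  by rewrite /g rectintD// rectintZ// K mulNr (mulrC (f z)).
suff g0 : rectint g a b c d = 0 by apply/eqP; rewrite -subr_eq0 -E g0.
have [l fl] := Hz.
have [dl dl0 Hd] := fl 1 ltr01.
pose K := cabs l + 1.
have K0 : 0 < K by rewrite ltr_wpDl ?cabs_ge0.
have small s : 0 < s -> s <= t -> 2 * s < dl -> cabs (rectint g a b c d) <= 16 * K * s.
  move=> s0 st sdl.
  rewrite (@rectint_deform _ _ a b c d z s)//; try lra.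
  have irs : inrect (complex.Re z - s) (complex.Re z + s) (complex.Im z - s)
     (complex.Im z + s) z s by [].
  have -> : 16 * K * s = 4 * K * ((complex.Re z + s - (complex.Re z - s)) +
       (complex.Im z + s - (complex.Im z - s))) by ring.
  have [ab' cd'] := inrect_le (ltW s0) irs.
  apply: rectint_bound => //.
    move=> x y Hxy; have [? ?] := redge_in ab' cd' Hxy.
    have [|||l' /cdiff_ccts//] := dg' x y; [lra|lra|exact: redge_neq irs Hxy].
  move=> x y Hxy; have [? ?] := redge_in ab' cd' Hxy.
  have xz := redge_neq s0 irs Hxy.
  set w := Complex x y in xz *.
  have wz0 : w - z != 0 by rewrite subr_eq0.
  have wz1 : 0 < cabs (w - z) by apply: lt_le_trans s0 (redge_far (ltW s0) irs Hxy).
  have wz : cabs (w - z) < dl.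
    apply: le_lt_trans sdl; have -> : w - z = Complex x y - Complex (complex.Re z) (complex.Im z).
      by case: (z).
    by apply: cabs_small_pt; rewrite ler_norml; lra.
  have := Hd _ wz; rewrite (addrC z) subrK mul1r => H1.
  have -> : g w = (f w - f z) * (w - z)^-1 by rewrite /g; ring.
  rewrite cabsM cabsV ler_pdivrMr// /K mulrDl mul1r.
  have -> : f w - f z = (w - z) * l + (f w - f z - (w - z) * l) by ring.
  by apply: le_trans (cabsD _ _) _; rewrite cabsM mulrC lerD2l.
apply: ComplexField.Normc.eq0_normc; apply/eqP; rewrite eq_le cabs_ge0 andbT.
rewrite leNgt; apply/negP => G0.
(* The last entry is chosen against the bound [16 * K * s], which then is at most half of the
   positive number that it bounds. *)
pose s := Num.min t (Num.min (dl / 4) (cabs (rectint g a b c d) / (32 * K))).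
have s0 : 0 < s by rewrite !lt_min t0 /= !divr_gt0// mulr_gt0.
have st : s <= t by rewrite /s ge_min lexx.
have sd : s <= dl / 4 by rewrite /s !ge_min lexx orbT.
have sg : s <= cabs (rectint g a b c d) / (32 * K) by rewrite /s !ge_min lexx !orbT.
have := small s s0 st ltac:(lra).
move: sg; rewrite ler_pdivlMr ?mulr_gt0//; lra.
Qed.

End kernel.

(** * Taylor estimates and Montel's theorem *)

Section taylor.
Variable R : realType.
Implicit Types (a b c d t s e x y r p q M : R) (z w h l v : R[i]) (f F : R[i] -> R[i]).
Local Notation "'j" := (Complex 0 1 : R[i]).
Local Notation mu := (@lebesgue_measure R).

(** Compactness along an arbitrary filter, to serve both for the boundedness of a continuous
    function (bounds tending to infinity) and for uniform convergence along an ultrafilter. *)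
Lemma near_closed_disc (I : Type) (F : set_system I) (FF : Filter F) (P : I -> R[i] -> Prop) r :
  (forall z, cabs z <= r -> exists2 d : R, 0 < d &
     \forall i \near F, forall v, cabs (v - z) < d -> cabs v <= r -> P i v) ->
  \forall i \near F, forall z, cabs z <= r -> P i z.
Proof.
move=> H.
(* The covering argument runs on a square, compact as a product of segments; near a point outside
   the closed disc the condition is vacuous. *)
pose K : set (R * R) := `[- r, r] `*` `[- r, r].
have cK : compact K by apply: compact_setX; exact: segment_compact.
have /(_ I F (fun i (w : R * R) => cabs (Complex w.1 w.2) <= r -> P i (Complex w.1 w.2)) FF) {}cK :=
  iffLR (compact_near_coveringP K) cK.
have : \forall i \near F, K `<=` (fun w : R * R => cabs (Complex w.1 w.2) <= r -> P i (Complex w.1 w.2)).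
  apply: cK => w _.
  have near_w e : 0 < e -> nbhs w [set v : R * R | cabs (Complex v.1 v.2 - Complex w.1 w.2) < e].
    move=> e0; apply/nbhs_ballP; exists (e / 4) => /=; first lra.
    move=> v [/= v1 v2]; apply: le_lt_trans (_ : 2 * (e / 4) < _); last lra.
    by apply: cabs_small_pt; rewrite distrC; apply: ltW.
  have [wr|wr] := leP (cabs (Complex w.1 w.2)) r.
    have [d d0 Hd] := H _ wr.
    exists ([set v : R * R | cabs (Complex v.1 v.2 - Complex w.1 w.2) < d],
       [set i | forall v, cabs (v - Complex w.1 w.2) < d -> cabs v <= r -> P i v]).
      by split => //=; exact: near_w.
    by move=> [v i] [/= vd Pi] vr; exact: Pi.
  exists ([set v : R * R | cabs (Complex v.1 v.2 - Complex w.1 w.2) < cabs (Complex w.1 w.2) - r], setT).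
    by split => /=; [apply: near_w; rewrite subr_gt0|exact: filterT].
  move=> [v i] [/= vd _] vr.
  have := cabsD (Complex v.1 v.2) (- (Complex v.1 v.2 - Complex w.1 w.2)).
  by rewrite cabsN opprB subrKC; lra.
apply: filterS => i Hi z zr.
have zK : K (complex.Re z, complex.Im z).
  split; rewrite /= in_itv /= -ler_norml; apply: le_trans zr.
    exact: normr_Re_le.
  exact: normr_Im_le.
by have := Hi (complex.Re z, complex.Im z) zK; case: (z) zr => ? ? /= zr; apply.
Qed.

Lemma ccts_bounded f r : (forall z, cabs z <= r -> ccts f z) ->
  exists2 B : R, 0 < B & forall z, cabs z <= r -> cabs (f z) <= B.
Proof.
move=> H.
have : \forall B \near +oo, forall z, cabs z <= r -> cabs (f z) <= B.
  apply: near_closed_disc => z zr; have [d d0 Hd] := H z zr 1 ltr01.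
  exists d => //; near=> B => v vd _.
  have := Hd _ vd; rewrite subrKC => fv.
  have fB : cabs (f z) + 1 <= B by near: B; apply: nbhs_pinfty_ge; exact: num_real.
  have := cabsD (f z) (f v - f z); rewrite subrKC; lra.
move=> N; near (pinfty_nbhs R) => B; exists B; first by near: B; apply: nbhs_pinfty_gt; exact: num_real.
by near: B.
Unshelve. all: by end_near. Qed.

Lemma analytic_ccts f z : analytic f -> udisc z -> ccts f z.
Proof. by move=> af /af /derivable_cdiff /cdiff_ccts. Qed.

Lemma analytic_bounded f r : analytic f -> r < 1 ->
  exists2 B : R, 0 < B & forall z, cabs z <= r -> cabs (f z) <= B.
Proof.
by move=> af r1; apply: ccts_bounded => z zr; apply: analytic_ccts => //; exact: le_lt_trans r1.
Qed.

Lemma cabs_2pi (z : R[i]) : cabs ((2 * pi)%:C%C * 'j * z) = 2 * pi * cabs z.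
Proof.
rewrite !cabsM cabs_real ger0_norm ?mulr_ge0 ?pi_ge0//.
have -> : cabs 'j = 1 by rewrite /ComplexField.Normc.normc expr0n /= expr1n add0r sqrtr1.
by rewrite mulr1.
Qed.

Lemma inrect_shift a b c d z t h : 0 < t -> inrect a b c d z t -> cabs h <= t / 2 ->
  inrect a b c d (z + h) (t / 2).
Proof.
move=> t0 [i1 i2 i3 i4] ht.
have := le_trans (normr_Re_le h) ht; have := le_trans (normr_Im_le h) ht.
rewrite !ler_norml; case: z h i1 i2 i3 i4 {ht} => x y [u v] /= *.
by split=> /=; lra.
Qed.

Lemma rcontZ k f a b c d : rcont f a b c d -> rcont (fun w => k * f w) a b c d.
Proof.
move=> ru x y Hxy e e0; have K0 : 0 < cabs k + 1 by rewrite ltr_wpDl ?cabs_ge0.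
have [dl dl0 Hd] := ru x y Hxy _ (divr_gt0 e0 K0); exists dl => // g /Hd.
rewrite ltr_pdivlMr// -mulrBr cabsM; apply: le_lt_trans.
by rewrite mulrC ler_wpM2l ?cabs_ge0// lerDl.
Qed.

Lemma rcontD f F a b c d : rcont f a b c d -> rcont F a b c d ->
  rcont (fun w => f w + F w) a b c d.
Proof.
move=> ru rv x y Hxy e e0; have e20 : 0 < e / 2 by lra.
have [d1 d10 H1] := ru x y Hxy _ e20; have [d2 d20 H2] := rv x y Hxy _ e20.
exists (Num.min d1 d2); first by rewrite lt_min d10.
move=> g; rewrite lt_min => /andP[/H1 A /H2 B]; rewrite opprD addrACA.
by apply: le_lt_trans (cabsD _ _) _; lra.
Qed.

Lemma cabs1 : cabs (1 : R[i]) = 1.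
Proof. by rewrite /ComplexField.Normc.normc /= expr1n expr0n addr0 sqrtr1. Qed.

Lemma twopij_neq0 : (2 * pi)%:C%C * 'j != 0 :> R[i].
Proof.
apply/eqP => H; have := cabs_2pi 1; rewrite H mul0r ComplexField.Normc.normc0 cabs1 mulr1.
by move/eqP; rewrite eq_sym mulf_eq0 gt_eqF//= gt_eqF ?pi_gt0.
Qed.

(** Integrate [f] against the identity 1/(w-z-h) = 1/(w-z) + h/(w-z)^2 + h^2/((w-z)^2 (w-z-h)),
    using Cauchy's formula at [z] and at [z + h]. An integral stands in the place of the derivative,
    so that the estimate itself can show that it is the derivative. *)
Lemma taylor_rect f a b c d z t h M : 0 < t -> inrect a b c d z t -> cdiff_on f a b c d ->
  (forall x y, redge a b c d x y -> cabs (f (Complex x y)) <= M) -> cabs h <= t / 2 ->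
  2 * pi * cabs (f (z + h) - f z -
    h * (rectint (fun w => f w * ((w - z)^-1 * (w - z)^-1)) a b c d / ((2 * pi)%:C%C * 'j)))
  <= 8 * M * ((b - a) + (d - c)) / t ^+ 3 * cabs h ^+ 2.
Proof.
move=> t0 ir H HM ht.
have t20 : 0 < t / 2 by lra.
have ir' := inrect_shift t0 ir ht; have [ab cd] := inrect_le (ltW t0) ir.
pose u0 w := f w * (w - z)^-1.
pose u1 w := f w * ((w - z)^-1 * (w - z)^-1).
pose u2 w := f w * ((w - z)^-1 * (w - z)^-1 * (w - (z + h))^-1).
pose uh w := f w * (w - (z + h))^-1.
have D x y : redge a b c d x y -> [/\ exists l, cdiff f (Complex x y) l,
    exists l, cdiff (fun w => (w - z)^-1) (Complex x y) l &
    exists l, cdiff (fun w => (w - (z + h))^-1) (Complex x y) l].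
  move=> Hxy; have [xab ycd] := redge_in ab cd Hxy; split; first exact: H.
    by apply: cdiff_inv_sub; exact: redge_neq ir Hxy.
  by apply: cdiff_inv_sub; exact: redge_neq ir' Hxy.
have r0 : rcont u0 a b c d.
  by move=> x y /D[[l1 d1] [l2 d2] [l3 d3]]; exact: cdiff_ccts (cdiffM d1 d2).
have r1 : rcont u1 a b c d.
  by move=> x y /D[[l1 d1] [l2 d2] [l3 d3]]; exact: cdiff_ccts (cdiffM d1 (cdiffM d2 d2)).
have r2 : rcont u2 a b c d.
  by move=> x y /D[[l1 d1] [l2 d2] [l3 d3]];
    exact: cdiff_ccts (cdiffM d1 (cdiffM (cdiffM d2 d2) d3)).
have E : rectint uh a b c d = rectint u0 a b c d + h * rectint u1 a b c d +
    h ^+ 2 * rectint u2 a b c d.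
  have z1 := rcontZ h r1; have z2 := rcontZ (h ^+ 2) r2; have z3 := rcontD r0 z1.
  rewrite -(rectintZ h r1) -(rectintZ _ r2) -(rectintD r0 z1) -(rectintD z3 z2).
  apply: eq_rectint => // x y Hxy; set w := Complex x y; rewrite /uh /u0 /u1 /u2.
  have wz : w - z != 0 by rewrite subr_eq0; exact: redge_neq ir Hxy.
  have wzh : w - (z + h) != 0 by rewrite subr_eq0; exact: redge_neq ir' Hxy.
  by field; rewrite wz wzh.
have C0 := cauchy_formula t0 ir H; have Ch := cauchy_formula t20 ir' H.
have pi2 := twopij_neq0.
rewrite -cabs_2pi.
have -> : (2 * pi)%:C%C * 'j * (f (z + h) - f z -
    h * (rectint u1 a b c d / ((2 * pi)%:C%C * 'j))) = h ^+ 2 * rectint u2 a b c d.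
  transitivity (rectint uh a b c d - rectint u0 a b c d - h * rectint u1 a b c d).
    by move: C0 Ch pi2; move: ((2 * pi)%:C%C * 'j) => K C0 Ch K0; rewrite Ch C0; field.
  by rewrite E; ring.
rewrite cabsM [cabs (h ^+ 2)]cabsM -expr2 mulrC ler_wpM2r ?sqr_ge0//.
have -> : 8 * M * (b - a + (d - c)) / t ^+ 3 = 4 * (M * (t^-1 * t^-1 * (t / 2)^-1)) * (b - a + (d - c)).
  by field; rewrite gt_eqF.
apply: rectint_bound => // x y Hxy; rewrite /u2 !cabsM !cabsV.
have k1 := redge_far (ltW t0) ir Hxy; have k2 := redge_far (ltW t20) ir' Hxy.
have i1 : (cabs (Complex x y - z))^-1 <= t^-1 by rewrite lef_pV2// posrE (lt_le_trans t0).
have i2 : (cabs (Complex x y - (z + h)))^-1 <= (t / 2)^-1 by rewrite lef_pV2// posrE (lt_le_trans t20).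
have n1 : 0 <= (cabs (Complex x y - z))^-1 by rewrite invr_ge0 cabs_ge0.
have n2 : 0 <= (cabs (Complex x y - (z + h)))^-1 by rewrite invr_ge0 cabs_ge0.
by do !apply: ler_pM => //; rewrite ?mulr_ge0 ?cabs_ge0//; exact: HM.
Qed.

End taylor.

(** * Uniform Taylor bounds and normal families *)

Section limits.
Variable R : realType.
Implicit Types (a b c d t s e x y r p q M B : R) (z w h l v : R[i]) (f F : R[i] -> R[i]).
Local Notation "'j" := (Complex 0 1 : R[i]).

Definition holo_bounded f r B :=
  forall z, cabs z <= r -> (exists l, cdiff f z l) /\ cabs (f z) <= B.

Lemma square_in_disc (z : R[i]) t x y : complex.Re z - t <= x <= complex.Re z + t ->
  complex.Im z - t <= y <= complex.Im z + t -> cabs (Complex x y) <= cabs z + 2 * t.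
Proof.
move=> H1 H2; have -> : Complex x y = z + (Complex x y - Complex (complex.Re z) (complex.Im z)).
  by case: (z) => u v /=; rewrite addrC subrK.
apply: le_trans (cabsD _ _) _; rewrite lerD2l; apply: cabs_small_pt; rewrite ler_norml; lra.
Qed.

(** The error in [taylor_rect] is quadratic in [h], which identifies the coefficient of [h] as the
    derivative. *)
Lemma cderiv_rectint f a b c d z t M : 0 < t -> inrect a b c d z t -> cdiff_on f a b c d ->
  (forall x y, redge a b c d x y -> cabs (f (Complex x y)) <= M) ->
  rectint (fun w => f w * ((w - z)^-1 * (w - z)^-1)) a b c d =
  (2 * pi)%:C%C * 'j * cderiv f z.
Proof.
move=> t0 ir H HM.
set I0 := rectint _ _ _ _ _; pose D := I0 / ((2 * pi)%:C%C * 'j).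
suff : cdiff f z D by move=> /cdiff_cderiv ->; rewrite /D mulrC mulfVK// twopij_neq0.
move=> e e0.
set K := 8 * M * ((b - a) + (d - c)) / t ^+ 3.
have T h := @taylor_rect _ f a b c d z t h M t0 ir H HM.
have K1 : 0 < `|K| + 1 by rewrite ltr_wpDl.
exists (Num.min (t / 2) (e / (`|K| + 1))); first by rewrite lt_min !divr_gt0.
move=> h; rewrite lt_min => /andP[h1 h2].
have := T h (ltW h1); rewrite -/I0 -/D -/K => H1.
have p2 : 1 <= 2 * pi :> R by have := pi_ge2 R; lra.
apply: le_trans (_ : 2 * pi * cabs (f (z + h) - f z - h * D) <= _).
  by rewrite ler_peMl ?cabs_ge0.
apply: le_trans H1 _; rewrite expr2 mulrA ler_wpM2r ?cabs_ge0//.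
move: h2; rewrite ltr_pdivlMr// => h2.
apply: le_trans (ler_norm _) _; rewrite normrM (ger0_norm (cabs_ge0 h)).
apply: le_trans (ltW h2); rewrite mulrC ler_wpM2l ?cabs_ge0//; lra.
Qed.

(** A square of half-side (1 - r) / 4 around [z] stays in the disc of radius (1 + r) / 2. The
    constant depends on [B] and [r] only, so the estimate is uniform over a locally bounded
    family. *)
Lemma taylor2 f r B z h : r < 1 -> holo_bounded f ((1 + r) / 2) B ->
  cabs z <= r -> cabs h <= (1 - r) / 8 ->
  cabs (f (z + h) - f z - h * cderiv f z) <= 256 * B / (1 - r) ^+ 2 * cabs h ^+ 2.
Proof.
move=> r1 H zr hr; set t := (1 - r) / 4; have t0 : 0 < t by rewrite /t; lra.
have ir : inrect (complex.Re z - t) (complex.Re z + t) (complex.Im z - t) (complex.Im z + t) z t by [].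
have [ab cd] := inrect_le (ltW t0) ir.
have H1 x y : complex.Re z - t <= x <= complex.Re z + t ->
  complex.Im z - t <= y <= complex.Im z + t -> (exists l, cdiff f (Complex x y) l) /\ cabs (f (Complex x y)) <= B.
  move=> xz yz; apply: H; apply: le_trans (square_in_disc xz yz) _; rewrite /t; lra.
have H2 : cdiff_on f (complex.Re z - t) (complex.Re z + t) (complex.Im z - t) (complex.Im z + t).
  by move=> x y xz yz; have [] := H1 x y xz yz.
have H3 x y : redge (complex.Re z - t) (complex.Re z + t) (complex.Im z - t) (complex.Im z + t) x y ->
    cabs (f (Complex x y)) <= B.
  by move=> /(redge_in ab cd)[xz yz]; have [] := H1 x y xz yz.
have ht : cabs h <= t / 2 by rewrite /t; lra.
have := taylor_rect t0 ir H2 H3 ht.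
rewrite (cderiv_rectint t0 ir H2 H3).
have -> : (2 * pi)%:C%C * 'j * cderiv f z / ((2 * pi)%:C%C * 'j) = cderiv f z.
  by rewrite mulrC mulrA mulVf ?mul1r// twopij_neq0.
have p2 : 4 <= 2 * pi :> R by have := pi_ge2 R; lra.
set X := cabs _ => HX.
have B0 : 0 <= B by apply: le_trans (cabs_ge0 _) (H z _).2; lra.
have := le_trans (ler_wpM2r (cabs_ge0 _) p2) HX.
have -> : 8 * B * (complex.Re z + t - (complex.Re z - t) + (complex.Im z + t - (complex.Im z - t))) / t ^+ 3
  = 2 * (256 * B / (1 - r) ^+ 2).
  by rewrite /t; field; lra.
have : 0 <= 256 * B / (1 - r) ^+ 2 * cabs h ^+ 2.
  exact: mulr_ge0 (divr_ge0 (mulr_ge0 (ler0n _ _) B0) (sqr_ge0 _)) (sqr_ge0 _).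
have := cabs_ge0 (f (z + h) - f z - h * cderiv f z); rewrite -/X; lra.
Qed.

(** [taylor2] with a real increment of length (1 - r) / 8, solved for the derivative: the two values
    contribute 2 B, the remainder 4 B, and 48 = 8 * 6. *)
Lemma cauchy_estimate f r B z : r < 1 -> holo_bounded f ((1 + r) / 2) B ->
  cabs z <= r -> cabs (cderiv f z) <= 48 * B / (1 - r).
Proof.
move=> r1 H zr; set t := (1 - r) / 8; have t0 : 0 < t by rewrite /t; lra.
have ct : cabs (t%:C%C : R[i]) = t by rewrite cabs_real gtr0_norm.
have := @taylor2 f r B z t%:C%C r1 H zr; rewrite ct => /(_ (lexx _)) T.
have B1 : cabs (f z) <= B by apply: (H _ _).2; lra.
have B2 : cabs (f (z + t%:C%C)) <= B.
  by apply: (H _ _).2; apply: le_trans (cabsD _ _) _; rewrite ct /t; lra.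
have : cabs (t%:C%C * cderiv f z) <= 2 * B + 256 * B / (1 - r) ^+ 2 * t ^+ 2.
  have -> : t%:C%C * cderiv f z = f (z + t%:C%C) + - f z +
     - (f (z + t%:C%C) - f z - t%:C%C * cderiv f z) by ring.
  apply: le_trans (cabsD _ _) _; rewrite cabsN; apply: lerD => //.
  by apply: le_trans (cabsD _ _) _; rewrite cabsN; lra.
rewrite cabsM ct mulrC -ler_pdivlMr// => /le_trans; apply.
by rewrite le_eqVlt; apply/orP; left; apply/eqP; rewrite /t; field; lra.
Qed.

(** Supplies the equicontinuity in [ultra_montel]. *)
Lemma holo_lipschitz f r B z v : r < 1 -> holo_bounded f ((1 + r) / 2) B ->
  cabs z <= r -> cabs (v - z) <= (1 - r) / 8 ->
  cabs (f v - f z) <= 80 * B / (1 - r) * cabs (v - z).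
Proof.
move=> r1 H zr hr; have T := taylor2 r1 H zr hr; have C := cauchy_estimate r1 H zr.
rewrite subrKC in T.
have -> : f v - f z = (f v - f z - (v - z) * cderiv f z) + (v - z) * cderiv f z by ring.
apply: le_trans (cabsD _ _) _; rewrite cabsM.
have B0 : 0 <= B by apply: le_trans (cabs_ge0 _) (H z _).2; lra.
have r0 : 0 < 1 - r by lra.
apply: le_trans (lerD T (ler_wpM2l (cabs_ge0 _) C)) _.
rewrite expr2 mulrA [cabs (v - z) * (_ / _)]mulrC -mulrDl ler_wpM2r ?cabs_ge0//.
apply: le_trans (_ : 256 * B / (1 - r) ^+ 2 * ((1 - r) / 8) + 48 * B / (1 - r) <= _).
  by rewrite lerD2r; apply: ler_wpM2l hr; exact: divr_ge0 (mulr_ge0 (ler0n _ _) B0) (sqr_ge0 _).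
by rewrite le_eqVlt; apply/orP; left; apply/eqP; field; lra.
Qed.

Variables (I : Type) (U : set_system I).
Hypothesis UU : UltraFilter U.

Lemma ultra_fmap (T : Type) (u : I -> T) : UltraFilter (u @ U).
Proof.
split=> [|G GF sG]; first exact: fmap_proper_filter.
rewrite predeqE => A; split; last exact: sG.
move=> GA; have [//|UnA] := in_ultra_setVsetC (u @^-1` A) UU.
have GnA : G (~` A) by apply: sG.
by have [x []] := filter_ex (filterI GA GnA).
Qed.

(** The image ultrafilter lives on a compact segment, hence converges. *)
Lemma ultra_lim_real (u : I -> R) B : (\forall i \near U, `|u i| <= B) ->
  exists l : R, forall e, 0 < e -> \forall i \near U, `|u i - l| < e.
Proof.
move=> uB.
have /[!compact_ultra] /(_ (u @ U)) := @segment_compact R (- B) B.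
have Uu : UltraFilter (u @ U) by exact: ultra_fmap.
case/(_ Uu).
  by apply: filterS uB => i /=; rewrite in_itv /= ler_norml.
move=> l [_ /= ul]; exists l => e e0.
have /cvgrPdist_lt/(_ e e0) : u @ U --> l by [].
by apply: filterS => i; rewrite distrC.
Qed.

Lemma ultra_lim (u : I -> R[i]) B : (\forall i \near U, cabs (u i) <= B) ->
  exists l, forall e, 0 < e -> \forall i \near U, cabs (u i - l) < e.
Proof.
move=> uB.
have [l1 H1] := @ultra_lim_real (fun i => complex.Re (u i)) B
  ltac:(by apply: filterS uB => i; apply: le_trans (normr_Re_le _)).
have [l2 H2] := @ultra_lim_real (fun i => complex.Im (u i)) B
  ltac:(by apply: filterS uB => i; apply: le_trans (normr_Im_le _)).
exists (Complex l1 l2) => e e0; have e20 : 0 < e / 2 by lra.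
near=> i.
have h1 : `|complex.Re (u i) - l1| < e / 2 by near: i; exact: H1.
have h2 : `|complex.Im (u i) - l2| < e / 2 by near: i; exact: H2.
apply: le_lt_trans (cabs_le_ReIm _) _.
by case: (u i) h1 h2 => ? ? /=; lra.
Unshelve. all: by end_near. Qed.

(* Along an ultrafilter every bounded family converges, so no diagonal extraction is
   needed and the limit is taken pointwise. *)
Lemma ultra_montel (u : I -> R[i] -> R[i]) :
  (forall r, r < 1 -> exists B, \forall i \near U, holo_bounded (u i) r B) ->
  exists F, analytic F /\ forall r e, r < 1 -> 0 < e ->
    \forall i \near U, forall z, cabs z <= r -> cabs (u i z - F z) < e.
Proof.
move=> H.
have limz z : exists l, udisc z -> forall e, 0 < e -> \forall i \near U, cabs (u i z - l) < e.
  have [z1|z1] := pselect (udisc z); last by exists 0.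
  have [B HB] := H _ z1.
  have [|l Hl] := @ultra_lim (fun i => u i z) B; last by exists l.
  by apply: filterS HB => i /(_ z (lexx _)) [].
have [F HF] := choice limz; exists F.
have zdisc z r : r < 1 -> cabs z <= r -> udisc z by move=> r1 zr; exact: le_lt_trans r1.
split.
  move=> z z1.
  set r := (1 + cabs z) / 2; have z1' : cabs z < 1 by [].
  have r1 : r < 1 by rewrite /r; lra.
  have zr : cabs z <= r by rewrite /r; lra.
  have [B HB] := H ((1 + r) / 2) ltac:(lra).
  have [|D HD] := @ultra_lim (fun i => cderiv (u i) z) (48 * B / (1 - r)).
    by apply: filterS HB => i Hi; exact: cauchy_estimate zr.
  apply: (@cdiff_derivable _ _ _ D).
  (* The constant of the quadratic remainder does not depend on [i], so the bound survives the
     pointwise limit and shows that [F] has derivative [D] at [z]. *)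
  have key h : cabs h <= (1 - r) / 8 ->
      cabs (F (z + h) - F z - h * D) <= 256 * B / (1 - r) ^+ 2 * cabs h ^+ 2.
    move=> hr; apply/ler_addgt0Pr => e e0.
    have zh1 : udisc (z + h).
      by apply: le_lt_trans (cabsD _ _) _; move: hr z1'; rewrite /r; lra.
    have e30 : 0 < e / 3 by lra.
    have K0 : 0 < cabs h + 1 by rewrite ltr_wpDl ?cabs_ge0.
    near U => i.
    have h1 : cabs (u i (z + h) - F (z + h)) < e / 3 by near: i; exact: HF.
    have h2 : cabs (u i z - F z) < e / 3 by near: i; exact: HF.
    have h3 : cabs (cderiv (u i) z - D) < e / 3 / (cabs h + 1).
      by near: i; apply: HD; rewrite divr_gt0.
    have h4 : holo_bounded (u i) ((1 + r) / 2) B by near: i.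
    have T := taylor2 r1 h4 zr hr.
    have -> : F (z + h) - F z - h * D = (u i (z + h) - u i z - h * cderiv (u i) z) +
       (- (u i (z + h) - F (z + h)) + (u i z - F z) + h * (cderiv (u i) z - D)) by ring.
    apply: le_trans (cabsD _ _) _; apply: lerD => //.
    apply: le_trans (cabsD _ _) _.
    have := cabsD (- (u i (z + h) - F (z + h))) (u i z - F z); rewrite cabsN.
    have : cabs (h * (cderiv (u i) z - D)) <= e / 3.
      rewrite cabsM; move: h3; rewrite ltr_pdivlMr// => h3; apply: le_trans (ltW h3).
      by rewrite mulrC ler_wpM2l ?cabs_ge0// lerDl.
    lra.
  move=> e e0; set K := 256 * B / (1 - r) ^+ 2 in key *.
  have K1 : 0 < `|K| + 1 by rewrite ltr_wpDl.
  have r0 : 0 < 1 - r by lra.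
  exists (Num.min ((1 - r) / 8) (e / (`|K| + 1))); first by rewrite lt_min !divr_gt0.
  move=> h; rewrite lt_min => /andP[h1 h2]; apply: le_trans (key h (ltW h1)) _.
  rewrite expr2 mulrA ler_wpM2r ?cabs_ge0//.
  move: h2; rewrite ltr_pdivlMr// => h2.
  apply: le_trans (ler_norm _) _; rewrite normrM (ger0_norm (cabs_ge0 h)).
  apply: le_trans (ltW h2); rewrite mulrC ler_wpM2l ?cabs_ge0//; lra.
move=> r e r1 e0.
have [B HB] := H ((1 + r) / 2) ltac:(lra).
have r0 : 0 < 1 - r by lra.
have L0 : 0 < `|80 * B / (1 - r)| + 1 by rewrite ltr_wpDl.
set L := `|80 * B / (1 - r)| + 1 in L0.
have e40 : 0 < e / 4 by lra.
(* The common Lipschitz bound, inherited by [F] in [lipF], upgrades pointwise convergence to uniform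
   convergence on the closed disc. *)
have lip i z v : holo_bounded (u i) ((1 + r) / 2) B -> cabs z <= r ->
    cabs (v - z) < Num.min ((1 - r) / 8) (e / 4 / L) -> cabs (u i v - u i z) < e / 4.
  move=> Hi zr; rewrite lt_min => /andP[h1 h2].
  apply: le_lt_trans (holo_lipschitz r1 Hi zr (ltW h1)) _.
  move: h2; rewrite ltr_pdivlMr//; apply: le_lt_trans; rewrite mulrC ler_wpM2l ?cabs_ge0//.
  by apply: le_trans (ler_norm _) _; rewrite /L lerDl.
have lipF z v : cabs z <= r -> cabs v <= r ->
    cabs (v - z) < Num.min ((1 - r) / 8) (e / 4 / L) -> cabs (F z - F v) <= e / 4.
  move=> zr vr vd; have z1 := zdisc _ _ r1 zr; have v1 := zdisc _ _ r1 vr.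
  apply/ler_addgt0Pr => e' e'0.
  have e20 : 0 < e' / 2 by lra.
  near U => k.
  have k1 : cabs (u k v - F v) < e' / 2 by near: k; exact: HF.
  have k2 : cabs (u k z - F z) < e' / 2 by near: k; exact: HF.
  have k3 : holo_bounded (u k) ((1 + r) / 2) B by near: k.
  have -> : F z - F v = - (u k z - F z) + (- (u k v - u k z)) + (u k v - F v) by ring.
  apply: le_trans (cabsD _ _) _.
  have := cabsD (- (u k z - F z)) (- (u k v - u k z)); rewrite !cabsN.
  have := lip k z v k3 zr vd; lra.
apply: near_closed_disc => z zr.
exists (Num.min ((1 - r) / 8) (e / 4 / L)); first by rewrite lt_min !divr_gt0.
have z1 := zdisc _ _ r1 zr.
near=> i => v vd vr; have v1 := zdisc _ _ r1 vr.
have Hi : holo_bounded (u i) ((1 + r) / 2) B by near: i.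
have hi : cabs (u i z - F z) < e / 4 by near: i; exact: HF.
have Fl := lipF _ _ zr vr vd.
have -> : u i v - F v = (u i v - u i z) + (u i z - F z) + (F z - F v) by ring.
apply: le_lt_trans (cabsD _ _) _.
have := cabsD (u i v - u i z) (u i z - F z).
have := lip i z v Hi zr vd; lra.
Unshelve. all: by end_near. Qed.

End limits.

(** * Derivatives, subsequences and primitives on the disc *)

Section analytic_functions.
Variable R : realType.
Implicit Types (t s e x y r B : R) (z w h l v : R[i]) (f F : R[i] -> R[i]).

Lemma analyticP f : (forall z, udisc z -> exists l, cdiff f z l) -> analytic f.
Proof. by move=> H z /H[l /cdiff_derivable]. Qed.

Lemma analytic_cdiff f z : analytic f -> udisc z -> cdiff f z (cderiv f z).
Proof. by move=> af /af /derivable_cdiff. Qed.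

Lemma analyticM f F : analytic f -> analytic F -> analytic (fun z => f z * F z).
Proof.
move=> af aF; apply: analyticP => z z1; eexists.
exact: cdiffM (analytic_cdiff af z1) (analytic_cdiff aF z1).
Qed.

Lemma analytic_cst (k : R[i]) : analytic (fun=> k).
Proof. by apply: analyticP => z z1; eexists; exact: cdiff_cst. Qed.

Lemma cdiffB f F z l l' : cdiff f z l -> cdiff F z l' ->
  cdiff (fun w => f w - F w) z (l - l').
Proof.
move=> df dF; have := cdiffD df (cdiffM (cdiff_cst (-1) z) dF).
rewrite mul0r addr0 mulN1r; congr (cdiff _ _ _).
by apply/funext => w; rewrite mulN1r.
Qed.

Lemma analyticB f F : analytic f -> analytic F -> analytic (fun z => f z - F z).
Proof.
move=> af aF; apply: analyticP => z z1; eexists.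
exact: cdiffB (analytic_cdiff af z1) (analytic_cdiff aF z1).
Qed.

Lemma udisc_nbhd z : udisc z -> exists2 d : R, 0 < d & forall h, cabs h < d -> udisc (z + h).
Proof.
rewrite /udisc /= => z1; exists (1 - cabs z); first by rewrite subr_gt0.
by move=> h hd; apply: le_lt_trans (cabsD _ _) _; lra.
Qed.

(** Functions are total but matter on the disc only: identities such as [cderiv (seg_int f) = f] are
    known there, and this lets them be differentiated further. *)
Lemma cdiff_local f F z l : (forall w, udisc w -> f w = F w) -> udisc z ->
  cdiff F z l -> cdiff f z l.
Proof.
move=> fF z1 dF e e0; have [d1 d10 H1] := udisc_nbhd z1; have [d d0 Hd] := dF e e0.
exists (Num.min d1 d); first by rewrite lt_min d10.
by move=> h; rewrite lt_min => /andP[/H1 h1 /Hd]; rewrite !fF.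
Qed.

Lemma analytic_local f F : (forall w, udisc w -> f w = F w) -> analytic F -> analytic f.
Proof.
by move=> fF aF; apply: analyticP => z z1; eexists; exact: cdiff_local fF z1 (analytic_cdiff aF z1).
Qed.

Lemma cderiv_local f F z : (forall w, udisc w -> f w = F w) -> analytic F -> udisc z ->
  cderiv f z = cderiv F z.
Proof. by move=> fF aF z1; apply/cdiff_cderiv/(cdiff_local fF z1)/analytic_cdiff. Qed.

Lemma cderivB f F z : analytic f -> analytic F -> udisc z ->
  cderiv (fun w => f w - F w) z = cderiv f z - cderiv F z.
Proof.
by move=> af aF z1; apply/cdiff_cderiv/cdiffB; exact: analytic_cdiff.
Qed.

Lemma cdiff_shift f z h l : cdiff f (z + h) l -> cdiff (fun w => f (w + h)) z l.
Proof.
move=> df e e0; have [d d0 Hd] := df e e0; exists d => // k /Hd.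
by rewrite (addrAC z h).
Qed.

Lemma eps_eq (x y : R[i]) : (forall e, 0 < e -> cabs (x - y) < e) -> x = y.
Proof.
move=> H; apply/eqP; rewrite -subr_eq0; apply/eqP/ComplexField.Normc.eq0_normc.
apply/eqP; rewrite eq_le cabs_ge0 andbT leNgt; apply/negP => H0.
by have := H _ H0; rewrite ltxx.
Qed.

Lemma analytic_holo_bounded f r : analytic f -> r < 1 -> exists2 B : R, 0 < B & holo_bounded f r B.
Proof.
move=> af r1; have [B B0 HB] := analytic_bounded af r1; exists B => // z zr.
by split; [eexists; apply: analytic_cdiff => //; exact: le_lt_trans r1|exact: HB].
Qed.

Lemma natSinv_small e : 0 < e -> exists N, forall n, (N <= n)%N -> n.+1%:R^-1 < e.
Proof.
by move=> e0; have [N _ HN] := @near_infty_natSinv_lt R (PosNum e0); exists N => n /HN.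
Qed.

(** On every smaller disc the difference quotients with increment 1 / (n + 1) are eventually
    analytic, and [taylor2] gives them a uniform rate of convergence to [cderiv f]. Their limit is
    analytic by [ultra_montel], which only asks for eventual bounds. *)
Lemma analytic_cderiv f : analytic f -> analytic (cderiv f).
Proof.
move=> af.
have [U [UU sU]] := ultraFilterLemma eventually_filter.
pose h n : R[i] := (n.+1%:R^-1 : R)%:C%C.
have hE n : cabs (h n) = n.+1%:R^-1 by rewrite cabs_real ger0_norm// invr_ge0.
have h0 n : h n != 0.
  by apply/eqP => /(congr1 (@complex.Re R)) /= /eqP; rewrite invr_eq0 pnatr_eq0.
pose u n z := (f (z + h n) - f z) * (h n)^-1.
have quot r : r < 1 -> exists K, exists N, forall n z, (N <= n)%N -> cabs z <= r ->
    udisc (z + h n) /\ cabs (u n z - cderiv f z) <= K * n.+1%:R^-1.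
  move=> r1; have [B B0 HB] := @analytic_holo_bounded f ((1 + r) / 2) af ltac:(lra).
  have [N HN] := @natSinv_small ((1 - r) / 8) ltac:(lra).
  exists (256 * B / (1 - r) ^+ 2), N => n z Nn zr.
  have hn : cabs (h n) <= (1 - r) / 8 by rewrite hE; exact/ltW/HN.
  split; first by apply: le_lt_trans (cabsD _ _) _; lra.
  have := taylor2 r1 HB zr hn.
  have -> : u n z - cderiv f z = (f (z + h n) - f z - h n * cderiv f z) * (h n)^-1.
    by rewrite /u; field.
  rewrite cabsM cabsV => T; rewrite ler_pdivrMr; last by rewrite hE invr_gt0.
  by apply: le_trans T _; rewrite hE expr2 mulrA.
have [|F [aF HF]] := @ultra_montel _ _ U UU u.
  move=> r r1; have [K [N HK]] := quot r r1.
  have [B B0 HB] := @analytic_holo_bounded f ((1 + r) / 2) af ltac:(lra).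
  exists (`|K| + 48 * B / (1 - r)); apply: sU.
  exists N => // n /= Nn z zr; have [zh Hq] := HK n z Nn zr.
  have z1 : udisc z by exact: le_lt_trans r1.
  split.
    eexists; rewrite /u; apply: cdiffM; last exact: cdiff_cst.
    apply: cdiffB; last exact: analytic_cdiff z1.
    by apply: cdiff_shift; exact: analytic_cdiff zh.
  rewrite -[u n z](subrK (cderiv f z)).
  apply: le_trans (cabsD _ _) _; apply: lerD; last exact: cauchy_estimate zr.
  apply: le_trans Hq _; apply: le_trans (ler_norm _) _; rewrite normrM ler_piMr//.
  by rewrite ger0_norm ?invr_ge0// invf_le1 ?ltr0n// ler1n.
apply: (analytic_local _ aF) => z z1; apply: eps_eq => e e0.
have e20 : 0 < e / 2 by lra.
have [K [N HK]] := quot _ z1.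
have K0 : 0 < `|K| + 1 by rewrite ltr_wpDl.
have [M HM] := natSinv_small (divr_gt0 e20 K0).
have U1 : U [set n | (maxn N M <= n)%N] by apply: sU; exists (maxn N M).
have [n []] := filter_ex (filterI U1 (HF _ _ z1 e20)).
rewrite /= geq_max => /andP[Nn Mn] /(_ z (lexx _)) n1.
have [_ n2] := HK n z Nn (lexx _).
have -> : cderiv f z - F z = - (u n z - cderiv f z) + (u n z - F z) by ring.
apply: le_lt_trans (cabsD _ _) _; rewrite cabsN.
suff H : K * n.+1%:R^-1 <= e / 2 by rewrite [e]splitr; exact: ler_ltD (le_trans n2 H) n1.
have := HM n Mn; rewrite ltr_pdivlMr// => HM'; apply: le_trans (ltW HM').
rewrite mulrC ler_wpM2l ?invr_ge0//; apply: le_trans (ler_norm _) _; by rewrite lerDl.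
Qed.

(** An ultrafilter finer than the eventual filter contains every tail of the index set and every set
    of indices at which [u] is uniformly close to [F]. These sets meet, so good indices can be
    picked one after the other. *)
Lemma montel (u : nat -> R[i] -> R[i]) : (forall k, analytic (u k)) ->
  (forall r, r < 1 -> exists B, forall k z, cabs z <= r -> cabs (u k z) <= B) ->
  exists (phi : nat -> nat) F, [/\ {homo phi : i j / (i < j)%N}, analytic F &
    forall r e, r < 1 -> 0 < e -> exists N, forall k, (N <= k)%N ->
      forall z, cabs z <= r -> cabs (u (phi k) z - F z) < e].
Proof.
move=> au ub.
have [U [UU sU]] := ultraFilterLemma eventually_filter.
have [|F [aF HF]] := @ultra_montel _ _ U UU u.
  move=> r r1; have [B HB] := ub r r1; exists B; apply: filterE => k z zr; split; last exact: HB.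
  by eexists; apply: analytic_cdiff => //; exact: le_lt_trans r1.
have pick (jm : nat * nat) : exists k, (jm.2 < k)%N /\
    forall z, cabs z <= 1 - jm.1.+1%:R^-1 -> cabs (u k z - F z) < jm.1.+1%:R^-1.
  have U1 : U [set n | (jm.2 < n)%N] by apply: sU; exists jm.2.+1.
  have r1 : 1 - jm.1.+1%:R^-1 < 1 :> R by rewrite gtrBl invr_gt0.
  have e0 : 0 < jm.1.+1%:R^-1 :> R by rewrite invr_gt0.
  by have [k [k1 k2]] := filter_ex (filterI U1 (HF _ _ r1 e0)); exists k.
have [c Hc] := choice pick.
(* The previous index enters the choice, to make [phi] increasing. *)
pose phi := fix phi k := if k is k'.+1 then c (k, phi k') else c (0%N, 0%N).
have phiP k z : cabs z <= 1 - k.+1%:R^-1 -> cabs (u (phi k) z - F z) < k.+1%:R^-1.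
  by case: k => [|k]; [exact: (Hc (0%N, 0%N)).2|exact: (Hc (k.+1, phi k)).2].
exists phi, F; split => //.
  apply: homo_ltn; first by move=> ? ? ?; exact: ltn_trans.
  by move=> k; exact: (Hc (k.+1, phi k)).1.
move=> r e r1 e0.
have [N1 HN1] := natSinv_small e0; have [N2 HN2] := @natSinv_small (1 - r) ltac:(lra).
exists (maxn N1 N2) => k; rewrite geq_max => /andP[/HN1 k1 /HN2 k2] z zr.
by apply: lt_trans k1; apply: phiP; apply: le_trans zr _; rewrite lerBrDl -lerBrDr ltW.
Qed.

Lemma udisc_scale z t : udisc z -> 0 <= t <= 1 -> udisc (t%:C%C * z).
Proof.
move=> z1 /andP[t0 t1]; rewrite /udisc /= cabsM cabs_real ger0_norm//.
by apply: le_lt_trans z1; rewrite ler_piMl ?cabs_ge0.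
Qed.

Lemma ccont_radial f z : (forall w, udisc w -> ccts f w) -> udisc z ->
  ccont 0 1 (fun t => f (t%:C%C * z)).
Proof.
move=> cf z1 t t01; have := @ccts_path _ f 0 z t; rewrite add0r => H.
have := H (cf _ (udisc_scale z1 t01)); congr (ccont_at _ _).
by apply/funext => s; rewrite add0r.
Qed.

Lemma seg_intE f z : seg_int f z = z * cint 0 1 (fun t => f (t%:C%C * z)).
Proof. by []. Qed.

Lemma path_diff_radial F z t l : cdiff F (t%:C%C * z) l ->
  path_diff (fun s => F (s%:C%C * z)) t (z * l).
Proof.
move=> dF; have := @cdiff_path _ F 0 z t l; rewrite add0r => /(_ dF).
by congr (path_diff _ _ _); apply/funext => s; rewrite add0r.
Qed.

Lemma seg_int_cderiv f z : analytic f -> udisc z -> seg_int (cderiv f) z = f z - f 0.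
Proof.
move=> af z1; have adf := analytic_cderiv af.
have c1 : ccont 0 1 (fun t => cderiv f (t%:C%C * z)).
  by apply: ccont_radial => // w w1; exact: analytic_ccts.
rewrite seg_intE -cintZ// (@cint_FTC _ 0 1 (fun s => f (s%:C%C * z)))//.
- by rewrite mul1r mul0r.
- exact: ccontZ.
- by move=> t t01; apply: path_diff_radial; apply: analytic_cdiff => //; exact: udisc_scale.
Qed.

Lemma cint_cst (k : R[i]) : cint 0 1 (fun=> k) = k.
Proof.
rewrite (@cint_FTC _ 0 1 (fun s => s%:C%C * k))//.
- by rewrite mul1r mul0r subr0.
- by move=> t _ e e0; exists 1 => // s _; rewrite subrr ComplexField.Normc.normc0.
- move=> t _ e e0; exists 1 => // s _; rewrite rmorphB /= mulrBl subrr.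
  by rewrite ComplexField.Normc.normc0 mulr_ge0// ltW.
Qed.

(** Write [seg_int f z] as z I(z), where I(z) is the integral of f(t z) over t in [0, 1]. The Taylor
    remainder is uniform in [t], so I can be differentiated under the integral sign; it remains to
    see that z I'(z) + I(z) = f(z). *)
Lemma seg_int_cdiff f z : analytic f -> udisc z -> cdiff (seg_int f) z (f z).
Proof.
move=> af z1; have adf := analytic_cderiv af.
have cf w : udisc w -> ccont 0 1 (fun t => f (t%:C%C * w)).
  by apply: ccont_radial => v; exact: analytic_ccts.
pose df t := t%:C%C * cderiv f (t%:C%C * z).
have cid : ccont 0 1 (fun t => t%:C%C : R[i]).
  by move=> t _ e e0; exists e => // s; rewrite -rmorphB cabs_real.
have cdf : ccont 0 1 df.
  move=> t t01; rewrite /df.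
  have [z0|z0] := eqVneq z 0.
    rewrite z0; have -> : (fun t0 : R => t0%:C%C * cderiv f (t0%:C%C * 0)) =
       (fun t => cderiv f 0 * t%:C%C) by apply/funext => s; rewrite mulr0 mulrC.
    exact: (@ccontZ _ 0 1 _ _ cid).
  (* For nonzero [z] the integrand is 1 / z times the continuous function w f'(w), taken at w = t
     z. *)
  have -> : (fun t : R => t%:C%C * cderiv f (t%:C%C * z)) =
     (fun t : R => z^-1 * ((fun w => w * cderiv f w) (t%:C%C * z))).
    by apply/funext => s; field.
  apply: (@ccontZ _ 0 1) => // s s01; apply: (@ccont_radial (fun w => w * cderiv f w)) => // w w1.
  by apply: (@cdiff_ccts _ _ _ (w * cderiv (cderiv f) w + 1 * cderiv f w));
    apply: cdiffM; [exact: cdiff_id|exact: analytic_cdiff].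
have dA : cdiff (fun w => cint 0 1 (fun t => f (t%:C%C * w))) z (cint 0 1 df).
  set r := (1 + cabs z) / 2; have z1' : cabs z < 1 by [].
  have r1 : r < 1 by rewrite /r; lra.
  have zr : cabs z <= r by rewrite /r; lra.
  have [B B0 HB] := @analytic_holo_bounded f ((1 + r) / 2) af ltac:(lra).
  have r0 : 0 < 1 - r by lra.
  set K := 256 * B / (1 - r) ^+ 2.
  have K0 : 0 < K by rewrite /K; apply: divr_gt0 (mulr_gt0 _ B0) (exprn_gt0 _ r0); rewrite ltr0n.
  move=> e e0; exists (Num.min ((1 - r) / 8) (e / (2 * K))).
    by rewrite lt_min (divr_gt0 r0)//= (divr_gt0 e0 (mulr_gt0 _ K0)).
  move=> h; rewrite lt_min => /andP[h1 h2].
  have zh1 : udisc (z + h) by apply: le_lt_trans (cabsD _ _) _; move: h1; rewrite /r; lra.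
  rewrite -mulN1r -[in X in _ - X]cintZ// -(cintZ (-1))//; last exact: cf.
  have c1 : ccont 0 1 (fun t => -1 * f (t%:C%C * z)) by apply: ccontZ; exact: cf.
  have c2 : ccont 0 1 (fun t => h * df t) by exact: ccontZ.
  have c3 := ccontD (cf _ zh1) c1.
  have c4 : ccont 0 1 (fun t => -1 * (h * df t)) by exact: ccontZ.
  rewrite -cintD//; last exact: cf.
  rewrite -[X in _ + X]mulN1r -(cintZ (-1))// -cintD//.
  have := @cabs_cint_bound _ 0 1 _ (K * cabs h ^+ 2) ler01 (ccontD c3 c4).
  rewrite subr0 mulr1 => /(_ _) HH; apply: le_trans (HH _) _.
    move=> t t01; rewrite !mulN1r /df.
    have t1 : cabs (t%:C%C * h) <= cabs h.
      rewrite cabsM cabs_real; case/andP: t01 => t0 t1; rewrite ger0_norm//.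
      by rewrite ler_piMl ?cabs_ge0.
    have t2 : cabs (t%:C%C * z) <= r.
      apply: le_trans zr; rewrite cabsM cabs_real; case/andP: t01 => t0 t1'; rewrite ger0_norm//.
      by rewrite ler_piMl ?cabs_ge0.
    have := taylor2 r1 HB t2 (le_trans t1 (ltW h1)).
    rewrite -/K mulrDr -mulrA (mulrCA h) => T; apply: le_trans T _.
    by rewrite ler_wpM2l ?(ltW K0)// ler_sqr ?nnegrE ?cabs_ge0.
  have -> : 2 * (K * cabs h ^+ 2) = 2 * K * cabs h * cabs h by ring.
  rewrite ler_wpM2r ?cabs_ge0//.
  have K20 : 0 < 2 * K by apply: mulr_gt0.
  by move: h2; rewrite (ltr_pdivlMr _ _ K20) => /ltW; rewrite mulrC.
have := cdiffM (cdiff_id z) dA; congr (cdiff _ _ _).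
rewrite mul1r.
have [z0|z0] := eqVneq z 0.
  rewrite z0 mul0r add0r -[RHS]cint_cst; apply: eq_cint => t _; by rewrite mulr0.
(* Multiplied by [z], the integrand is the derivative of w f(w) along the segment, and the
   fundamental theorem gives z f(z). *)
apply: (mulfI z0); rewrite mulrDr.
have cz : ccont 0 1 (fun t => z * df t) by exact: ccontZ.
have cs := ccontD cz (cf _ z1).
rewrite -cintZ// -mulrDr -cintD//; last exact: cf.
rewrite -cintZ// (@cint_FTC _ 0 1 (fun s => (fun w => w * f w) (s%:C%C * z)))//.
- by rewrite mul1r !mul0r subr0.
- exact: ccontZ.
- move=> t t01; have tz := udisc_scale z1 t01.
  have := path_diff_radial (cdiffM (cdiff_id (t%:C%C * z)) (analytic_cdiff af tz)).
  by congr (path_diff _ _ _); rewrite /df; ring.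
Qed.

Lemma analytic_seg_int f : analytic f -> analytic (seg_int f).
Proof. by move=> af; apply: analyticP => z z1; exists (f z); exact: seg_int_cdiff. Qed.

Lemma cderiv_seg_int f z : analytic f -> udisc z -> cderiv (seg_int f) z = f z.
Proof. by move=> af z1; apply/cdiff_cderiv/seg_int_cdiff. Qed.

Lemma analytic_iter_seg_int n f : analytic f -> analytic (iter n (@seg_int R) f).
Proof. by move=> af; elim: n => [|n IH]; [exact: af|rewrite iterS; apply: analytic_seg_int; exact: IH]. Qed.

Lemma analytic_iter_cderiv n f : analytic f -> analytic (iter n (@cderiv R) f).
Proof. by move=> af; elim: n => [|n IH]; [exact: af|rewrite iterS; apply: analytic_cderiv; exact: IH]. Qed.

Lemma iter_cderiv_sub n f F z : analytic f -> analytic F -> udisc z ->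
  iter n (@cderiv R) (fun w => f w - F w) z = iter n (@cderiv R) f z - iter n (@cderiv R) F z.
Proof.
move=> af aF; elim: n z => [//|n IH] z z1; rewrite !iterS.
have A1 := analytic_iter_cderiv (n := n) af; have A2 := analytic_iter_cderiv (n := n) aF.
by rewrite (cderiv_local IH (analyticB A1 A2) z1) cderivB.
Qed.

(** The innermost derivative cancels the outermost primitive. This equality holds on the disc, and
    [loc] carries it through the remaining derivatives. *)
Lemma iter_cderiv_seg_int n f z : analytic f -> udisc z ->
  iter n (@cderiv R) (iter n (@seg_int R) f) z = f z.
Proof.
move=> af; elim: n z => // n IH z z1; rewrite iterSr [iter n.+1 (@seg_int R) f]/=.
set G := iter n (@seg_int R) f in IH *.
have aG : analytic G by exact: analytic_iter_seg_int.
have loc k : forall w, udisc w -> iter k (@cderiv R) (cderiv (seg_int G)) w = iter k (@cderiv R) G w.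
  elim: k => [|k IHk] w w1; [exact: cderiv_seg_int|rewrite !iterS].
  exact: (cderiv_local IHk (analytic_iter_cderiv (n := k) aG) w1).
by rewrite loc// IH.
Qed.

End analytic_functions.

(** * Mean value inequalities *)

(** The measure dx dy under a name of its own, to be registered as sigma-finite, which Tonelli's
    theorem on pairs of points requires. *)
Definition area (R : realType) : set (plane R) -> \bar R := (@lebesgue_measure R \x @lebesgue_measure R)%E.
HB.instance Definition _ (R : realType) := Measure.copy (@area R) ((@lebesgue_measure R \x @lebesgue_measure R)%E).
Section area_sigma_finite.
Variable R : realType.
Lemma area_sigma_finite : sigma_finite setT (@area R).
Proof.
have /sigma_finiteP [F [TF ndF Foo]] := sigma_finiteT (@lebesgue_measure R).
exists (fun n => F n `*` F n).
  rewrite -setXTT TF predeqE => -[x y]; split.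
    move=> [/= [n _ Fnx] [k _ Gky]]; exists (maxn n k) => //; split.
    - by move: x Fnx; exact/subsetPset/ndF/leq_maxl.
    - by move: y Gky; exact/subsetPset/ndF/leq_maxr.
  by move=> [n _ []/= ? ?]; split; exists n.
move=> k; have [mk Fk] := Foo k.
split; first exact: measurableX.
by rewrite /area product_measure1E//; apply: lte_mul_pinfty => //; rewrite ge0_fin_numE.
Qed.
HB.instance Definition _ := Measure_isSigmaFinite.Build _ _ _ (@area R) area_sigma_finite.
End area_sigma_finite.

Section area_mean.
Variable R : realType.
Implicit Types (a b c d t x y r p q rho : R) (z h : R[i]) (f : R[i] -> R[i])
  (w : plane R) (G : plane R -> \bar R).
Local Notation "'j" := (Complex 0 1 : R[i]).
Local Notation mu := (@lebesgue_measure R).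
Local Notation leb2 := (@area R).

Lemma lee_mul_sum4 (k A B C D : R) (X Y Z T : \bar R) :
  (0 <= X)%E -> (0 <= Y)%E -> (0 <= Z)%E -> (0 <= T)%E ->
  (A%:E <= k%:E * X)%E -> (B%:E <= k%:E * Y)%E -> (C%:E <= k%:E * Z)%E ->
  (D%:E <= k%:E * T)%E -> ((A + B + (C + D))%:E <= k%:E * (X + Y + (Z + T)))%E.
Proof.
move=> X0 Y0 Z0 T0 hX hY hZ hT.
rewrite (EFinD (A + B)) (EFinD A) (EFinD C) (ge0_muleDr _ (adde_ge0 X0 Y0) (adde_ge0 Z0 T0)).
by rewrite (ge0_muleDr _ X0 Y0) (ge0_muleDr _ Z0 T0); apply: leeD; apply: leeD.
Qed.

Lemma cabs_rectint_edges f a b c d : rcont f a b c d ->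
  ((cabs (rectint f a b c d))%:E <= 2%:E *
   (\int[mu]_(x in `[a, b]) (cabs (f (Complex x c)))%:E +
    \int[mu]_(x in `[a, b]) (cabs (f (Complex x d)))%:E +
   (\int[mu]_(y in `[c, d]) (cabs (f (Complex b y)))%:E +
    \int[mu]_(y in `[c, d]) (cabs (f (Complex a y)))%:E)))%E.
Proof.
move=> /rcontE[f1 f2 f3 f4]; rewrite /rectint.
have cj : cabs 'j = 1 by rewrite /ComplexField.Normc.normc expr0n /= expr1n add0r sqrtr1.
set A := cint _ _ _; set B := cint _ _ _; set C := cint _ _ _; set D := cint _ _ _.
apply: (@le_trans _ _ ((cabs A + cabs B + (cabs C + cabs D))%:E)%E).
  rewrite lee_fin; apply: le_trans (cabsD _ _) _; rewrite cabsM cj mul1r.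
  by apply: lerD; apply: le_trans (cabsD _ _) _; rewrite cabsN.
by apply: lee_mul_sum4; rewrite ?cabs_cint_le//; apply: integral_ge0 => ? _; rewrite lee_fin cabs_ge0.
Qed.

(** If every horizontal slice over [u, v] were above the average, the integral over that strip alone
    would reach [I]. *)
Lemma exists_good_y G (I : R) u v : measurable_fun setT G -> (forall w, 0 <= G w)%E ->
  u < v -> (\int[leb2]_w G w < I%:E)%E ->
  exists2 y, u <= y <= v & (\int[mu]_x G (x, y) <= (I / (v - u))%:E)%E.
Proof.
move=> mG G0 uv GI; apply: contrapT => /forall2NP H.
have uv0 : 0 < v - u by rewrite subr_gt0.
have H' y : u <= y <= v -> ((I / (v - u))%:E <= \int[mu]_x G (x, y))%E.
  by move=> yuv; case: (H y) => // /negP; rewrite -ltNge => /ltW.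
have mE := measurable_fun_fubini_tonelli_G (m1 := mu) G mG G0.
have E0 y : (0 <= \int[mu]_x G (x, y))%E by exact: integral_ge0.
have I0 : 0 <= I.
  by rewrite -lee_fin; apply: le_trans (ltW GI); exact: integral_ge0.
suff : (I%:E <= \int[leb2]_w G w)%E by rewrite leNgt GI.
have -> : (\int[leb2]_w G w = \int[mu]_y fubini_G mu G y)%E := fubini_tonelli2 G mG G0.
apply: (@le_trans _ _ (\int[mu]_(y in `[u, v]) (fubini_G mu G y))%E); last first.
  by apply: ge0_subset_integral => //; move=> y _; exact: E0.
apply: (@le_trans _ _ (\int[mu]_(y in `[u, v]) (I / (v - u))%:E)%E).
  rewrite integral_cst//= lebesgue_measure_itv /= lte_fin uv -EFinB -EFinM.
  by rewrite divfK ?gt_eqF.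
apply: ge0_le_integral => //.
- by move=> y _; rewrite lee_fin divr_ge0// ltW.
- exact: measurable_funTS mE.
Qed.

Lemma exists_good_x G (I : R) u v : measurable_fun setT G -> (forall w, 0 <= G w)%E ->
  u < v -> (\int[leb2]_w G w < I%:E)%E ->
  exists2 x, u <= x <= v & (\int[mu]_y G (x, y) <= (I / (v - u))%:E)%E.
Proof.
move=> mG G0 uv GI; apply: contrapT => /forall2NP H.
have uv0 : 0 < v - u by rewrite subr_gt0.
have H' x : u <= x <= v -> ((I / (v - u))%:E <= \int[mu]_y G (x, y))%E.
  by move=> yuv; case: (H x) => // /negP; rewrite -ltNge => /ltW.
have mE := measurable_fun_fubini_tonelli_F (m2 := mu) G mG G0.
have E0 x : (0 <= \int[mu]_y G (x, y))%E by exact: integral_ge0.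
have I0 : 0 <= I.
  by rewrite -lee_fin; apply: le_trans (ltW GI); exact: integral_ge0.
suff : (I%:E <= \int[leb2]_w G w)%E by rewrite leNgt GI.
have -> : (\int[leb2]_w G w = \int[mu]_x fubini_F mu G x)%E := fubini_tonelli1 G mG G0.
apply: (@le_trans _ _ (\int[mu]_(y in `[u, v]) (fubini_F mu G y))%E); last first.
  by apply: ge0_subset_integral => //; move=> y _; exact: E0.
apply: (@le_trans _ _ (\int[mu]_(y in `[u, v]) (I / (v - u))%:E)%E).
  rewrite integral_cst//= lebesgue_measure_itv /= lte_fin uv -EFinB -EFinM.
  by rewrite divfK ?gt_eqF.
apply: ge0_le_integral => //.
- by move=> y _; rewrite lee_fin divr_ge0// ltW.
- exact: measurable_funTS mE.
Qed.

Lemma edge_integral_le (F : R -> R) (g : R -> \bar R) a b k (K : R) :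
  mu.-integrable `[a, b] (EFin \o F) -> measurable_fun setT g ->
  (forall x, 0 <= g x)%E -> 0 <= k -> (forall x, 0 <= F x) ->
  (forall x, a <= x <= b -> ((F x)%:E <= k%:E * g x)%E) ->
  (\int[mu]_x g x <= K%:E)%E -> (\int[mu]_(x in `[a, b]) (F x)%:E <= (k * K)%:E)%E.
Proof.
move=> /integrableP[mF _] mg g0 k0 F0 Fg gK.
apply: (@le_trans _ _ (\int[mu]_(x in `[a, b]) (k%:E * g x))%E).
  apply: ge0_le_integral; [by []|by move=> x _; rewrite lee_fin|exact: mF| |].
    by apply: measurable_funeM; exact: measurable_funTS.
  by move=> x /=; rewrite in_itv /=; exact: Fg.
rewrite ge0_integralZl_EFin//; last exact: measurable_funTS.
rewrite EFinM lee_pmul//; first exact: integral_ge0.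
by apply: le_trans gK; apply: ge0_subset_integral => //.
Qed.

(* Cauchy's formula on the boundary of a square around [z], each side being placed
   where the integral of [G] along it is at most average. *)
Lemma area_bound f z r G (I : R) : analytic f -> 0 < r -> cabs z + 2 * r < 1 ->
  measurable_fun setT G -> (forall w, 0 <= G w)%E ->
  (forall w, cabs (cplx w - z) <= 2 * r -> ((cabs (f (cplx w)))%:E <= G w)%E) ->
  (\int[leb2]_w G w < I%:E)%E ->
  cabs (f z) <= 32 * I / r ^+ 2 /\ cabs (cderiv f z) <= 64 * I / r ^+ 3.
Proof.
move=> af r0 zr mG G0 fG GI.
have h k : k - r < k - r / 2 /\ k + r / 2 < k + r by lra.
have r20 : 0 < r / 2 by lra.
(* The sides are sought between the distances r / 2 and r from [z]: near enough for the rectangle to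
   stay within 2 r of [z], far enough for |w - z|^-1 <= 2 / r on its boundary. *)
have [c cP cI] := exists_good_y mG G0 (h (complex.Im z)).1 GI.
have [d dP dI] := exists_good_y mG G0 (h (complex.Im z)).2 GI.
have [a aP aI] := exists_good_x mG G0 (h (complex.Re z)).1 GI.
have [b bP bI] := exists_good_x mG G0 (h (complex.Re z)).2 GI.
have E1 k : k - r / 2 - (k - r) = r / 2 by lra.
have E2 k : k + r - (k + r / 2) = r / 2 by lra.
rewrite E1 in cI; rewrite E1 in aI; rewrite E2 in dI; rewrite E2 in bI.
have ir : inrect a b c d z (r / 2) by split; lra.
have [ab cd] := inrect_le (ltW r20) ir.
have insq x y : a <= x <= b -> c <= y <= d -> cabs (Complex x y - z) <= 2 * r.
  move=> xab ycd; have -> : z = Complex (complex.Re z) (complex.Im z) by case: (z).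
  by apply: cabs_small_pt; rewrite ler_norml; lra.
have indisc x y : a <= x <= b -> c <= y <= d -> udisc (Complex x y).
  move=> xab ycd; have := insq x y xab ycd; rewrite /udisc /= => H.
  rewrite -[Complex x y](subrK z); apply: le_lt_trans (cabsD _ _) _; lra.
have cdf : cdiff_on f a b c d.
  by move=> x y xab ycd; eexists; exact: analytic_cdiff (indisc _ _ xab ycd).
have [M M0 HM] : exists2 M : R, 0 < M & forall x y, redge a b c d x y -> cabs (f (Complex x y)) <= M.
  have [M M0 HM] := analytic_bounded af zr; exists M => // x y /(redge_in ab cd)[xab ycd].
  apply: HM; rewrite -[Complex x y](subrK z); apply: le_trans (cabsD _ _) _.
  by rewrite addrC lerD2l; exact: insq.
have CF := cauchy_formula r20 ir cdf.
have CD := cderiv_rectint r20 ir cdf HM.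
have p1 : 1 <= 2 * pi :> R by have := pi_ge2 R; lra.
have I0 : 0 <= I by rewrite -lee_fin; apply: le_trans (ltW GI); exact: integral_ge0.
have rI0 : 0 <= I / (r / 2) by rewrite divr_ge0// ltW.
(* The multiplier [g] is (w - z)^-1 for the value of [f] and its square for the derivative. The 8
   counts four sides and the factor 2 of [cabs_cint_le]. *)
have step (g : R[i] -> R[i]) (k : R) : 0 <= k ->
   rcont (fun v => f v * g v) a b c d ->
   (forall x y, redge a b c d x y -> cabs (g (Complex x y)) <= k) ->
   cabs (rectint (fun v => f v * g v) a b c d) <= 8 * (k * (I / (r / 2))).
  move=> k0 rc gk; rewrite -lee_fin.
  apply: le_trans (cabs_rectint_edges rc) _.
  have [r1 r2 r3 r4] := rcontE rc.
  have [_ _ i1] := ccont_integrable r1; have [_ _ i2] := ccont_integrable r2.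
  have [_ _ i3] := ccont_integrable r3; have [_ _ i4] := ccont_integrable r4.
  have pt x y : redge a b c d x y ->
     ((cabs (f (Complex x y) * g (Complex x y)))%:E <= k%:E * G (x, y))%E.
    move=> Hxy; rewrite cabsM mulrC EFinM; apply: lee_pmul; rewrite ?lee_fin ?cabs_ge0//.
      exact: gk.
    have [xab ycd] := redge_in ab cd Hxy.
    exact: fG (x, y) (insq _ _ xab ycd).
  have mx y : measurable_fun setT (fun x => G (x, y)) by exact: measurable_fun_pair1.
  have my x : measurable_fun setT (fun y => G (x, y)) by exact: measurable_fun_pair2.
  have e1 : (\int[mu]_(x in `[a, b]) (cabs (f (Complex x c) * g (Complex x c)))%:E <= (k * (I / (r / 2)))%:E)%E.
    exact: (edge_integral_le i1 (mx c) (fun=> G0 _) k0 (fun=> cabs_ge0 _) (fun x xab => pt _ _ (or_introl (conj xab (or_introl erefl)))) cI).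
  have e2 : (\int[mu]_(x in `[a, b]) (cabs (f (Complex x d) * g (Complex x d)))%:E <= (k * (I / (r / 2)))%:E)%E.
    exact: (edge_integral_le i2 (mx d) (fun=> G0 _) k0 (fun=> cabs_ge0 _) (fun x xab => pt _ _ (or_introl (conj xab (or_intror erefl)))) dI).
  have e3 : (\int[mu]_(y in `[c, d]) (cabs (f (Complex a y) * g (Complex a y)))%:E <= (k * (I / (r / 2)))%:E)%E.
    exact: (edge_integral_le i3 (my a) (fun=> G0 _) k0 (fun=> cabs_ge0 _) (fun x xab => pt _ _ (or_intror (conj (or_introl erefl) xab))) aI).
  have e4 : (\int[mu]_(y in `[c, d]) (cabs (f (Complex b y) * g (Complex b y)))%:E <= (k * (I / (r / 2)))%:E)%E.
    exact: (edge_integral_le i4 (my b) (fun=> G0 _) k0 (fun=> cabs_ge0 _) (fun x xab => pt _ _ (or_intror (conj (or_intror erefl) xab))) bI).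
  have -> : 8 * (k * (I / (r / 2))) = 2 * (k * (I / (r / 2)) + k * (I / (r / 2)) +
      (k * (I / (r / 2)) + k * (I / (r / 2)))) by ring.
  by rewrite EFinM lee_pmul2l// !EFinD; apply: leeD; apply: leeD.
have rc1 : rcont (fun v => f v * (v - z)^-1) a b c d.
  move=> x y Hxy; have [xab ycd] := redge_in ab cd Hxy; have [l dl] := cdf _ _ xab ycd.
  by have [l' dl'] := cdiff_inv_sub (redge_neq r20 ir Hxy); exact: cdiff_ccts (cdiffM dl dl').
have rc2 : rcont (fun v => f v * ((v - z)^-1 * (v - z)^-1)) a b c d.
  move=> x y Hxy; have [xab ycd] := redge_in ab cd Hxy; have [l dl] := cdf _ _ xab ycd.
  by have [l' dl'] := cdiff_inv_sub (redge_neq r20 ir Hxy);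
    exact: cdiff_ccts (cdiffM dl (cdiffM dl' dl')).
have iv x y : redge a b c d x y -> cabs (Complex x y - z)^-1 <= (r / 2)^-1.
  move=> Hxy; have := redge_far (ltW r20) ir Hxy => k1.
  by rewrite cabsV lef_pV2// posrE (lt_le_trans r20).
have k0 : 0 <= (r / 2)^-1 by rewrite invr_ge0 ltW.
split.
  have := step _ _ k0 rc1 iv; rewrite CF cabs_2pi => H.
  apply: le_trans (_ : 2 * pi * cabs (f z) <= _); first by rewrite ler_peMl ?cabs_ge0.
  apply: le_trans H _; rewrite le_eqVlt; apply/orP; left; apply/eqP; field; lra.
have := step _ _ (mulr_ge0 k0 k0) rc2; rewrite CD cabs_2pi => H.
apply: le_trans (_ : 2 * pi * cabs (cderiv f z) <= _); first by rewrite ler_peMl ?cabs_ge0.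
apply: le_trans (H _) _.
  by move=> x y Hxy; rewrite cabsM; apply: ler_pM; rewrite ?cabs_ge0//; exact: iv.
rewrite le_eqVlt; apply/orP; left; apply/eqP; field; lra.
Qed.

Lemma measurable_ccts f (O : set (plane R)) : measurable O ->
  (forall w, O w -> exists2 e : R, 0 < e & forall v : plane R,
     `|v.1 - w.1| < e -> `|v.2 - w.2| < e -> O v) ->
  (forall w, O w -> ccts f (cplx w)) ->
  measurable_fun O (fun w => cabs (f (cplx w))).
Proof.
move=> mO oO cf; apply: plane_cts_measurable => // w Ow t t0.
have [d1 d10 H1] := cf w Ow t t0.
have [d d0 H] := @cplx_near _ w _ d10; exists d => // v v1 v2.
apply: le_lt_trans (cabs_dist _ _) _.
by have := H1 _ (H v v1 v2); rewrite subrKC.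
Qed.

Lemma measurable_analytic f : analytic f ->
  measurable_fun (disc (R := R)) (fun w => cabs (f (cplx w))).
Proof.
move=> af; apply: measurable_ccts; [exact: measurable_disc|exact: (@disc_r_open _ 1)|].
by move=> w w1; exact: analytic_ccts.
Qed.

Definition pball z rho : set (plane R) := [set w | cabs (cplx w - z) < rho].

Lemma measurable_pball z rho : measurable (pball z rho).
Proof.
apply: plane_open_measurable => w; rewrite /pball /= => wr.
have [d d0 H] := @cplx_near _ w (rho - cabs (cplx w - z)) ltac:(lra).
exists d => // v v1 v2; have := H v v1 v2.
have := cabsD (cplx v - cplx w) (cplx w - z); rewrite addrA subrK; lra.
Qed.

Lemma leb2_square x y rho : 0 < rho ->
  leb2 (`[x - rho, x + rho] `*` `[y - rho, y + rho]) = (4 * rho ^+ 2)%:E.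
Proof.
move=> r0; rewrite /area product_measure1E//= !lebesgue_measure_itv /= !lte_fin.
rewrite !ifT; [|lra|lra].
by rewrite -!EFinB -EFinM; congr EFin; ring.
Qed.

Lemma leb2_pball z rho : 0 < rho -> (leb2 (pball z rho) <= (4 * rho ^+ 2)%:E)%E.
Proof.
move=> r0; rewrite -(leb2_square (complex.Re z) (complex.Im z) r0).
apply: le_measure; rewrite ?inE; [exact: measurable_pball|exact: measurableX|].
move=> w; rewrite /pball /= => wz; rewrite !in_itv /=.
have := le_lt_trans (normr_Re_le _) wz; have := le_lt_trans (normr_Im_le _) wz.
by case: (z) => u v /=; rewrite !ltr_norml; lra.
Qed.

Lemma pball_disc z rho : cabs z + rho <= 1 -> pball z rho `<=` disc (R := R).
Proof.
move=> zr w; rewrite /pball /disc /udisc /= => wz.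
have := cabsD (cplx w - z) z; rewrite subrK; lra.
Qed.

Lemma area_disc : (leb2 (disc (R := R)) <= 4%:E)%E.
Proof.
have -> : (4 : R)%:E = (4 * 1 ^+ 2)%:E by rewrite expr1n mulr1.
apply: le_trans (leb2_pball 0 ltr01); apply: le_measure; rewrite ?inE//.
- exact: measurable_disc.
- exact: measurable_pball.
- by move=> w; rewrite /pball /= subr0.
Qed.

(** The bounds [P] are positive and finite, so that the proofs below can divide by them and take
    roots even when [X] is 0. *)
Lemma lee_of_pos_bounds (x c : R) (X : \bar R) : 0 < c -> (0 <= X)%E ->
  (forall P, 0 < P -> (X <= P%:E)%E -> x <= c * P) -> (x%:E <= c%:E * X)%E.
Proof.
move=> c0; case: X => [P| |//] X0 H; last by rewrite gt0_muley ?lte_fin ?leey.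
rewrite -EFinM lee_fin; apply/ler_addgt0Pr => e e0.
have P0 : 0 <= P by rewrite -lee_fin.
apply: le_trans (H (P + e / c) _ _) _.
- by rewrite ltr_wpDl// divr_gt0.
- by rewrite lee_fin lerDl ltW// divr_gt0.
- by rewrite mulrDr lerD2l mulrCA divff ?gt_eqF// mulr1.
Qed.

(* Optimizing over [lam] gives Jensen's inequality up to a factor 2. *)
Lemma young_powR x lam q : 0 <= x -> 0 < lam -> 1 <= q ->
  x <= lam + lam * (lam `^ q)^-1 * x `^ q.
Proof.
move=> x0 l0 q1; have [xl|lx] := leP x lam.
  by apply: le_trans xl _; rewrite lerDl !mulr_ge0 ?invr_ge0 ?powR_ge0// ltW.
apply: le_trans (_ : lam * (x / lam) `^ q <= _); last first.
  rewrite powRM//; last by rewrite invr_ge0 ltW.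
  have -> : lam^-1 `^ q = (lam `^ q)^-1 by rewrite -(powR_inv1 (ltW l0)) -powRrM mulN1r powRN.
  by rewrite [x `^ q * _]mulrC mulrA lerDr ltW.
have ln0 : lam != 0 by rewrite gt_eqF.
rewrite -{1}[x](divfK ln0) mulrC; apply: ler_wpM2l; first exact: ltW.
by apply: le1r_powR => //; rewrite ler_pdivlMr// mul1r ltW.
Qed.

(** By [young_powR], |f| is dominated by [lam + k * |f|^q], whose mean over the ball is comparable
    to [lam] once [lam] is the L^q mean of |f|. Then [area_bound] controls f(z) and, multiplied by
    [rho], the derivative. *)
Lemma subharmonic q : 1 <= q -> exists2 K : R, 0 < K & forall f z rho,
  analytic f -> 0 < rho -> cabs z + rho <= 1 ->
  (((cabs (f z)) `^ q)%:E <= (K / rho ^+ 2)%:E *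
    \int[leb2]_(w in pball z rho) (cabs (f (cplx w)) `^ q)%:E)%E /\
  (((rho * cabs (cderiv f z)) `^ q)%:E <= (K / rho ^+ 2)%:E *
    \int[leb2]_(w in pball z rho) (cabs (f (cplx w)) `^ q)%:E)%E.
Proof.
(* Below, [rho = 4 r]. The 32 is that of [area_bound]; 66 exceeds 64 + 1, where 4 rho^2 = 64 r^2
   bounds the area and 1 stands for the term [k * P]; 8 is rho / r = 4 times the ratio 64 / 32 of
   the two bounds in [area_bound]. The factor 16 in the final constant is (rho / r)^2. *)
move=> q1; pose c : R := 32 * 66 * 8; have c0 : 0 < c by rewrite !mulr_gt0// ltr0n.
have q0 : 0 < q by lra.
exists (16 * c `^ q); first by rewrite mulr_gt0 ?powR_gt0.
move=> f z rho af r0 zr; pose r := rho / 4; have r40 : 0 < r by rewrite /r; lra.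
set J := (\int[leb2]_(w in pball z rho) _)%E.
have J0 : (0 <= J)%E by apply: integral_ge0 => w _; rewrite lee_fin powR_ge0.
have mf : measurable_fun (pball z rho) (fun w => cabs (f (cplx w)) `^ q).
  apply: (measurableT_comp (measurable_powR q)).
  by apply: measurable_funS (measurable_analytic af); [exact: measurable_disc|exact: pball_disc].
have key P : 0 < P -> (J <= P%:E)%E ->
    (cabs (f z)) `^ q <= 16 * c `^ q / rho ^+ 2 * P /\
    (rho * cabs (cderiv f z)) `^ q <= 16 * c `^ q / rho ^+ 2 * P.
  move=> P0 JP; pose lam := (P / r ^+ 2) `^ q^-1.
  have Pr0 : 0 < P / r ^+ 2 by rewrite divr_gt0// exprn_gt0.
  have l0 : 0 < lam by rewrite powR_gt0.
  have lq : lam `^ q = P / r ^+ 2 by rewrite -powRrM mulVf ?gt_eqF// powRr1// ltW.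
  pose k := lam * (lam `^ q)^-1; have k0 : 0 < k by rewrite mulr_gt0// invr_gt0 powR_gt0.
  have kP : k * P = lam * r ^+ 2 by rewrite /k lq; field; rewrite !gt_eqF.
  pose G : plane R -> \bar R := (fun w => (lam + k * cabs (f (cplx w)) `^ q)%:E) \_ (pball z rho).
  have mG' : measurable_fun (pball z rho) (fun w => (lam + k * cabs (f (cplx w)) `^ q)%:E).
    by apply/measurable_EFinP; apply: measurable_funD => //; exact: measurable_funM.
  have mG : measurable_fun setT G by apply/(measurable_restrictT _ _).1 => //; exact: measurable_pball.
  have G'0 w : (0 <= (lam + k * cabs (f (cplx w)) `^ q)%:E)%E.
    exact: (addr_ge0 (ltW l0) (mulr_ge0 (ltW k0) (powR_ge0 _ _))).
  have G0 w : (0 <= G w)%E by rewrite /G patchE; case: ifP.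
  have GI : (\int[leb2]_w G w < (lam * r ^+ 2 * 66)%:E)%E.
    rewrite -integral_mkcond.
    have mB := measurable_pball z rho.
    have n1 w : pball z rho w -> (0 <= lam%:E)%E by move=> _; rewrite lee_fin ltW.
    have n2 w : pball z rho w -> (0 <= (cabs (f (cplx w)) `^ q)%:E)%E.
      by move=> _; rewrite lee_fin powR_ge0.
    have n3 w : pball z rho w -> (0 <= k%:E * (cabs (f (cplx w)) `^ q)%:E)%E.
      by move=> Bw; rewrite mule_ge0 ?n2// lee_fin ltW.
    have m2 : measurable_fun (pball z rho) (fun w => (cabs (f (cplx w)) `^ q)%:E).
      exact/measurable_EFinP.
    have m3 : measurable_fun (pball z rho) (fun w => k%:E * (cabs (f (cplx w)) `^ q)%:E)%E.
      exact: measurable_funeM.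
    under eq_integral do rewrite EFinD EFinM.
    rewrite (ge0_integralD _ mB n1 (measurable_cst _) n3 m3) integral_cst//.
    rewrite (ge0_integralZl_EFin _ mB n2 m2 (ltW k0)).
    apply: (@le_lt_trans _ _ ((lam * (4 * rho ^+ 2))%:E + (k * P)%:E)%E).
      apply: leeD; [rewrite (EFinM lam) lee_pmul2l ?lte_fin//|by rewrite (EFinM k) lee_pmul2l ?lte_fin].
      exact: leb2_pball.
    rewrite -EFinD lte_fin kP.
    have -> : lam * (4 * rho ^+ 2) = lam * r ^+ 2 * 64 by rewrite /r; field.
    have : 0 < lam * r ^+ 2 by rewrite mulr_gt0// exprn_gt0.
    lra.
  have zr' : cabs z + 2 * r < 1 by rewrite /r; lra.
  have fG w : cabs (cplx w - z) <= 2 * r -> ((cabs (f (cplx w)))%:E <= G w)%E.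
    move=> wz; rewrite /G patchE ifT; last by rewrite inE /pball /=; move: wz; rewrite /r; lra.
    by rewrite lee_fin; exact: young_powR (cabs_ge0 _) l0 q1.
  have [] := area_bound af r40 zr' mG G0 fG GI.
  have e1 : 32 * (lam * r ^+ 2 * 66) / r ^+ 2 = 32 * 66 * lam by field; rewrite gt_eqF.
  have e2 : 64 * (lam * r ^+ 2 * 66) / r ^+ 3 = 64 * 66 * lam / r by field; rewrite gt_eqF.
  rewrite e1 e2 => b1 b2.
  have fin x : 0 <= x -> x <= c * lam -> x `^ q <= 16 * c `^ q / rho ^+ 2 * P.
    move=> x0 xc; apply: le_trans (_ : (c * lam) `^ q <= _).
      by apply: ge0_ler_powR; rewrite ?nnegrE// ?(ltW q0)//; exact: le_trans xc.
    rewrite powRM ?(ltW c0) ?(ltW l0)// lq /r le_eqVlt; apply/orP; left; apply/eqP; field; lra.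
  split; apply: fin; rewrite ?cabs_ge0 ?(mulr_ge0 (ltW r0) (cabs_ge0 _))//.
    by apply: le_trans b1 _; rewrite ler_pM2r// /c; lra.
  move: b2; rewrite ler_pdivlMr// /r => b2.
  by apply: le_trans (_ : 64 * 66 * lam * 4 <= _); [lra|rewrite /c; lra].
have cc0 : 0 < 16 * c `^ q / rho ^+ 2 by rewrite divr_gt0 ?exprn_gt0// mulr_gt0 ?powR_gt0.
by split; apply: lee_of_pos_bounds => // P P0 /(key P P0)[].
Qed.

End area_mean.

(** * Averaging over hyperbolic discs *)

Section averaging.
Variable R : realType.
Implicit Types (a b d t x y r p q rho : R) (z h : R[i]) (f : R[i] -> R[i])
  (c w v : plane R).
Local Notation leb2 := (@area R).

Definition delta w : R := 1 - cabs (cplx w).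

Lemma measurable_cabsT : measurable_fun setT (fun w : plane R => cabs (cplx w)).
Proof.
apply: plane_cts_measurable => //; first by move=> w _; exists 1.
move=> w _ t t0; have [d d0 H] := @cplx_near _ w _ t0; exists d => // v v1 v2.
by apply: le_lt_trans (cabs_dist _ _) _; exact: H.
Qed.

Lemma cabs_le_delta d w : d <= delta w -> cabs (cplx w) <= 1 - d.
Proof. by rewrite /delta; lra. Qed.

Lemma measurable_delta : measurable_fun setT delta.
Proof. by apply: measurable_funB => //; exact: measurable_cabsT. Qed.

(** The first point is the centre, and a positive radius forces it into the disc. A set of pairs is
    what Tonelli's theorem integrates over. *)
Definition nbr : set (plane R * plane R) :=
  [set cw | cabs (cplx cw.2 - cplx cw.1) < delta cw.1 / 2].

Lemma measurable_nbr : measurable nbr.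
Proof.
pose sub (cw : plane R * plane R) : plane R := (cw.2.1 - cw.1.1, cw.2.2 - cw.1.2).
have msub : measurable_fun setT sub.
  apply: measurable_fun_pair; apply: measurable_funB.
  - exact: (measurableT_comp (@measurable_fst _ _ _ _) (@measurable_snd _ _ _ _)).
  - exact: (measurableT_comp (@measurable_fst _ _ _ _) (@measurable_fst _ _ _ _)).
  - exact: (measurableT_comp (@measurable_snd _ _ _ _) (@measurable_snd _ _ _ _)).
  - exact: (measurableT_comp (@measurable_snd _ _ _ _) (@measurable_fst _ _ _ _)).
have m1 : measurable_fun setT (fun cw : plane R * plane R => cabs (cplx (sub cw))).
  exact: measurableT_comp measurable_cabsT msub.
have m2 : measurable_fun setT (fun cw : plane R * plane R => delta cw.1 / 2).
  apply: measurable_funM => //.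
  exact: measurableT_comp measurable_delta (@measurable_fst _ _ _ _).
have mB : measurable_fun setT (fun cw : plane R * plane R => delta cw.1 / 2 - cabs (cplx (sub cw))).
  exact: measurable_funB.
have -> : nbr = (fun cw : plane R * plane R => delta cw.1 / 2 - cabs (cplx (sub cw))) @^-1` `]0, +oo[%classic.
  apply/seteqP; split => cw; rewrite /nbr /= in_itv /= andbT subr_gt0 => H; apply: le_lt_trans H;
    rewrite le_eqVlt; apply/orP; left; apply/eqP; congr cabs;
    by apply/eqP; rewrite eq_complex /= !eqxx.
by rewrite -[X in measurable X]setTI; exact: mB.
Qed.

Lemma measurable_nbr_l c : measurable [set w | nbr (c, w)].
Proof.
have -> : [set w | nbr (c, w)] = xsection nbr c.
  by apply/seteqP; split => w; rewrite /xsection /= inE.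
by apply: measurable_xsection; exact: measurable_nbr.
Qed.

Lemma measurable_nbr_r w : measurable [set c | nbr (c, w)].
Proof.
have -> : [set c | nbr (c, w)] = ysection nbr w.
  by apply/seteqP; split => c; rewrite /ysection /= inE.
by apply: measurable_ysection; exact: measurable_nbr.
Qed.

Lemma integral_indic_mul (A : set (plane R)) (k : R) (F : plane R -> R) :
  measurable A -> measurable_fun setT F -> (forall w, 0 <= F w) -> 0 <= k ->
  (k%:E * \int[leb2]_(w in A) (F w)%:E = \int[leb2]_w (k * F w * \1_A w)%:E)%E.
Proof.
move=> mA mF F0 k0; rewrite -ge0_integralZl_EFin//; last 2 first.
  by move=> w _; rewrite lee_fin.
  by apply/measurable_EFinP; exact: measurable_funTS mF.
rewrite integral_mkcond; apply: eq_integral => w _; rewrite patchE indicE.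
by case: ifP; rewrite ?mulr1 ?mulr0.
Qed.

Lemma tonelli_nbr (m Phi : plane R -> R) :
  measurable_fun setT m -> measurable_fun setT Phi ->
  (forall w, 0 <= m w) -> (forall w, 0 <= Phi w) ->
  (\int[leb2]_c ((m c)%:E * \int[leb2]_(w in [set w | nbr (c, w)]) (Phi w)%:E) =
   \int[leb2]_w ((Phi w)%:E * \int[leb2]_(c in [set c | nbr (c, w)]) (m c)%:E))%E.
Proof.
move=> mm mP m0 P0.
pose F (cw : plane R * plane R) : \bar R := ((m cw.1 * Phi cw.2) * \1_nbr cw)%:E.
have mF : measurable_fun setT F.
  apply/measurable_EFinP; apply: measurable_funM.
    apply: measurable_funM.
      exact: measurableT_comp mm (@measurable_fst _ _ _ _).
    exact: measurableT_comp mP (@measurable_snd _ _ _ _).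
  exact: measurable_indic measurable_nbr.
have F0 cw : (0 <= F cw)%E by rewrite lee_fin !mulr_ge0// indicE.
have := @fubini_tonelli _ _ (plane R) (plane R) R leb2 leb2 F mF F0.
have -> : (\int[leb2]_c \int[leb2]_w F (c, w) = \int[leb2]_c ((m c)%:E * \int[leb2]_(w in [set w | nbr (c, w)]) (Phi w)%:E))%E.
  apply: eq_integral => c _; rewrite (integral_indic_mul (measurable_nbr_l c) mP P0 (m0 c)).
  by apply: eq_integral => w _; rewrite /F !indicE.
have -> : (\int[leb2]_w \int[leb2]_c F (c, w) = \int[leb2]_w ((Phi w)%:E * \int[leb2]_(c in [set c | nbr (c, w)]) (m c)%:E))%E.
  apply: eq_integral => w _; rewrite (integral_indic_mul (measurable_nbr_r w) mm m0 (P0 w)).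
  by apply: eq_integral => c _; rewrite /F !indicE (mulrC (m c)).
by [].
Qed.

Lemma nbr_pball c : [set w | nbr (c, w)] = pball (cplx c) (delta c / 2).
Proof. by []. Qed.

(** The reverse triangle inequality. This comparability allows weights to be moved between a centre
    and the points of its ball. *)
Lemma nbr_delta c w : nbr (c, w) -> 0 < delta c /\
  delta c / 2 <= delta w <= 2 * delta c.
Proof.
rewrite /nbr /delta /= => H; have := cabs_ge0 (cplx w - cplx c).
have := cabs_dist (cplx w) (cplx c); rewrite ler_norml; lra.
Qed.

Lemma discE w : disc w = (0 < delta w).
Proof. by rewrite /disc /udisc /delta /= subr_gt0. Qed.

Lemma integral_disc_patch (F : plane R -> R) :
  (\int[leb2]_(w in disc (R := R)) (F w)%:E = \int[leb2]_w ((F \_ (disc (R := R))) w)%:E)%E.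
Proof.
rewrite integral_mkcond; apply: eq_integral => w _; rewrite !patchE; by case: ifP.
Qed.

(* Fubini, exchanging the average over [nbr (c, _)] with the integral in [c]. *)
Lemma avg_le (A m Phi v : plane R -> R) :
  measurable_fun (disc (R := R)) A ->
  measurable_fun (disc (R := R)) m -> measurable_fun (disc (R := R)) Phi ->
  measurable_fun (disc (R := R)) v ->
  (forall w, disc w -> 0 <= A w) ->
  (forall w, disc w -> 0 <= m w) -> (forall w, disc w -> 0 <= Phi w) ->
  (forall w, disc w -> 0 <= v w) ->
  (forall c, disc c -> ((A c)%:E <= (m c)%:E * \int[leb2]_(w in pball (cplx c) (delta c / 2)) (Phi w)%:E)%E) ->
  (forall w, disc w -> (\int[leb2]_(c in [set c | nbr (c, w)]) (m c)%:E <= (v w)%:E)%E) ->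
  (\int[leb2]_(c in disc (R := R)) (A c)%:E <= \int[leb2]_(w in disc (R := R)) (Phi w * v w)%:E)%E.
Proof.
move=> mA mm mP mv A0 m0 P0 v0 HA Hv; have mD := @measurable_disc R.
(* Extension by 0 lets Tonelli's theorem run over the whole plane; both points of a pair in [nbr]
   lie in the disc, where nothing changes. *)
pose m' := m \_ (disc (R := R)); pose P' := Phi \_ (disc (R := R)).
have mm' : measurable_fun setT m' by apply/(measurable_restrictT _ _).1.
have mP' : measurable_fun setT P' by apply/(measurable_restrictT _ _).1.
have m'0 w : 0 <= m' w by rewrite /m' patchE; case: ifPn => //; rewrite inE; exact: m0.
have P'0 w : 0 <= P' w by rewrite /P' patchE; case: ifPn => //; rewrite inE; exact: P0.
have nbrd c w : nbr (c, w) -> disc c /\ disc w.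
  by move=> /nbr_delta; rewrite !discE; lra.
apply: (@le_trans _ _ (\int[leb2]_c ((m' c)%:E * \int[leb2]_(w in [set w | nbr (c, w)]) (P' w)%:E))%E).
  rewrite integral_disc_patch; apply: ge0_le_integral => //.
  - by move=> w _; rewrite lee_fin patchE; case: ifPn => //; rewrite inE; exact: A0.
  - by apply/measurable_EFinP; apply/(measurable_restrictT _ _).1.
  - pose F (cw : plane R * plane R) : \bar R := ((m' cw.1 * P' cw.2) * \1_nbr cw)%:E.
    have mF : measurable_fun setT F.
      apply/measurable_EFinP; apply: measurable_funM.
        apply: measurable_funM.
          exact: measurableT_comp mm' (@measurable_fst _ _ _ _).
        exact: measurableT_comp mP' (@measurable_snd _ _ _ _).
      exact: measurable_indic measurable_nbr.
    have F0 cw : (0 <= F cw)%E by rewrite lee_fin !mulr_ge0// indicE.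
    have := @measurable_fun_fubini_tonelli_F _ _ (plane R) (plane R) R leb2 F mF F0.
    congr measurable_fun; apply/funext => c; rewrite (integral_indic_mul (measurable_nbr_l c) mP' P'0 (m'0 c)).
    by apply: eq_integral => w _; rewrite /F !indicE.
  - move=> c _; rewrite /m' !patchE; case: ifPn => [|_]; last by rewrite mul0e.
    rewrite inE => Dc; apply: le_trans (HA c Dc) _.
    rewrite le_eqVlt; apply/orP; left; apply/eqP; congr (_ * _)%E.
    apply: eq_integral => w; rewrite inE -nbr_pball => cw.
    by rewrite /P' patchE ifT// inE; have [] := nbrd _ _ cw.
rewrite (tonelli_nbr mm' mP' m'0 P'0) integral_disc_patch; apply: ge0_le_integral => //.
- by move=> w _; apply: mule_ge0; [rewrite lee_fin|apply: integral_ge0 => c _; rewrite lee_fin].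
- pose F (cw : plane R * plane R) : \bar R := ((P' cw.2 * m' cw.1) * \1_nbr cw)%:E.
  have mF : measurable_fun setT F.
    apply/measurable_EFinP; apply: measurable_funM.
      apply: measurable_funM.
        exact: measurableT_comp mP' (@measurable_snd _ _ _ _).
      exact: measurableT_comp mm' (@measurable_fst _ _ _ _).
    exact: measurable_indic measurable_nbr.
  have F0 cw : (0 <= F cw)%E by rewrite lee_fin !mulr_ge0// indicE.
  have := @measurable_fun_fubini_tonelli_G _ _ (plane R) (plane R) R leb2 F mF F0.
  congr measurable_fun; apply/funext => w; rewrite (integral_indic_mul (measurable_nbr_r w) mm' m'0 (P'0 w)).
  by apply: eq_integral => c _; rewrite /F !indicE.
- by apply/measurable_EFinP; apply/(measurable_restrictT _ _).1 => //; exact: measurable_funM.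
- move=> w _; rewrite /P' !patchE; case: ifPn => [|_]; last by rewrite mul0e.
  rewrite inE => Dw; rewrite EFinM lee_wpmul2l ?lee_fin ?P0//.
  apply: le_trans (Hv w Dw).
  rewrite le_eqVlt; apply/orP; left; apply/eqP.
  apply: eq_integral => c; rewrite inE => cw.
  by rewrite /m' patchE ifT// inE; have [] := nbrd _ _ cw.
Qed.

End averaging.

(** * Weighted area integrals of derivatives *)

Section weights.
Variable R : realType.
Implicit Types (a b d t x y p q : R) (z h : R[i]) (f : R[i] -> R[i])
  (c w v : plane R).
Local Notation leb2 := (@area R).
Local Notation D := (disc (R := R)).

(** For a negative exponent the two comparisons exchange their roles, whence both are assumed and
    the constant carries |a|. *)
Lemma powR_comparable a (K x y : R) : 1 <= K -> 0 < x -> 0 < y -> x <= K * y -> y <= K * x ->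
  y `^ a <= K `^ `|a| * x `^ a.
Proof.
move=> K1 x0 y0 xy yx; have K0 : 0 < K by lra.
have [a0|a0] := leP 0 a.
  rewrite (ger0_norm a0) -powRM ?(ltW K0) ?(ltW x0)//.
  by apply: ge0_ler_powR; rewrite ?nnegrE// ?(ltW y0)//; apply: (le_trans (ltW y0) yx).
have : x `^ (- a) <= (K * y) `^ (- a).
  by apply: ge0_ler_powR; rewrite ?nnegrE ?(ltW x0) ?oppr_ge0 ?(ltW a0)//; exact: le_trans (ltW x0) xy.
have inv u : u `^ a = (u `^ (- a))^-1 by rewrite -powRN opprK.
rewrite powRM ?(ltW K0) ?(ltW y0)// (ltr0_norm a0) !inv => H.
by rewrite ler_pdivlMr ?powR_gt0// mulrC ler_pdivrMr ?powR_gt0.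
Qed.

Lemma powR_le_half a x : 2^-1 <= x <= 1 -> x `^ a <= 2 `^ `|a|.
Proof.
move=> /andP[x2 x1]; have := @powR_comparable a 2 1 x; rewrite powR1 !mulr1.
by apply; lra.
Qed.

Lemma nbr_pball_r w : [set c | nbr (c, w)] `<=` pball (cplx w) (delta w).
Proof.
move=> c H; have [_] := nbr_delta H; move: H; rewrite /nbr /pball /=.
by rewrite -cabsN opprB; lra.
Qed.

(** The centres whose ball contains [w] lie within delta w of [w], in a set of area at most 4 (delta
    w)^2. *)
Lemma integral_nbr_le (m : plane R -> R) w (B : R) : D w -> measurable_fun D m ->
  (forall c, D c -> 0 <= m c) -> 0 <= B -> (forall c, nbr (c, w) -> m c <= B) ->
  (\int[leb2]_(c in [set c | nbr (c, w)]) (m c)%:E <= (B * (4 * delta w ^+ 2))%:E)%E.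
Proof.
move=> Dw mm m0 B0 mB.
have SD : [set c | nbr (c, w)] `<=` D by move=> c /nbr_delta[]; rewrite discE.
have mS := measurable_nbr_r w.
apply: (@le_trans _ _ (\int[leb2]_(c in [set c | nbr (c, w)]) B%:E)%E).
  apply: ge0_le_integral; [exact: mS| | |exact: measurable_cst|].
  - by move=> c /SD Dc; rewrite lee_fin m0.
  - apply/measurable_EFinP; apply: measurable_funS mm => //; exact: measurable_disc.
  - by move=> c cw; rewrite lee_fin; exact: mB.
rewrite integral_cst// EFinM; apply: lee_wpmul2l; first by rewrite lee_fin.
have dw0 : 0 < delta w by rewrite -discE.
apply: le_trans (leb2_pball (cplx w) dw0); apply: le_measure; rewrite ?inE//.
  exact: measurable_pball.
exact: nbr_pball_r.
Qed.

Lemma measurable_delta_powR a : measurable_fun setT (fun w => delta w `^ a).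
Proof. exact: (measurableT_comp (measurable_powR a) (measurable_delta (R := R))). Qed.

(* The Bergman integral up to constants, as [delta w <= 1 - |w|^2 <= 2 * delta w]. *)
Definition wint a p f : \bar R := (\int[leb2]_(w in D) (cabs (f (cplx w)) `^ p * delta w `^ a)%:E)%E.

Lemma measurable_wint a p f : analytic f ->
  measurable_fun D (fun w => cabs (f (cplx w)) `^ p * delta w `^ a).
Proof.
move=> af; apply: measurable_funM.
  exact: (measurableT_comp (measurable_powR p) (measurable_analytic af)).
exact: measurable_funTS (measurable_delta_powR a).
Qed.

Lemma wint_ge0 a p f : (0 <= wint a p f)%E.
Proof. by apply: integral_ge0 => w _; rewrite lee_fin mulr_ge0 ?powR_ge0. Qed.

Lemma powRD2 x a : 0 < x -> x `^ (a - 2) = x `^ a / x ^+ 2.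
Proof.
move=> x0; rewrite powRB; last by apply/implyP => _; rewrite gt_eqF.
by congr (_ / _); rewrite -powR_mulrn ?ltW.
Qed.

(** On the ball of radius delta c / 2, [subharmonic] bounds (delta c / 2 * |f'(c)|)^q, so the
    additional weight delta^q is exactly what the derivative costs; [avg_le] integrates this
    bound. *)
Lemma wint_cderiv b q : 1 <= q -> exists2 C : R, 0 < C & forall f, analytic f ->
  (wint (b + q) q (cderiv f) <= C%:E * wint b q f)%E.
Proof.
move=> q1; have [K K0 HK] := subharmonic q1.
have q0 : 0 <= q by lra.
(* In [M], the factors 2^q and 4 undo the halving of the radius. In [C], 2^|b| and one factor 4
   compare powers of delta at [c] and at [w], and the other 4 comes from the area of the set of
   centres. *)
pose M := 2 `^ q * (4 * K); have M0 : 0 < M by rewrite !mulr_gt0 ?powR_gt0.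
pose C := M * 4 * 2 `^ `|b| * 4; have C0 : 0 < C by rewrite !mulr_gt0 ?powR_gt0.
exists C => // f af; have mD := @measurable_disc R.
pose m c := M * delta c `^ (b - 2).
pose Phi w := cabs (f (cplx w)) `^ q.
pose v w := C * delta w `^ b.
have mm : measurable_fun D m.
  apply: measurable_funM => //; apply: measurable_funTS; exact: measurable_delta_powR.
have mPhi : measurable_fun D Phi.
  exact: (measurableT_comp (measurable_powR q) (measurable_analytic af)).
have mv : measurable_fun D v.
  apply: measurable_funM => //; apply: measurable_funTS; exact: measurable_delta_powR.
have m0 c : 0 <= m c by rewrite mulr_ge0 ?powR_ge0// ltW.
have := @avg_le _ (fun c => cabs (cderiv f (cplx c)) `^ q * delta c `^ (b + q)) m Phi v
  (measurable_wint _ _ (analytic_cderiv af)) mm mPhi mv.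
have -> : (\int[leb2]_(w in D) (Phi w * v w)%:E = C%:E * wint b q f)%E.
  rewrite /wint -ge0_integralZl_EFin//; last 3 first.
  - by move=> w _; rewrite lee_fin mulr_ge0 ?powR_ge0.
  - by apply/measurable_EFinP; exact: measurable_wint.
  - exact: ltW.
  by apply: eq_integral => w _; rewrite -EFinM /Phi /v mulrCA.
apply.
- by move=> w _; rewrite mulr_ge0 ?powR_ge0.
- by move=> w _; exact: m0.
- by move=> w _; exact: powR_ge0.
- by move=> w _; rewrite mulr_ge0 ?powR_ge0// ltW.
- move=> c Dc; have dc0 : 0 < delta c by rewrite -discE.
  have dc20 : 0 < delta c / 2 by lra.
  have [|_ H] := HK f (cplx c) (delta c / 2) af dc20; first by move: dc0; rewrite /delta; lra.
  have -> : (cabs (cderiv f (cplx c)) `^ q * delta c `^ (b + q)) =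
      2 `^ q * delta c `^ b * (delta c / 2 * cabs (cderiv f (cplx c))) `^ q.
    rewrite powRD; last by apply/implyP => _; rewrite gt_eqF.
    have -> : delta c `^ q = 2 `^ q * (delta c / 2) `^ q.
      by rewrite -powRM ?(ltW dc20)// mulrC divfK.
    rewrite (powRM _ (ltW dc20) (cabs_ge0 _)); ring.
  rewrite EFinM; apply: le_trans (lee_wpmul2l _ H) _.
    by rewrite lee_fin mulr_ge0 ?powR_ge0.
  rewrite muleA -EFinM le_eqVlt; apply/orP; left; apply/eqP; congr (_%:E * _)%E.
  by rewrite /m /M powRD2//; field; rewrite gt_eqF.
- move=> w Dw; have dw0 : 0 < delta w by rewrite -discE.
  pose B := M * (2 `^ `|b| * delta w `^ b) * (4 / delta w ^+ 2).
  have B0 : 0 <= B by rewrite !mulr_ge0 ?powR_ge0 ?invr_ge0 ?sqr_ge0// ltW.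
  apply: (@le_trans _ _ ((B * (4 * delta w ^+ 2))%:E)%E).
    apply: (integral_nbr_le Dw mm (fun c _ => m0 c) B0).
    move=> c cw; have [dc0 /andP[h1 h2]] := nbr_delta cw.
    rewrite /m /B powRD2// mulrA; apply: ler_pM.
    - by rewrite mulr_ge0 ?powR_ge0// ltW.
    - by rewrite invr_ge0 sqr_ge0.
    - rewrite ler_pM2l//; apply: powR_comparable => //; lra.
    - rewrite -ler_pV2; last 2 first.
      + by rewrite inE unitfE gt_eqF ?divr_gt0 ?exprn_gt0//= divr_gt0// exprn_gt0.
      + by rewrite inE unitfE gt_eqF ?invr_gt0 ?exprn_gt0//= invr_gt0 exprn_gt0.
      rewrite invrK invf_div ler_pdivrMr//.
      have -> : delta c ^+ 2 * 4 = (2 * delta c) ^+ 2 by ring.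
      by rewrite ler_sqr ?nnegrE//; lra.
  rewrite lee_fin /B /v /C le_eqVlt; apply/orP; left; apply/eqP; field; lra.
Qed.

Lemma wint_iter_cderiv n b q : 1 <= q -> exists2 C : R, 0 < C & forall f, analytic f ->
  (wint (b + n%:R * q) q (iter n (@cderiv R) f) <= C%:E * wint b q f)%E.
Proof.
move=> q1; elim: n => [|n [C C0 HC]].
  by exists 1 => // f af; rewrite mul0r addr0 mul1e.
have [C' C'0 HC'] := wint_cderiv (b + n%:R * q) q1.
exists (C' * C); first exact: mulr_gt0.
move=> f af; have := HC' _ (analytic_iter_cderiv (n := n) af).
have -> : b + n%:R * q + q = b + n.+1%:R * q by rewrite -addrA -natr1 mulrDl mul1r.
rewrite iterS => /le_trans; apply.
rewrite EFinM -muleA; apply: lee_wpmul2l; first by rewrite lee_fin ltW.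
exact: HC.
Qed.

End weights.

(** * Integration along radii *)

Section dilation.
Variable R : realType.
Implicit Types (a b s t x y : R) (w : plane R).
Local Notation mu := (@lebesgue_measure R).
Local Notation leb2 := (@area R).

(** Lebesgue measure equals [s] times its push-forward under x -> s x, since the two agree on
    half-open intervals. *)
Lemma integral_scale s (F : R -> \bar R) : 0 < s -> measurable_fun setT F ->
  (forall x, 0 <= F x)%E -> (\int[mu]_x F x = s%:E * \int[mu]_x F (s * x)%R)%E.
Proof.
move=> s0 mF F0.
have mphi : measurable_fun [set: measurableTypeR R] (fun x : measurableTypeR R => s * x : measurableTypeR R).
  exact: measurable_funM.
pose nu0 := mscale (NngNum (ltW s0)) (pushforward mu (fun x : measurableTypeR R => s * x : measurableTypeR R)).
pose nu := nu0 mphi.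
have E A : measurable A -> mu A = nu A.
  apply: lebesgue_measure_unique => X [[a b] _ <-].
  change (mu [set` `]a, b]] = s%:E * mu ((fun x : measurableTypeR R => (s * x)%R) @^-1` [set` `]a, b]]))%E.
  rewrite [X in (_ * mu X)%E](_ : _ = [set` `]a / s, b / s]]); last first.
    by apply/seteqP; split => x /=; rewrite !in_itv /= ltr_pdivrMr// ler_pdivlMr// (mulrC x).
  rewrite !lebesgue_measure_itv /= !lte_fin ltr_pM2r ?invr_gt0//.
  case: ifP => // _; last by rewrite mule0.
  by rewrite -!EFinB -EFinM; congr EFin; field; rewrite gt_eqF.
rewrite (eq_measure_integral nu); last by move=> A mA _; exact: E.
rewrite ge0_integral_mscale//; congr (_ * _)%E.
by rewrite ge0_integral_pushforward.
Qed.

Definition smul t w : plane R := (t * w.1, t * w.2).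

Lemma cplx_smul t w : cplx (smul t w) = t%:C%C * cplx w.
Proof. by apply/eqP; rewrite eq_complex /=; apply/andP; split; apply/eqP; ring. Qed.

Lemma area_scale s (F : plane R -> \bar R) : 0 < s -> measurable_fun setT F ->
  (forall w, 0 <= F w)%E ->
  (\int[leb2]_w F w = (s ^+ 2)%:E * \int[leb2]_w F (smul s w))%E.
Proof.
move=> s0 mF F0.
have msmul : measurable_fun setT (smul s).
  by apply: measurable_fun_pair; exact: measurable_funM.
have mG : measurable_fun setT (fun w => F (smul s w)) by exact: measurableT_comp mF msmul.
have G0 w : (0 <= F (smul s w))%E by [].
have -> : (\int[leb2]_w F w = \int[mu]_x \int[mu]_y F (x, y))%E := fubini_tonelli1 F mF F0.
have -> : (\int[leb2]_w F (smul s w) = \int[mu]_x \int[mu]_y F (s * x, s * y)%R)%E :=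
  fubini_tonelli1 (fun w => F (smul s w)) mG G0.
have mI : measurable_fun setT (fun x => \int[mu]_y F (x, y))%E := measurable_fun_fubini_tonelli_F F mF F0.
have mxy x : measurable_fun setT (fun y => F (x, y)) by exact: measurable_fun_pair2.
have mI2 : measurable_fun setT (fun x => \int[mu]_y F (s * x, s * y)%R)%E :=
  measurable_fun_fubini_tonelli_F (fun w => F (smul s w)) mG G0.
rewrite (integral_scale s0 mI); last by move=> x; exact: integral_ge0.
rewrite expr2 EFinM -muleA; congr (_ * _)%E.
rewrite -ge0_integralZl_EFin//; last 2 first.
  by move=> x _; exact: integral_ge0.
  exact: ltW.
by apply: eq_integral => x _; rewrite (integral_scale s0 (mxy _)).
Qed.

End dilation.

(** * Integrals of powers over intervals *)

Section power_integrals.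
Variable R : realType.
Implicit Types (a b c s t x y : R).
Local Notation mu := (@lebesgue_measure R).

Lemma is_derive_affine_powR (k m c x : R) : 0 < k * x + m ->
  is_derive x 1 (fun x => (k * x + m) `^ c) (c * (k * x + m) `^ (c - 1) * k).
Proof.
move=> x0.
have d1 : is_derive x 1 (fun x : R => k * x + m) k.
  by apply: is_derive_eq; rewrite /GRing.scale /=; ring.
have d2 := @is_derive1_comp R (fun y : R => y `^ c) (fun x : R => k * x + m) x _ _ (is_derive1_powR c x0) d1.
by move: d2 => /is_derive_eq; apply; rewrite /GRing.scale /=; ring.
Qed.

Lemma integral_affine_powR (k m c a b : R) : a < b -> c != -1 -> k != 0 ->
  (forall x, a <= x <= b -> 0 < k * x + m) ->
  (\int[mu]_(x in `[a, b]) ((k * x + m) `^ c)%:E =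
   (((k * b + m) `^ (c + 1) - (k * a + m) `^ (c + 1)) / ((c + 1) * k))%:E)%E.
Proof.
move=> ab c1 k0 pos.
have c0 : c + 1 != 0 by rewrite addr_eq0.
have ck : (c + 1) * k != 0 by rewrite mulf_neq0.
pose F x := ((c + 1) * k)^-1 * (k * x + m) `^ (c + 1).
have dF x : a <= x <= b -> is_derive x 1 F ((k * x + m) `^ c).
  move=> xab; have d1 := is_derive_affine_powR (c + 1) (pos x xab).
  have := @is_deriveZ _ _ _ _ ((c + 1) * k)^-1 _ _ _ d1.
  move=> /is_derive_eq; apply.
  by rewrite /GRing.scale /= addrK; field; rewrite k0 c0.
have cont x (G : R -> R) l : is_derive x 1 G l -> {for x, continuous G}.
  by move=> [d1 _]; apply: differentiable_continuous; exact/derivable1_diffP.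
rewrite (@continuous_FTC2 _ _ F)//.
- by rewrite -EFinB /F -mulrBr mulrC.
- apply: continuous_in_subspaceT => x; rewrite inE /= in_itv /= => xab.
  exact: cont (is_derive_affine_powR c (pos x xab)).
- split.
  + by move=> x; rewrite in_itv /= => /andP[ax xb]; have [] := dF x ltac:(lra).
  + by apply: cvg_at_right_filter; apply: (cont _ _ _ (dF a ltac:(lra))).
  + by apply: cvg_at_left_filter; apply: (cont _ _ _ (dF b ltac:(lra))).
- move=> x; rewrite in_itv /= => /andP[ax xb].
  by have [_ <-] := dF x ltac:(lra); rewrite derive1E.
Qed.

(** For negative [c] the integrand is singular at [a], so the integral is reached by monotone
    convergence from the intervals [a + 1 / (n + 1), b]. *)
Lemma integral_powR_sub (c a b : R) : -1 < c -> a < b ->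
  (\int[mu]_(x in `]a, b]) ((x - a) `^ c)%:E <= ((b - a) `^ (c + 1) / (c + 1))%:E)%E.
Proof.
move=> c1 ab; have c0 : 0 < c + 1 by lra.
have mf : measurable_fun setT (fun x : R => ((x - a) `^ c)%:E).
  apply/measurable_EFinP; apply: (measurableT_comp (measurable_powR c)).
  exact: measurable_funB.
have e0 n : 0 < n.+1%:R^-1 :> R by rewrite invr_gt0.
have -> : `]a, b]%classic = \bigcup_n (`[a + n.+1%:R^-1, b]%classic : set R).
  apply/seteqP; split => x /=; rewrite in_itv /=.
    move=> /andP[ax xb]; have xa : 0 < x - a by lra.
    have [N HN] := natSinv_small xa.
    by exists N => //=; rewrite in_itv /= xb andbT -lerBrDl ltW// HN.
  move=> [n _] /=; rewrite in_itv /= => /andP[ax ->]; rewrite andbT.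
  by apply: lt_le_trans ax; rewrite ltrDl.
have mF n : measurable (`[a + n.+1%:R^-1, b]%classic : set R) by exact: measurable_itv.
have hF : {homo (fun n => `[a + n.+1%:R^-1, b]%classic : set R) : n m / (n <= m)%N >-> (n <= m)%O}.
  move=> n m nm; rewrite subsetEset => x /=; rewrite !in_itv /= => /andP[xa ->]; rewrite andbT.
  by apply: le_trans xa; rewrite lerD2l lef_pV2 ?posrE// ler_nat.
have cv := @ge0_nondecreasing_set_cvg_integral _ _ R _ _ mu hF mF
  (fun n => measurable_funTS mf) (fun n x _ => powR_ge0 (x - a) c).
rewrite -(cvg_lim _ cv)//; apply: lime_le; first exact: cvgP cv.
near=> n; have [nb|nb] := ltP (a + n.+1%:R^-1) b; last first.
  move: nb; rewrite le_eqVlt => /predU1P[->|nb].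
    by rewrite set_itv1 integral_set1 lee_fin divr_ge0 ?powR_ge0 ?ltW.
  by rewrite set_itv_ge ?integral_set0 ?lee_fin ?divr_ge0 ?powR_ge0 ?ltW// bnd_simp -ltNge.
have cN1 : c != -1 by rewrite gt_eqF.
have pos x : a + n.+1%:R^-1 <= x <= b -> 0 < 1 * x - a.
  by move=> /andP[xa _]; rewrite mul1r subr_gt0; apply: lt_le_trans xa; rewrite ltrDl.
rewrite (_ : (\int[mu]_(x in `[(a + n.+1%:R^-1)%R, b]) _)%E =
    \int[mu]_(x in `[(a + n.+1%:R^-1)%R, b]) ((1 * x - a) `^ c)%:E)%E; last first.
  by apply: eq_integral => x _; rewrite mul1r.
rewrite (integral_affine_powR nb cN1 (oner_neq0 R) pos) !mul1r mulr1.
rewrite lee_fin ler_pM2r ?invr_gt0// gerBl; exact: powR_ge0.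
Unshelve. all: by end_near. Qed.

(* [1 - t r >= ((1 - t) + (1 - r)) / 2] on [1/2, 1]. *)
Lemma integral_radial_powR (kap r : R) : 1 < kap -> 0 <= r < 1 ->
  (\int[mu]_(t in `[(2^-1)%R, 1%R]) ((1 - t * r) `^ (- kap))%:E
    <= (2 `^ kap / (kap - 1) * (1 - r) `^ (1 - kap))%:E)%E.
Proof.
move=> k1 /andP[r0 r1].
have mf k m c : measurable_fun setT (fun t : R => ((k * t + m) `^ c)%:E).
  apply/measurable_EFinP; apply: (measurableT_comp (measurable_powR c)).
  by apply: measurable_funD => //; exact: measurable_funM.
apply: (@le_trans _ _ (\int[mu]_(t in `[(2^-1)%R, 1%R]) ((2 `^ kap)%:E * ((-1 * t + (2 - r)) `^ (- kap))%:E))%E).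
  apply: ge0_le_integral; [exact: measurable_itv| | | |].
  - by move=> t _; rewrite lee_fin powR_ge0.
  - have := mf (- r) 1 (- kap) => H; apply: measurable_funTS.
    by under eq_fun => t do rewrite [1 - _]addrC -mulrN mulrC.
  - by apply: measurable_funeM; apply: measurable_funTS; exact: mf.
  - move=> t /=; rewrite in_itv /= => /andP[t0 t1]; rewrite -EFinM lee_fin.
    have tr : 0 < 1 - t * r by nra.
    have tr2 : 0 < -1 * t + (2 - r) by lra.
    have := @powR_comparable R (- kap) 2 (-1 * t + (2 - r)) (1 - t * r).
    rewrite normrN gtr0_norm; last by lra.
    by apply => //; nra.
rewrite ge0_integralZl_EFin//; last 2 first.
- by move=> t _; rewrite lee_fin powR_ge0.
- by apply: measurable_funTS; exact: mf.
rewrite (@integral_affine_powR (-1) (2 - r) (- kap)); first last.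
- by move=> t /andP[t0 t1]; lra.
- by rewrite oppr_eq0 oner_eq0.
- by rewrite eqr_opp gt_eqF.
- by lra.
rewrite -EFinM lee_fin -mulrA ler_pM2l ?powR_gt0//.
have -> : -1 * 1 + (2 - r) = 1 - r by lra.
have -> : - kap + 1 = 1 - kap by lra.
set u := _ `^ _; set v := _ `^ _; have v0 : 0 <= v by exact: powR_ge0.
have -> : (u - v) / ((1 - kap) * -1) = (kap - 1)^-1 * (u - v) by field; lra.
by rewrite ler_pM2l ?invr_gt0 ?subr_gt0// gerBl.
Qed.

End power_integrals.

(** * Averages over radii *)

Section radial.
Variable R : realType.
Implicit Types (a b e s t x y p q : R) (f phi : R[i] -> R[i]) (w z : plane R).
Local Notation mu := (@lebesgue_measure R).
Local Notation leb2 := (@area R).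
Local Notation D := (disc (R := R)).
Local Notation J := (`[(2^-1)%R, 1%R]%classic : set (measurableTypeR R)).

Lemma measurable_smul (k : R -> R) : measurable_fun setT k ->
  measurable_fun setT (fun zt : plane R * measurableTypeR R => smul (k zt.2) zt.1).
Proof.
move=> mk; have mk2 : measurable_fun setT (fun zt : plane R * measurableTypeR R => k zt.2).
  exact: measurableT_comp mk (@measurable_snd _ _ _ _).
apply: measurable_fun_pair; apply: measurable_funM => //.
  exact: (measurableT_comp (@measurable_fst _ _ _ _) (@measurable_fst _ _ _ _)).
exact: (measurableT_comp (@measurable_snd _ _ _ _) (@measurable_fst _ _ _ _)).
Qed.

Definition wdisc e w : R := ((fun w => delta w `^ e) \_ D) w.

Lemma measurable_wdisc e : measurable_fun setT (wdisc e).
Proof.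
apply/(measurable_restrictT _ _).1; first exact: measurable_disc.
exact: measurable_funTS (measurable_delta_powR e).
Qed.

Lemma wdisc_ge0 e w : 0 <= wdisc e w.
Proof. by rewrite /wdisc patchE; case: ifP => // _; exact: powR_ge0. Qed.

Lemma wdiscE e w : D w -> wdisc e w = delta w `^ e.
Proof. by move=> Dw; rewrite /wdisc patchE ifT// inE. Qed.

(** The range [1/2, 1] keeps the Jacobian t^(-2) of the substitution w = t z at most 4. *)
Definition radial_int (G : plane R -> R) z : \bar R := (\int[mu]_(t in J) (G (smul t z))%:E)%E.

Lemma radial_kernel_measurable e (G : plane R -> R) : measurable_fun setT G ->
  measurable_fun setT (fun zt : plane R * measurableTypeR R =>
    (wdisc e zt.1 * G (smul zt.2 zt.1) * \1_J zt.2)%:E).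
Proof.
move=> mG; apply/measurable_EFinP; apply: measurable_funM; first apply: measurable_funM.
- exact: measurableT_comp (measurable_wdisc e) (@measurable_fst _ _ _ _).
- exact: measurableT_comp mG (@measurable_smul id (@measurable_id _ _ _)).
- have mJ : measurable_fun setT (\1_J : measurableTypeR R -> R) by exact: measurable_indic.
  exact: measurableT_comp mJ (@measurable_snd _ _ _ _).
Qed.

Lemma radial_intE e (G : plane R -> R) z : measurable_fun setT G -> (forall w, 0 <= G w) ->
  ((wdisc e z)%:E * radial_int G z =
   \int[mu]_t (wdisc e z * G (smul t z) * \1_J t)%:E)%E.
Proof.
move=> mG G0; rewrite /radial_int.
have n1 t : J t -> (0 <= (G (smul t z))%:E)%E by rewrite lee_fin.
have m1 : measurable_fun J (fun t : measurableTypeR R => (G (smul t z))%:E).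
  apply/measurable_EFinP; apply: measurable_funTS.
  have H : measurable_fun setT (fun zt : plane R * measurableTypeR R => G (smul zt.2 zt.1)).
    exact: measurableT_comp mG (@measurable_smul id (@measurable_id _ _ _)).
  exact: (measurable_fun_pair2 z H).
transitivity (\int[mu]_(t in J) ((wdisc e z)%:E * (G (smul t z))%:E))%E.
  by rewrite (ge0_integralZl_EFin mu (measurable_itv _) n1 m1 (wdisc_ge0 e z)).
rewrite integral_mkcond; apply: eq_integral => t _; rewrite patchE indicE.
by case: ifP; rewrite ?mulr1 ?mulr0 ?EFinM.
Qed.

Lemma measurable_radial_int e (G : plane R -> R) : measurable_fun setT G -> (forall w, 0 <= G w) ->
  measurable_fun setT (fun z => (wdisc e z)%:E * radial_int G z)%E.
Proof.
move=> mG G0.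
have F0 (zt : plane R * measurableTypeR R) :
    (0 <= (wdisc e zt.1 * G (smul zt.2 zt.1) * \1_J zt.2)%:E)%E.
  by rewrite lee_fin !mulr_ge0 ?wdisc_ge0// indicE.
have -> : (fun z => (wdisc e z)%:E * radial_int G z)%E = fubini_F mu
    (fun zt : plane R * measurableTypeR R => (wdisc e zt.1 * G (smul zt.2 zt.1) * \1_J zt.2)%:E).
  by apply/funext => z; rewrite (radial_intE _ _ mG G0).
exact: (@measurable_fun_fubini_tonelli_F _ _ (plane R) (measurableTypeR R) R mu _
  (radial_kernel_measurable e mG) F0).
Qed.

(* Fubini, the substitution [w = t z], and integration in [t] of [(1 - |w| / t)^e]. *)
Lemma radial_avg e : -1 < e -> exists2 C : R, 0 < C & forall G : plane R -> R,
  measurable_fun setT G -> (forall w, 0 <= G w) -> (forall w, ~ D w -> G w = 0) ->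
  (\int[leb2]_z ((wdisc e z)%:E * radial_int G z) <=
   C%:E * \int[leb2]_w (G w * delta w `^ (e + 1))%:E)%E.
Proof.
move=> e1; have e10 : 0 < e + 1 by lra.
(* The 4 bounds the Jacobian, 2^|e| replaces (t - |w|) / t by t - |w|, and e + 1 comes from
   integrating (t - |w|)^e. *)
pose C := 4 * (2 `^ `|e| / (e + 1)).
have C0 : 0 < C by rewrite mulr_gt0// divr_gt0// powR_gt0.
exists C => // G mG G0 GD.
pose F1 (zt : plane R * measurableTypeR R) : \bar R :=
  (wdisc e zt.1 * G (smul zt.2 zt.1) * \1_J zt.2)%:E.
have mF1 : measurable_fun setT F1 by exact: radial_kernel_measurable.
have F10 zt : (0 <= F1 zt)%E by rewrite lee_fin !mulr_ge0 ?wdisc_ge0// indicE.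
(* The integrand after the substitution, with 4 in the place of the Jacobian. The inverse of [t] is
   written as a real power, for measurability. *)
pose F2 (zt : plane R * measurableTypeR R) : \bar R :=
  (4 * (wdisc e (smul (zt.2 `^ (-1)) zt.1) * G zt.1) * \1_J zt.2)%:E.
have mF2 : measurable_fun setT F2.
  apply/measurable_EFinP; apply: measurable_funM; first apply: measurable_funM => //.
    apply: measurable_funM.
      exact: measurableT_comp (measurable_wdisc e) (@measurable_smul (fun t => t `^ (-1)) (measurable_powR _)).
    exact: measurableT_comp mG (@measurable_fst _ _ _ _).
  have mJ : measurable_fun setT (\1_J : measurableTypeR R -> R) by exact: measurable_indic.
  exact: measurableT_comp mJ (@measurable_snd _ _ _ _).
have F20 zt : (0 <= F2 zt)%E by rewrite lee_fin !mulr_ge0 ?wdisc_ge0// indicE.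
have -> : (\int[leb2]_z ((wdisc e z)%:E * radial_int G z) =
    \int[leb2]_z \int[mu]_t F1 (z, t))%E.
  by apply: eq_integral => z _; rewrite (radial_intE _ _ mG G0).
rewrite (@fubini_tonelli _ _ (plane R) (measurableTypeR R) R leb2 mu F1 mF1 F10).
apply: (@le_trans _ _ (\int[mu]_t \int[leb2]_w F2 (w, t))%E).
  apply: ge0_le_integral => //.
  - by move=> t _; apply: integral_ge0.
  - exact: (@measurable_fun_fubini_tonelli_G _ _ (plane R) (measurableTypeR R) R leb2 F1 mF1 F10).
  - exact: (@measurable_fun_fubini_tonelli_G _ _ (plane R) (measurableTypeR R) R leb2 F2 mF2 F20).
  - move=> t _; have [tJ|tJ] := boolP (t \in J); last first.
      rewrite integral0_eq; first exact: integral_ge0.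
      by move=> z _; rewrite /F1 /= indicE (negbTE tJ) mulr0.
    have /andP[t12 t1] : (2^-1 <= t) && (t <= 1) by move: tJ; rewrite inE /= in_itv.
    have t0 : 0 < t by apply: lt_le_trans t12; rewrite invr_gt0.
    pose H w : \bar R := (wdisc e (smul (t `^ (-1)) w) * G w)%:E.
    have mH : measurable_fun setT H.
      apply/measurable_EFinP; apply: measurable_funM => //.
      have := @measurable_smul (fun t => t `^ (-1)) (measurable_powR _).
      move=> ms; have := measurable_fun_pair1 t ms; exact: measurableT_comp (measurable_wdisc e).
    have H0 w : (0 <= H w)%E by rewrite lee_fin mulr_ge0 ?wdisc_ge0.
    have -> : (\int[leb2]_w F2 (w, t) = 4%:E * \int[leb2]_w H w)%E.
      rewrite -ge0_integralZl_EFin//; apply: eq_integral => w _.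
      by rewrite /F2 /H /= indicE tJ mulr1 EFinM.
    have -> : (\int[leb2]_z F1 (z, t) = \int[leb2]_z H (smul t z))%E.
      apply: eq_integral => z _; rewrite /F1 /H /= indicE tJ mulr1; congr (wdisc _ _ * _)%:E.
      rewrite powR_inv1 ?(ltW t0)// /smul /= !mulrA mulVf ?gt_eqF// !mul1r.
      by case: z.
    rewrite (area_scale t0 mH H0) muleA -EFinM -[leLHS]mul1e.
    apply: lee_wpmul2r; first exact: integral_ge0.
    rewrite lee_fin.
    have : (2^-1) ^+ 2 <= t ^+ 2 by rewrite ler_sqr ?nnegrE ?invr_ge0// ltW.
    by rewrite exprVn; lra.
rewrite -(@fubini_tonelli _ _ (plane R) (measurableTypeR R) R leb2 mu F2 mF2 F20).
have mGd : measurable_fun setT (fun w => (G w * delta w `^ (e + 1))%:E).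
  by apply/measurable_EFinP; apply: measurable_funM => //; exact: measurable_delta_powR.
rewrite -ge0_integralZl_EFin//; last 2 first.
  by move=> w _; rewrite lee_fin mulr_ge0 ?powR_ge0.
  exact: ltW.
apply: ge0_le_integral => //.
- by move=> w _; apply: integral_ge0.
- exact: (@measurable_fun_fubini_tonelli_F _ _ (plane R) (measurableTypeR R) R mu F2 mF2 F20).
- exact: measurable_funeM.
move=> w _; have [Dw|Dw] := pselect (D w); last first.
  by rewrite GD// mul0r mule0 integral0_eq// => t _; rewrite /F2 /= GD// !(mulr0,mul0r).
have w1 : cabs (cplx w) < 1 by [].
pose k := 4 * 2 `^ `|e| * G w; have k0 : 0 <= k by rewrite !mulr_ge0 ?powR_ge0.
have mA : measurable_fun setT (fun t : measurableTypeR R => ((t - cabs (cplx w)) `^ e)%:E).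
  apply/measurable_EFinP; apply: (measurableT_comp (measurable_powR e)).
  exact: measurable_funB.
(* For positive [t], the point w / t lies in the disc exactly when t > |w|. *)
apply: (@le_trans _ _ (\int[mu]_(t in `]cabs (cplx w), 1%R]) (k%:E * ((t - cabs (cplx w)) `^ e)%:E))%E).
  rewrite [leRHS]integral_mkcond; apply: ge0_le_integral => //.
  - exact: (measurable_fun_pair2 w mF2).
  - apply/(measurable_restrictT _ _).1 => //; apply: measurable_funeM; exact: measurable_funTS.
  - move=> t _; rewrite /F2 /= indicE.
    have nn : (0 <= ((fun t => k%:E * ((t - cabs (cplx w)) `^ e)%:E) \_ `]cabs (cplx w), 1%R]) t)%E.
      by rewrite patchE; case: ifP => // _; rewrite -EFinM lee_fin mulr_ge0 ?powR_ge0.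
    have [tJ|tJ] := boolP (t \in J); last by rewrite mulr0.
    have /andP[t12 t1] : (2^-1 <= t) && (t <= 1) by move: tJ; rewrite inE /= in_itv.
    have t0 : 0 < t by apply: lt_le_trans t12; rewrite invr_gt0.
    rewrite mulr1 powR_inv1 ?(ltW t0)//.
    have cE : cabs (cplx (smul t^-1 w)) = cabs (cplx w) / t.
      by rewrite cplx_smul cabsM cabs_real gtr0_norm ?invr_gt0// mulrC.
    have [Dt|Dt] := pselect (D (smul t^-1 w)); last first.
      by rewrite /wdisc patchE ifF ?mul0r ?mulr0//; apply/negbTE; rewrite notin_setE.
    have wt : cabs (cplx w) < t by move: Dt; rewrite /disc /udisc /= cE ltr_pdivrMr// mul1r.
    rewrite wdiscE// patchE ifT; last by rewrite inE /= in_itv /= wt.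
    rewrite -EFinM lee_fin /k.
    have -> : 4 * 2 `^ `|e| * G w * (t - cabs (cplx w)) `^ e =
      4 * (2 `^ `|e| * (t - cabs (cplx w)) `^ e * G w) by ring.
    rewrite ler_pM2l// ler_wpM2r//.
    have -> : delta (smul t^-1 w) = (t - cabs (cplx w)) / t.
      by rewrite /delta cE mulrBl divff ?gt_eqF.
    have x0 : 0 < t - cabs (cplx w) by rewrite subr_gt0.
    apply: powR_comparable => //.
    + by rewrite ler1n.
    + exact: divr_gt0.
    + by rewrite mulrA ler_pdivlMr// mulrC ler_wpM2r ?(ltW x0)//; lra.
    + rewrite ler_pdivrMr// -mulrA mulrC -mulrA ler_pMr//; lra.
rewrite ge0_integralZl_EFin//; last 2 first.
- by move=> t _; rewrite lee_fin powR_ge0.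
- exact: measurable_funTS.
apply: (@le_trans _ _ (k%:E * ((1 - cabs (cplx w)) `^ (e + 1) / (e + 1))%:E)%E).
  by apply: lee_wpmul2l; [rewrite lee_fin|exact: integral_powR_sub].
rewrite -!EFinM lee_fin /k /C /delta le_eqVlt; apply/orP; left; apply/eqP; field; lra.
Qed.

End radial.

(** * Norms of derivatives and primitives *)

Section littlewood_paley.
Variable R : realType.
Implicit Types (a b e s t x y p q : R) (f phi : R[i] -> R[i]) (w z : plane R).
Local Notation mu := (@lebesgue_measure R).
Local Notation leb2 := (@area R).
Local Notation D := (disc (R := R)).
Local Notation J := (`[(2^-1)%R, 1%R]%classic : set (measurableTypeR R)).

Lemma powR_add_le q x y : 0 <= q -> 0 <= x -> 0 <= y ->
  (x + y) `^ q <= 2 `^ q * (x `^ q + y `^ q).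
Proof.
move=> q0 x0 y0.
have [xy|/ltW yx] := leP x y.
  apply: (@le_trans _ _ ((2 * y) `^ q)).
    by apply: ge0_ler_powR; rewrite ?nnegrE ?addr_ge0 ?mulr_ge0//; lra.
  by rewrite powRM// ler_wpM2l ?powR_ge0// lerDr powR_ge0.
apply: (@le_trans _ _ ((2 * x) `^ q)).
  by apply: ge0_ler_powR; rewrite ?nnegrE ?addr_ge0 ?mulr_ge0//; lra.
by rewrite powRM// ler_wpM2l ?powR_ge0// lerDl powR_ge0.
Qed.

Lemma powR_le_root q x y : 0 < q -> 0 <= x -> x `^ q <= y -> x <= y `^ q^-1.
Proof.
move=> q0 x0 xy; have qn0 : q != 0 by rewrite gt_eqF.
rewrite -[leLHS](powRr1 x0) -(mulfV qn0) powRrM.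
apply: ge0_ler_powR; rewrite ?invr_ge0 ?(ltW q0) ?nnegrE ?powR_ge0//.
exact: le_trans (powR_ge0 _ _) xy.
Qed.

Lemma wint_subset a p f (S : set (plane R)) (k : R) : analytic f -> measurable S ->
  S `<=` D -> 0 <= k -> (forall w, S w -> 1 <= k * delta w `^ a) ->
  (\int[leb2]_(w in S) (cabs (f (cplx w)) `^ p)%:E <= k%:E * wint a p f)%E.
Proof.
move=> af mS SD k0 Hk; have mD := @measurable_disc R.
have mf := measurable_wint a p af.
have mS1 : measurable_fun S (fun w => (cabs (f (cplx w)) `^ p)%:E).
  apply/measurable_EFinP; apply: (measurableT_comp (measurable_powR p)).
  exact: measurable_funS mD SD (measurable_analytic af).
have mS2 : measurable_fun D (fun w => (cabs (f (cplx w)) `^ p * delta w `^ a)%:E).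
  exact/measurable_EFinP.
have n2 w : D w -> (0 <= (cabs (f (cplx w)) `^ p * delta w `^ a)%:E)%E.
  by move=> _; rewrite lee_fin mulr_ge0 ?powR_ge0.
have n3 w : D w -> (0 <= k%:E * (cabs (f (cplx w)) `^ p * delta w `^ a)%:E)%E.
  by move=> Dw; rewrite mule_ge0 ?n2// lee_fin.
rewrite /wint -(ge0_integralZl_EFin leb2 mD n2 mS2 k0).
apply: (@le_trans _ _ (\int[leb2]_(w in S) (k%:E * (cabs (f (cplx w)) `^ p * delta w `^ a)%:E))%E).
  apply: ge0_le_integral; [exact: mS| |exact: mS1| |].
  - by move=> w _; rewrite lee_fin powR_ge0.
  - by apply: measurable_funS mD SD _; exact: measurable_funeM.
  - move=> w Sw; rewrite -EFinM lee_fin mulrCA ler_peMr ?powR_ge0//; exact: Hk.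
by apply: ge0_subset_integral => //; exact: measurable_funeM.
Qed.

(** The mean value inequality on the ball of radius delta c / 2. The area contributes the exponent
    -2, and the weight, comparable to a constant there, contributes -a. *)
Lemma growth a p : 1 <= p -> exists2 K : R, 0 < K & forall f c, analytic f -> D c ->
  ((cabs (f (cplx c)) `^ p)%:E <= (K * delta c `^ (- (2 + a)))%:E * wint a p f)%E.
Proof.
move=> p1; have [K K0 HK] := subharmonic p1.
exists (K * 4 * 2 `^ `|- a|); first by rewrite !mulr_gt0// powR_gt0.
move=> f c af Dc; have dc0 : 0 < delta c by rewrite -discE.
have dc20 : 0 < delta c / 2 by lra.
have cd1 : cabs (cplx c) + delta c / 2 <= 1 by move: dc0; rewrite /delta; lra.
have [H _] := HK f (cplx c) (delta c / 2) af dc20 cd1.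
apply: le_trans H _.
pose k := 2 `^ `|- a| * delta c `^ (- a).
have k0 : 0 <= k by rewrite mulr_ge0 ?powR_ge0.
have H : (\int[leb2]_(w in pball (cplx c) (delta c / 2)) (cabs (f (cplx w)) `^ p)%:E <= k%:E * wint a p f)%E.
  apply: (@wint_subset a p f _ k af (measurable_pball _ _) (pball_disc cd1) k0).
  move=> w; rewrite -nbr_pball => cw; have [_ /andP[h1 h2]] := nbr_delta cw.
  have dw0 : 0 < delta w by lra.
  rewrite -ler_pdivrMr ?powR_gt0// mul1r -powRN.
  apply: powR_comparable => //; lra.
apply: le_trans (lee_wpmul2l _ H) _; first by rewrite lee_fin divr_ge0 ?sqr_ge0// ltW.
rewrite muleA -EFinM le_eqVlt; apply/orP; left; apply/eqP; congr (_%:E * _)%E.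
have -> : - (2 + a) = - a - 2 by ring.
by rewrite /k powRD2//; field; rewrite gt_eqF.
Qed.

(** [radial_avg] for the indicator of the disc: the radial integral is 1/2 on the disc, and on the
    right delta^(e+1) <= 1 leaves the area. Hence 8, twice the area bound 4. *)
Lemma weight_integrable e : -1 < e -> exists2 C : R, 0 < C &
  (\int[leb2]_(w in D) (delta w `^ e)%:E <= C%:E)%E.
Proof.
move=> e1; have [C C0 HC] := radial_avg e1.
exists (C * 8); first by rewrite mulr_gt0.
have mD := @measurable_disc R.
have mG : measurable_fun setT (\1_D : plane R -> R) by exact: measurable_indic.
have G0 w : 0 <= \1_D w :> R by rewrite indicE.
have GD w : ~ D w -> \1_D w = 0 :> R by move=> H; rewrite indicE memNset.
have := HC _ mG G0 GD.
have half z : ((wdisc e z)%:E * radial_int \1_D z = (2^-1)%:E * (wdisc e z)%:E)%E.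
  have [Dz|Dz] := pselect (D z); last first.
    by rewrite /wdisc patchE memNset// mul0e mule0.
  rewrite muleC; congr (_ * _)%E; rewrite /radial_int.
  transitivity (\int[mu]_(t in J) 1%:E)%E.
    apply: eq_integral => t; rewrite inE /= in_itv /= => /andP[t0 t1].
    rewrite indicE mem_set// /disc /udisc /= cplx_smul cabsM cabs_real ger0_norm; last by lra.
    by apply: le_lt_trans (_ : cabs (cplx z) < 1) => //; rewrite ler_piMl ?cabs_ge0.
  rewrite integral_cst//= lebesgue_measure_itv /= lte_fin ifT; last by lra.
  by rewrite -EFinB -EFinM; congr EFin; lra.
under eq_integral do rewrite half.
have mW := measurable_wdisc e.
have n1 w : [set: plane R] w -> (0 <= (wdisc e w)%:E)%E by rewrite lee_fin wdisc_ge0.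
have m1 : measurable_fun [set: plane R] (fun w => (wdisc e w)%:E) by exact/measurable_EFinP.
have h0 : 0 <= 2^-1 :> R by rewrite invr_ge0.
rewrite (ge0_integralZl_EFin leb2 measurableT n1 m1 h0).
move=> H.
have E : (\int[leb2]_(w in D) (delta w `^ e)%:E = \int[leb2]_w (wdisc e w)%:E)%E.
  by rewrite integral_disc_patch.
rewrite E -(@lee_pmul2l _ (2^-1)%:E) ?lte_fin ?invr_gt0//.
apply: le_trans H _; rewrite -EFinM.
have -> : 2^-1 * (C * 8) = C * 4 by field.
rewrite EFinM; apply: lee_wpmul2l; first by rewrite lee_fin ltW.
apply: (@le_trans _ _ (\int[leb2]_(w in D) 1%:E)%E); last first.
  by rewrite integral_cst// mul1e; exact: area_disc.
rewrite [leRHS]integral_mkcond; apply: ge0_le_integral; [exact: measurableT| | | |].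
- by move=> w _; rewrite lee_fin mulr_ge0 ?powR_ge0.
- apply/measurable_EFinP; apply: measurable_funM => //; exact: measurable_delta_powR.
- by apply/(measurable_restrictT _ _).1.
- move=> w _; rewrite patchE indicE; case: ifPn => [|_]; last by rewrite mul0r.
  rewrite inE => Dw; rewrite mul1r lee_fin.
  have dw0 : 0 < delta w by rewrite -discE.
  have dw1 : delta w <= 1 by rewrite /delta gerBl cabs_ge0.
  rewrite -[leRHS](powRr0 (delta w)); apply: ger_powR; [by rewrite dw0|lra].
Qed.

End littlewood_paley.

(** * Weighted area integrals of primitives *)

Section primitive_bound.
Variable R : realType.
Implicit Types (a b e s t x y p q eta : R) (f phi : R[i] -> R[i]) (w z : plane R).
Local Notation mu := (@lebesgue_measure R).
Local Notation leb2 := (@area R).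
Local Notation D := (disc (R := R)).
Local Notation J := (`[(2^-1)%R, 1%R]%classic : set (measurableTypeR R)).

Lemma radial_disc t z : D z -> 0 <= t <= 1 -> D (smul t z).
Proof. by move=> Dz t01; rewrite /disc /= cplx_smul; exact: udisc_scale. Qed.

(* Hoelder's inequality on a radius, with weights [delta^(-kap)]. *)
Lemma radial_hoelder q eta : 1 <= q -> 0 < eta -> exists2 C : R, 0 < C &
  forall phi z, analytic phi -> D z ->
  (((\int[mu]_(t in J) cabs (phi (cplx (smul t z)))) `^ q)%:E <=
   (C * delta z `^ (- (eta * (q - 1))))%:E *
   radial_int (fun w => (cabs (phi (cplx w)) `^ q * delta w `^ ((1 + eta) * (q - 1)))%R) z)%E.
Proof.
move=> q1 eta0; pose kap := 1 + eta; have kap1 : 1 < kap by rewrite /kap; lra.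
have q0 : 0 <= q by lra.
have qn0 : q != 0 by rewrite gt_eqF; lra.
pose A := 2 `^ kap / (kap - 1).
have A0 : 0 < A by rewrite divr_gt0 ?powR_gt0// subr_gt0.
have A10 : 0 < A + 1 by lra.
exists ((A + 1) `^ q); first by rewrite powR_gt0.
move=> phi z ap Dz.
have dz0 : 0 < delta z by rewrite -discE.
set x := \int[mu]_(t in J) _.
have tJ t : J t -> 0 <= t <= 1 by rewrite /= in_itv /= => /andP[t0 t1]; rewrite t1 andbT; lra.
have cphi : ccont 0 1 (fun t => phi (t%:C%C * cplx z)).
  by apply: ccont_radial => // w w1; exact: analytic_ccts.
have h12 : 0 <= 2^-1 :> R by rewrite invr_ge0.
have [_ _ ip] := ccont_integrable (ccontS h12 (lexx 1) cphi).
have ip' : mu.-integrable J (EFin \o (fun t => cabs (phi (cplx (smul t z))))).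
  by move: ip; congr (_.-integrable _ _); apply/funext => t /=; rewrite cplx_smul.
have x0 : 0 <= x by apply: Rintegral_ge0 => t _; exact: cabs_ge0.
have xE : (x%:E = \int[mu]_(t in J) (cabs (phi (cplx (smul t z))))%:E)%E.
  by rewrite /x /Rintegral fineK//; exact: integrable_fin_num ip'.
have C0 : 0 < (A + 1) `^ q * delta z `^ (- (eta * (q - 1))) by rewrite mulr_gt0 ?powR_gt0.
apply: lee_of_pos_bounds => //.
  by apply: integral_ge0 => t _; rewrite lee_fin mulr_ge0 ?powR_ge0.
move=> P P0 HP.
(* Chosen to balance the two integrated terms of [young_powR]: both become multiples of lam * (delta
   z)^(-eta). *)
pose lam := (P * delta z `^ eta) `^ q^-1.
have Pd0 : 0 < P * delta z `^ eta by rewrite mulr_gt0// powR_gt0.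
have l0 : 0 < lam by rewrite powR_gt0.
have lq : lam `^ q = P * delta z `^ eta by rewrite -powRrM mulVf// powRr1// ltW.
have dz1 : delta z `^ (1 - kap) = (delta z `^ eta)^-1.
  by rewrite -powRN; congr (_ `^ _); rewrite /kap; ring.
have de0 : 0 < delta z `^ eta by rewrite powR_gt0.
suff xb : x <= (A + 1) * (lam * (delta z `^ eta)^-1).
  apply: le_trans (_ : ((A + 1) * (lam * (delta z `^ eta)^-1)) `^ q <= _).
    by apply: ge0_ler_powR; rewrite ?nnegrE//; exact: le_trans x0 xb.
  rewrite !powRM ?invr_ge0 ?powR_ge0 ?(ltW A10) ?(ltW l0)//; last first.
    by rewrite mulr_ge0 ?invr_ge0 ?powR_ge0 ?(ltW l0).
  rewrite lq -powRN -powRrM -mulrA (mulrC _ P) ler_pM2l ?powR_gt0// -!mulrA ler_pM2l//.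
  rewrite -powRD; last by apply/implyP => _; rewrite gt_eqF.
  by rewrite le_eqVlt; apply/orP; left; apply/eqP; congr (_ `^ _); ring.
pose k := lam / lam `^ q.
have k0 : 0 <= k by rewrite divr_ge0 ?powR_ge0// ltW.
have kP : k * P = lam * (delta z `^ eta)^-1.
  by rewrite /k lq; field; rewrite !gt_eqF.
pose u t := (1 - t * cabs (cplx z)) `^ (- kap).
pose G w := cabs (phi (cplx w)) `^ q * delta w `^ ((1 + eta) * (q - 1)).
have mu1 : measurable_fun J (fun t : measurableTypeR R => (u t)%:E).
  apply/measurable_EFinP; apply: measurable_funTS; apply: (measurableT_comp (measurable_powR _)).
  by apply: measurable_funB => //; exact: measurable_funM.
have mG : measurable_fun J (fun t : measurableTypeR R => (G (smul t z))%:E).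
  apply/measurable_EFinP; apply: measurable_funM.
    apply: (measurableT_comp (measurable_powR q)).
    by have /integrableP[/measurable_EFinP] := ip'.
  have : measurable_fun setT (fun zt : plane R * measurableTypeR R => delta (smul zt.2 zt.1) `^ ((1 + eta) * (q - 1))).
    exact: measurableT_comp (measurable_delta_powR _) (@measurable_smul R id (@measurable_id _ _ _)).
  by move=> H; apply: measurable_funTS; exact: (measurable_fun_pair2 z H).
have n1 t : J t -> (0 <= (u t)%:E)%E by rewrite lee_fin powR_ge0.
have n2 t : J t -> (0 <= (G (smul t z))%:E)%E by rewrite lee_fin mulr_ge0 ?powR_ge0.
have n1' t : J t -> (0 <= lam%:E * (u t)%:E)%E by move=> Jt; rewrite mule_ge0 ?n1 ?lee_fin ?ltW.
have n2' t : J t -> (0 <= k%:E * (G (smul t z))%:E)%E by move=> Jt; rewrite mule_ge0 ?n2 ?lee_fin.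
have m1' : measurable_fun J (fun t : measurableTypeR R => lam%:E * (u t)%:E)%E by exact: measurable_funeM.
have m2' : measurable_fun J (fun t : measurableTypeR R => k%:E * (G (smul t z))%:E)%E by exact: measurable_funeM.
rewrite -lee_fin xE.
apply: (@le_trans _ _ (\int[mu]_(t in J) (lam%:E * (u t)%:E + k%:E * (G (smul t z))%:E))%E).
  apply: ge0_le_integral; [exact: measurable_itv| | |exact: emeasurable_funD|].
  - by move=> t _; rewrite lee_fin cabs_ge0.
  - by have /integrableP[] := ip'.
  - move=> t Jt; rewrite -!EFinM -EFinD lee_fin.
    have Dt := radial_disc Dz (tJ t Jt).
    have dE : delta (smul t z) = 1 - t * cabs (cplx z).
      by rewrite /delta cplx_smul cabsM cabs_real ger0_norm//; have /andP[] := tJ t Jt.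
    have d0 : 0 < delta (smul t z) by rewrite -discE.
    rewrite /u -dE.
    have dk0 : 0 < delta (smul t z) `^ (- kap) by rewrite powR_gt0.
    (* The threshold lam * delta^(-kap) varies along the radius. Its integral is that of
       [integral_radial_powR], and its power 1 - q produces the weight delta^((1 + eta) (q - 1)). *)
    have := @young_powR R (cabs (phi (cplx (smul t z)))) (lam * delta (smul t z) `^ (- kap)) q
      (cabs_ge0 _) (mulr_gt0 l0 dk0) q1.
    move=> /le_trans; apply; rewrite lerD2l.
    rewrite powRM ?(ltW l0) ?(ltW dk0)// /G /k -powRrM.
    have -> : (1 + eta) * (q - 1) = - kap - - kap * q by rewrite /kap; ring.
    rewrite powRB; last by apply/implyP => _; rewrite gt_eqF.
    rewrite le_eqVlt; apply/orP; left; apply/eqP; field.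
    by rewrite !gt_eqF ?powR_gt0.
rewrite (ge0_integralD mu (measurable_itv _) n1' m1' n2' m2').
rewrite (ge0_integralZl_EFin mu (measurable_itv _) n1 mu1 (ltW l0)).
rewrite (ge0_integralZl_EFin mu (measurable_itv _) n2 mG k0).
rewrite mulrDl mul1r EFinD; apply: leeD.
  rewrite mulrCA EFinM; apply: lee_wpmul2l; first by rewrite lee_fin ltW.
  by rewrite -dz1; apply: integral_radial_powR => //; rewrite cabs_ge0.
by rewrite -kP (EFinM k P); apply: lee_wpmul2l; rewrite ?lee_fin.
Qed.

(** The segment is cut at its midpoint. The inner half is bounded through [growth], the outer half
    through [radial_hoelder] followed by [radial_avg]. The exponents add up: (e + 1) + (1 + eta) (q
    - 1) = b + q. *)
Lemma wint_seg_int b q : 1 <= q -> -1 < b -> exists2 C : R, 0 < C &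
  forall phi, analytic phi -> (wint b q (seg_int phi) <= C%:E * wint (b + q) q phi)%E.
Proof.
move=> q1 b1; have q0 : 0 < q by lra.
(* Small enough for the exponent [e] below to stay above -1. *)
pose eta := (b + 1) / (2 * q).
have eta0 : 0 < eta by rewrite divr_gt0 ?mulr_gt0//; lra.
have eq : eta * (q - 1) <= (b + 1) / 2.
  rewrite /eta mulrAC ler_pdivrMr ?mulr_gt0//.
  have -> : (b + 1) / 2 * (2 * q) = (b + 1) * q by field.
  by rewrite ler_pM2l; lra.
pose e := b - eta * (q - 1).
have e1 : -1 < e by rewrite /e; lra.
have [C1 C10 HC1] := radial_hoelder q1 eta0.
have [C2 C20 HC2] := radial_avg e1.
have [C3 C30 HC3] := weight_integrable b1.
have [K K0 HK] := growth (b + q) q1.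
pose K1 := K * 2 `^ `|- (2 + (b + q))|.
have K10 : 0 < K1 by rewrite mulr_gt0// powR_gt0.
(* A common 2^q splits (S + 2 x)^q, and the 2 in 2 x gives a second one, hence 4^q. *)
pose C := 2 `^ q * K1 * C3 + 4 `^ q * C1 * C2.
have C0 : 0 < C by rewrite addr_gt0// !mulr_gt0// powR_gt0.
exists C => // phi ap.
have mD := @measurable_disc R.
have : (0 <= wint (b + q) q phi)%E by exact: wint_ge0.
case E : (wint (b + q) q phi) => [N| |//] N0; last by rewrite gt0_muley ?lte_fin ?leey.
rewrite lee_fin in N0.
(* A bound for |phi| on |v| <= 1/2, where delta lies in [1/2, 1], so that the singular factor of
   [growth] is bounded. *)
pose S := (K1 * N) `^ q^-1.
have S0 : 0 <= S by exact: powR_ge0.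
have Sq : S `^ q = K1 * N by rewrite -powRrM mulVf ?gt_eqF// powRr1// mulr_ge0// ltW.
have HS (v : R[i]) : cabs v <= 2^-1 -> cabs (phi v) <= S.
  move=> v2; pose c : plane R := (complex.Re v, complex.Im v).
  have cv : cplx c = v by rewrite /c /cplx /=; case: (v).
  have Dc : D c by rewrite /disc /udisc /= cv; lra.
  have := HK phi c ap Dc; rewrite E -EFinM lee_fin cv => H.
  have dc : 2^-1 <= delta c <= 1 by rewrite /delta cv; have := cabs_ge0 v; lra.
  have dp : delta c `^ (- (2 + (b + q))) <= 2 `^ `|- (2 + (b + q))| by exact: powR_le_half.
  have H2 : cabs (phi v) `^ q <= K1 * N.
    apply: le_trans H _; rewrite /K1 ler_wpM2r// ler_pM2l//.
  by apply: powR_le_root => //; exact: cabs_ge0.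
pose G := (fun w => cabs (phi (cplx w)) `^ q * delta w `^ ((1 + eta) * (q - 1))) \_ D.
have mG : measurable_fun setT G.
  apply/(measurable_restrictT _ _).1 => //; exact: measurable_wint.
have G0 w : 0 <= G w by rewrite /G patchE; case: ifP => // _; rewrite mulr_ge0 ?powR_ge0.
have GD w : ~ D w -> G w = 0 by move=> H; rewrite /G patchE memNset.
have aS := analytic_seg_int ap.
pose F1 w : \bar R := ((2 `^ q * K1 * N)%:E * (wdisc b w)%:E)%E.
pose F2 w : \bar R := ((4 `^ q * C1)%:E * ((wdisc e w)%:E * radial_int G w))%E.
have mF1 : measurable_fun setT F1 by apply: measurable_funeM; apply/measurable_EFinP; exact: measurable_wdisc.
have mF2 : measurable_fun setT F2 by apply: measurable_funeM; exact: measurable_radial_int.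
have c10 : 0 <= 2 `^ q * K1 * N by rewrite !mulr_ge0 ?powR_ge0// ltW.
have c20 : 0 <= 4 `^ q * C1 by rewrite !mulr_ge0 ?powR_ge0// ltW.
have r0 w : (0 <= radial_int G w)%E by apply: integral_ge0 => t _; rewrite lee_fin.
have nF1' w : (0 <= (wdisc b w)%:E)%E by rewrite lee_fin wdisc_ge0.
have nF2' w : (0 <= (wdisc e w)%:E * radial_int G w)%E by rewrite mule_ge0 ?lee_fin ?wdisc_ge0.
have nF1 w : (0 <= F1 w)%E by apply: mule_ge0 => //; rewrite lee_fin.
have nF2 w : (0 <= F2 w)%E by apply: mule_ge0 => //; rewrite lee_fin.
rewrite /wint integral_disc_patch.
apply: (@le_trans _ _ (\int[leb2]_w (F1 w + F2 w))%E).
  apply: ge0_le_integral; [exact: measurableT| | |exact: emeasurable_funD|].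
  - by move=> w _; rewrite lee_fin patchE; case: ifP => // _; rewrite mulr_ge0 ?powR_ge0.
  - by apply/measurable_EFinP; apply/(measurable_restrictT _ _).1 => //; exact: measurable_wint.
  - move=> z _; rewrite patchE; case: ifPn => [|_]; last exact: adde_ge0.
    rewrite inE => Dz; have dz0 : 0 < delta z by rewrite -discE.
    have c1 : ccont 0 1 (fun t => phi (t%:C%C * cplx z)).
      by apply: ccont_radial => // w w1; exact: analytic_ccts.
    pose x := \int[mu]_(t in J) cabs (phi (cplx (smul t z))).
    have x0 : 0 <= x by apply: Rintegral_ge0 => t _; exact: cabs_ge0.
    have h0 : 0 <= 2^-1 :> R by rewrite invr_ge0.
    have h1 : 2^-1 <= 1 :> R by lra.
    have seg : cabs (seg_int phi (cplx z)) <= S + 2 * x.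
      rewrite seg_intE cabsM; apply: (@le_trans _ _ (cabs (cint 0 1 (fun t => phi (t%:C%C * cplx z))))).
        by rewrite ler_piMl ?cabs_ge0//; exact: ltW Dz.
      rewrite (cint_split h0 h1 c1); apply: le_trans (cabsD _ _) _; apply: lerD.
        have := @cabs_cint_bound _ 0 2^-1 _ S h0 (ccontS (lexx 0) h1 c1).
        have -> : 2 * S * (2^-1 - 0) = S by field.
        apply => t /andP[t0 t1]; apply: HS; rewrite cabsM cabs_real ger0_norm//.
        by rewrite -[leRHS]mulr1; apply: ler_pM => //; [exact: cabs_ge0|exact: ltW Dz].
      rewrite -lee_fin; apply: le_trans (cabs_cint_le (ccontS h0 (lexx 1) c1)) _.
      rewrite EFinM; apply: lee_wpmul2l; first by rewrite lee_fin.
      have [_ _ ip] := ccont_integrable (ccontS h0 (lexx 1) c1).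
      rewrite /x /Rintegral fineK.
        rewrite le_eqVlt; apply/orP; left; apply/eqP; apply: eq_integral => t _.
        by rewrite cplx_smul.
      under eq_integral do rewrite cplx_smul.
      exact: integrable_fin_num ip.
    have segq : cabs (seg_int phi (cplx z)) `^ q <= 2 `^ q * (K1 * N) + 4 `^ q * x `^ q.
      apply: (@le_trans _ _ ((S + 2 * x) `^ q)).
        by apply: ge0_ler_powR; rewrite ?nnegrE ?cabs_ge0 ?(ltW q0)// addr_ge0// mulr_ge0.
      apply: le_trans (powR_add_le (ltW q0) S0 (mulr_ge0 (ler0n _ 2) x0)) _.
      rewrite Sq mulrDr lerD2l powRM// mulrA -powRM//.
      by have -> : 2 * 2 = 4 :> R by ring.
    have rE : radial_int (fun w => cabs (phi (cplx w)) `^ q * delta w `^ ((1 + eta) * (q - 1))) z = radial_int G z.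
      apply: eq_integral => t; rewrite inE /= in_itv /= => /andP[t0 t1].
      rewrite /G patchE ifT// inE; apply: radial_disc => //; lra.
    have := HC1 phi z ap Dz; rewrite -/x rE => Hx.
    apply: (@le_trans _ _ ((2 `^ q * K1 * N * wdisc b z)%:E +
       (4 `^ q * x `^ q * wdisc b z)%:E)%E).
      rewrite -EFinD lee_fin wdiscE// -mulrDl ler_wpM2r ?powR_ge0//.
      by rewrite -[2 `^ q * K1 * N]mulrA.
    apply: leeD; first by rewrite /F1 -EFinM.
    rewrite /F2 !wdiscE// mulrAC EFinM.
    apply: le_trans (lee_wpmul2l _ Hx) _; first by rewrite lee_fin mulr_ge0 ?powR_ge0.
    rewrite !muleA -!EFinM le_eqVlt; apply/orP; left; apply/eqP; congr (_%:E * _)%E.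
    rewrite /e powRD; last by apply/implyP => _; rewrite gt_eqF.
    ring.
rewrite (ge0_integralD leb2 measurableT (fun w _ => nF1 w) mF1 (fun w _ => nF2 w) mF2).
have mW : measurable_fun [set: plane R] (fun w => (wdisc b w)%:E) by apply/measurable_EFinP; exact: measurable_wdisc.
rewrite (ge0_integralZl_EFin leb2 measurableT (fun w _ => nF1' w) mW c10).
rewrite (ge0_integralZl_EFin leb2 measurableT (fun w _ => nF2' w) (measurable_radial_int e mG G0) c20).
have -> : (C%:E * N%:E = (2 `^ q * K1 * N)%:E * C3%:E + (4 `^ q * C1)%:E * (C2 * N)%:E)%E.
  by rewrite -!EFinM -EFinD; congr EFin; rewrite /C; ring.
apply: leeD.
  apply: lee_wpmul2l; first by rewrite lee_fin.
  by rewrite /wdisc -integral_disc_patch.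
apply: lee_wpmul2l; first by rewrite lee_fin.
apply: le_trans (HC2 G mG G0 GD) _.
rewrite EFinM -E; apply: lee_wpmul2l; first by rewrite lee_fin ltW.
rewrite /wint integral_disc_patch le_eqVlt; apply/orP; left; apply/eqP.
apply: eq_integral => w _; rewrite /G !patchE; case: ifPn => [|_]; last by rewrite mul0r.
rewrite inE => Dw; have dw0 : 0 < delta w by rewrite -discE.
rewrite -mulrA -powRD; last by apply/implyP => _; rewrite gt_eqF.
by congr ((_ * _ `^ _)%:E); rewrite /e; ring.
Qed.

Lemma wint_iter_seg_int n b q : 1 <= q -> -1 < b -> exists2 C : R, 0 < C &
  forall phi, analytic phi ->
  (wint b q (iter n (@seg_int R) phi) <= C%:E * wint (b + n%:R * q) q phi)%E.
Proof.
move=> q1; elim: n b => [|n IH] b b1.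
  by exists 1 => // phi ap; rewrite mul0r addr0 mul1e.
have [C C0 HC] := wint_seg_int q1 b1.
have [C' C'0 HC'] := IH (b + q) ltac:(lra).
exists (C * C'); first exact: mulr_gt0.
move=> phi ap; have := HC _ (analytic_iter_seg_int (n := n) ap); rewrite iterS.
move=> /le_trans; apply; rewrite EFinM -muleA; apply: lee_wpmul2l; first by rewrite lee_fin ltW.
have := HC' phi ap.
by have -> : b + q + n%:R * q = b + n.+1%:R * q by rewrite -natr1; ring.
Qed.

End primitive_bound.

(** * Test functions *)

Section test_functions.
Variable R : realType.
Implicit Types (a b e h t x y p q : R) (c u z : R[i]) (w : plane R).
Local Notation mu := (@lebesgue_measure R).
Local Notation leb2 := (@area R).
Local Notation D := (disc (R := R)).

Lemma cdiffX f z (l : R[i]) n : cdiff f z l ->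
  cdiff (fun v => f v ^+ n.+1) z (n.+1%:R * f z ^+ n * l).
Proof.
move=> df; elim: n => [|n IH].
  by rewrite expr0 mulr1 mul1r.
have := cdiffM df IH; congr cdiff.
rewrite !exprS -[n.+2%:R]natr1; ring.
Qed.

Lemma conjc_mul c : conjc c * c = ((cabs c) ^+ 2)%:C%C.
Proof.
case: c => x y; rewrite /ComplexField.Normc.normc sqr_sqrtr ?addr_ge0 ?sqr_ge0//.
by apply/eqP; rewrite eq_complex /=; apply/andP; split; apply/eqP; ring.
Qed.

Lemma cabs_conjc c : cabs (conjc c) = cabs c.
Proof. by case: c => x y; rewrite /ComplexField.Normc.normc /= sqrrN. Qed.

(** Powers of the Szego kernel, which concentrate near c / |c| as |c| tends to 1. *)
Definition peak (m : nat) c : R[i] -> R[i] := fun z => ((1 - conjc c * z)^-1) ^+ m.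

Lemma peak_denom_ge c z : cabs c < 1 -> cabs z < 1 ->
  1 - cabs c <= cabs (1 - conjc c * z) /\ 1 - cabs z <= cabs (1 - conjc c * z).
Proof.
move=> c1 z1; have := cabsD (1 - conjc c * z) (conjc c * z); rewrite subrK cabs1.
rewrite cabsM cabs_conjc => H; have c0 := cabs_ge0 c; have z0 := cabs_ge0 z.
have : cabs c * cabs z <= cabs c by rewrite ler_piMr// ltW.
have : cabs c * cabs z <= cabs z by rewrite ler_piMl// ltW.
by split; lra.
Qed.

Lemma peak_denom_neq0 c z : cabs c < 1 -> cabs z < 1 -> 1 - conjc c * z != 0.
Proof.
move=> c1 z1; have [H _] := peak_denom_ge c1 z1; apply/eqP => H0.
by move: H; rewrite H0 ComplexField.Normc.normc0; lra.
Qed.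

Lemma peak_cdiff m c z : cabs c < 1 -> cabs z < 1 ->
  cdiff (peak m.+1 c) z (m.+1%:R * (1 - conjc c * z)^-1 ^+ m *
    (- (1 - conjc c * z) ^- 2 * (0 - (conjc c * 1 + 0 * z)))).
Proof.
move=> c1 z1; apply: (@cdiffX (fun v => (1 - conjc c * v)^-1)).
apply: (@cdiffV _ (fun v => 1 - conjc c * v)); last exact: peak_denom_neq0.
apply: cdiffB; first exact: cdiff_cst.
by apply: cdiffM; [exact: cdiff_cst|exact: cdiff_id].
Qed.

Lemma analytic_peak m c : cabs c < 1 -> analytic (peak m.+1 c).
Proof. by move=> c1; apply: analyticP => z z1; eexists; exact: peak_cdiff. Qed.

Lemma cabsX z n : cabs (z ^+ n) = cabs z ^+ n.
Proof. by elim: n => [|n IH]; [rewrite !expr0 cabs1|rewrite !exprS cabsM IH]. Qed.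

Lemma cabs_cderiv_peak m c z : cabs c < 1 -> cabs z < 1 ->
  cabs (cderiv (peak m.+1 c) z) <= m.+1%:R * (cabs (1 - conjc c * z))^-1 ^+ m.+2.
Proof.
move=> c1 z1; rewrite (cdiff_cderiv (peak_cdiff m c1 z1)).
rewrite mulr1 mul0r addr0 sub0r mulrNN !cabsM cabsV !cabsX cabsV cabs_conjc.
have -> : cabs (m.+1%:R : R[i]) = m.+1%:R.
  have -> : (m.+1%:R : R[i]) = (m.+1%:R : R)%:C%C by rewrite rmorph_nat.
  by rewrite cabs_real ger0_norm.
set X := cabs _; rewrite -mulrA ler_pM2l ?ltr0n// !exprS expr0 mulr1.
have -> : X^-1 * (X^-1 * X^-1 ^+ m) = X^-1 ^+ m * ((X * X)^-1 * 1).
  by rewrite mulr1 invfM; ring.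
have X0 : 0 <= X^-1 by rewrite invr_ge0 cabs_ge0.
apply: ler_wpM2l; first exact: exprn_ge0.
by apply: ler_wpM2l; [rewrite invr_ge0 mulr_ge0 ?cabs_ge0|exact: ltW].
Qed.

(** The factorization |1 - conj(c) z| = |c| |z - 1 / conj(c)| exhibits the distance to the
    reflection of [c] in the circle, and |c| >= 1/2 makes the two comparable. *)
Lemma peak_denom_sqr c z : 2^-1 <= cabs c -> cabs c < 1 -> cabs z < 1 ->
  (1 - cabs c) ^+ 2 + cabs (z - (conjc c)^-1) ^+ 2 <= 8 * cabs (1 - conjc c * z) ^+ 2.
Proof.
move=> c2 c1 z1; have [H _] := peak_denom_ge c1 z1.
have c0 : conjc c != 0.
  by apply/eqP => H0; move: c2; rewrite -cabs_conjc H0 ComplexField.Normc.normc0; lra.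
have E : cabs (1 - conjc c * z) = cabs c * cabs (z - (conjc c)^-1).
  rewrite -(cabs_conjc c) -cabsM -cabsN; congr cabs; field; exact: c0.
have := cabs_ge0 (z - (conjc c)^-1); set X := cabs (z - _) in E * => X0.
have h1 : X <= 2 * cabs (1 - conjc c * z) by rewrite E; nra.
have h2 : X ^+ 2 <= (2 * cabs (1 - conjc c * z)) ^+ 2.
  by rewrite ler_sqr ?nnegrE// mulr_ge0 ?cabs_ge0.
have h3 : (1 - cabs c) ^+ 2 <= cabs (1 - conjc c * z) ^+ 2.
  by rewrite ler_sqr ?nnegrE ?cabs_ge0//; lra.
rewrite exprMn in h2; have := sqr_ge0 (cabs (1 - conjc c * z)); lra.
Qed.

Lemma cabs_sqr (x y : R) : cabs (Complex x y) ^+ 2 = x ^+ 2 + y ^+ 2.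
Proof. by rewrite /ComplexField.Normc.normc sqr_sqrtr ?addr_ge0 ?sqr_ge0. Qed.

(** With (X, Y) the reflection of [c], [peak_denom_sqr] bounds the integrand by 64 = 8 * 8 times the
    product of 1 / ((x-X)^2 + h^2) and 1 / ((y-Y)^2 + h^2). The double integral then splits into two
    arctangent integrals, without polar coordinates. *)
Lemma peak_denom4_integral c : 2^-1 <= cabs c -> cabs c < 1 ->
  (\int[leb2]_(w in D) ((cabs (1 - conjc c * cplx w) ^+ 4)^-1)%:E <=
    (64 * pi ^+ 2 / (1 - cabs c) ^+ 2)%:E)%E.
Proof.
move=> c2 c1; pose h := 1 - cabs c; have h0 : 0 < h by rewrite /h; lra.
case E : ((conjc c)^-1) => [X Y].
have mD := @measurable_disc R.
pose k (x0 x : R) := h / ((x - x0) ^+ 2 + h ^+ 2).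
have k0 x0 x : 0 <= k x0 x by exact: (divr_ge0 (ltW h0) (addr_ge0 (sqr_ge0 _) (sqr_ge0 _))).
pose I := (`[(-1)%R, 1%R]%classic : set (measurableTypeR R)).
have mI : measurable I by apply: measurable_itv.
pose u x0 := (k x0) \_ I.
have mk x0 : measurable_fun setT (k x0).
  apply: measurable_funM => //.
  have -> : (fun x : R => ((x - x0) ^+ 2 + h ^+ 2)^-1) = (fun x : R => ((x - x0) ^+ 2 + h ^+ 2) `^ (-1)).
    by apply/funext => x; rewrite powR_inv1 ?addr_ge0 ?sqr_ge0.
  apply: (measurableT_comp (measurable_powR _)); apply: measurable_funD => //.
  by apply: measurable_funX; exact: measurable_funB.
have mu0 x0 : measurable_fun [set: measurableTypeR R] (u x0).
  by apply/(measurable_restrictT _ _).1 => //; exact: measurable_funTS (mk x0).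
have u0 x0 x : 0 <= u x0 x by rewrite /u patchE; case: ifP.
have iu x0 : (\int[mu]_x (u x0 x)%:E <= pi%:E)%E.
  have -> : (\int[mu]_x (u x0 x)%:E = \int[mu]_(x in I) (k x0 x)%:E)%E.
    by rewrite [RHS]integral_mkcond; apply: eq_integral => x _; rewrite /u !patchE; case: ifP.
  have l11 : -1 < 1 :> R by lra.
  rewrite /k /I (integral_atan x0 h0 l11).
  by rewrite lee_fin; have := atan_ltpi2 ((1 - x0) / h); have := atan_gtNpi2 ((-1 - x0) / h); lra.
pose F w : \bar R := ((64 / h ^+ 2) * (u X w.1 * u Y w.2))%:E.
have mF : measurable_fun setT F.
  apply/measurable_EFinP; apply: measurable_funM => //; apply: measurable_funM.
    exact: measurableT_comp (mu0 X) (@measurable_fst _ _ _ _).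
  exact: measurableT_comp (mu0 Y) (@measurable_snd _ _ _ _).
have h20 : 0 <= 64 / h ^+ 2 by rewrite divr_ge0 ?sqr_ge0.
have F0 w : (0 <= F w)%E by exact: (mulr_ge0 h20 (mulr_ge0 (u0 _ _) (u0 _ _))).
have iF : (\int[leb2]_w F w <= (64 * pi ^+ 2 / h ^+ 2)%:E)%E.
  have -> : (\int[leb2]_w F w = \int[mu]_x \int[mu]_y F (x, y))%E := fubini_tonelli1 F mF F0.
  have muE x0 : measurable_fun [set: measurableTypeR R] (fun x => (u x0 x)%:E) by exact/measurable_EFinP.
  have uE0 x0 x : [set: measurableTypeR R] x -> (0 <= (u x0 x)%:E)%E by rewrite lee_fin.
  have in1 x : (\int[mu]_y F (x, y) = (64 / h ^+ 2 * u X x)%:E * \int[mu]_y (u Y y)%:E)%E.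
    rewrite -(ge0_integralZl_EFin mu measurableT (uE0 Y) (muE Y)); last by rewrite mulr_ge0.
    by apply: eq_integral => y _; rewrite /F /= mulrA EFinM.
  under eq_integral do rewrite in1.
  apply: (@le_trans _ _ (\int[mu]_x ((64 / h ^+ 2 * pi)%:E * (u X x)%:E))%E).
    apply: ge0_le_integral => //.
    - move=> x _; apply: mule_ge0; first by rewrite lee_fin mulr_ge0.
      by apply: integral_ge0 => y _; rewrite lee_fin.
    - apply: emeasurable_funM; last exact: measurable_cst.
      by apply/measurable_EFinP; exact: measurable_funM.
    - exact: measurable_funeM.
    - move=> x _; apply: le_trans (lee_wpmul2l _ (iu Y)) _; first by rewrite lee_fin mulr_ge0.
      by rewrite -!EFinM lee_fin le_eqVlt; apply/orP; left; apply/eqP; ring.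
  have hp : 0 <= 64 / h ^+ 2 * pi by rewrite mulr_ge0 ?pi_ge0.
  rewrite (ge0_integralZl_EFin mu measurableT (uE0 X) (muE X) hp).
  apply: le_trans (lee_wpmul2l _ (iu X)) _; first by rewrite lee_fin.
  by rewrite -EFinM lee_fin le_eqVlt; apply/orP; left; apply/eqP; rewrite expr2; ring.
apply: le_trans iF; rewrite integral_mkcond.
have pt w : D w -> (cabs (1 - conjc c * cplx w) ^+ 4)^-1 <= 64 / h ^+ 2 * (u X w.1 * u Y w.2).
  move=> Dw; have w1 : cabs (cplx w) < 1 by [].
  have := peak_denom_sqr c2 c1 w1; rewrite E -/h.
  have -> : cplx w - Complex X Y = Complex (w.1 - X) (w.2 - Y).
    by apply/eqP; rewrite eq_complex /= !eqxx.
  rewrite cabs_sqr.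
  have [d0 _] := peak_denom_ge c1 w1.
  set d := cabs (1 - conjc c * cplx w) in d0 *; set x := (w.1 - X) ^+ 2; set y := (w.2 - Y) ^+ 2 => H.
  have x0 : 0 <= x by exact: sqr_ge0.
  have y0 : 0 <= y by exact: sqr_ge0.
  have hh : 0 < h ^+ 2 by rewrite exprn_gt0.
  have dd : 0 < d by exact: lt_le_trans h0 d0.
  have bnd (v : R) : `|v| <= cabs (cplx w) -> I v.
    by move=> vw; rewrite /I /= in_itv /= -ler_norml; apply: le_trans vw (ltW w1).
  rewrite /u !patchE !ifT ?inE; last 2 first.
  - by apply: bnd; exact: (normr_Im_le (cplx w)).
  - by apply: bnd; exact: (normr_Re_le (cplx w)).
  rewrite /k -/x -/y.
  have -> : 64 / h ^+ 2 * (h / (x + h ^+ 2) * (h / (y + h ^+ 2))) =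
     64 / ((x + h ^+ 2) * (y + h ^+ 2)).
    by field; rewrite !gt_eqF//; lra.
  rewrite ler_pdivlMr; last by rewrite mulr_gt0//; lra.
  rewrite mulrC ler_pdivrMr ?exprn_gt0//.
  have e1 : x + h ^+ 2 <= 8 * d ^+ 2 by lra.
  have e2 : y + h ^+ 2 <= 8 * d ^+ 2 by lra.
  apply: le_trans (_ : (8 * d ^+ 2) * (8 * d ^+ 2) <= _).
    by apply: ler_pM => //; lra.
  by rewrite le_eqVlt; apply/orP; left; apply/eqP; ring.
apply: ge0_le_integral => //.
- by move=> w _; rewrite patchE; case: ifP => // _; rewrite lee_fin invr_ge0 exprn_ge0 ?cabs_ge0.
- apply/(measurable_restrictT _ _).1 => //; apply/measurable_EFinP.
  have -> : (fun w => (cabs (1 - conjc c * cplx w) ^+ 4)^-1) =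
     (fun w => cabs ((peak 4 c) (cplx w))).
    by apply/funext => w; rewrite /peak cabsX cabsV exprVn.
  by apply: (@measurable_analytic R (peak 4 c)); exact: analytic_peak.
- by move=> w _; rewrite patchE; case: ifPn => [|_]; [rewrite inE => /pt|exact: F0].
Qed.

End test_functions.

(** * Norms and lower bounds of the test functions *)

Section peak_norm.
Variable R : realType.
Implicit Types (a b e h t x y p q : R) (c u z : R[i]) (w : plane R).
Local Notation leb2 := (@area R).
Local Notation D := (disc (R := R)).

Lemma cabs_peak m c z : cabs (peak m c z) = cabs (1 - conjc c * z) `^ (- m%:R).
Proof. by rewrite /peak cabsX cabsV powR_invn ?cabs_ge0// exprVn. Qed.

Lemma peak0 m c : peak m c 0 = 1.
Proof. by rewrite /peak mulr0 subr0 invr1 expr1n. Qed.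

(** With U = |1 - conj(c) z|, the inequality delta <= U bounds a power of delta from above only for
    a nonnegative exponent, and [a] may be negative. For the derivative the exponent is a + p > 0.
    There all but U^(-4) is bounded by a power of 1 - |c|, and [wint_seg_int] carries the estimate
    back to the function. *)
Lemma wint_peak a p : 1 <= p -> -1 < a -> exists m : nat, exists2 C : R, 0 < C &
  forall c, 2^-1 <= cabs c -> cabs c < 1 ->
    (wint a p (peak m.+1 c) <= (C * (1 - cabs c) `^ (2 + a - m.+1%:R * p))%:E)%E.
Proof.
move=> p1 a1; have p0 : 0 < p by lra.
(* Large enough for (m + 1) p - a >= 4, so that the factor U^(-4) can be set aside. *)
pose m := Num.truncn (4 + `|a|); exists m.
have mp : 4 <= m.+1%:R * p - a.
  have h1 : 4 + `|a| < m.+1%:R by exact: truncnS_gt.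
  have h2 : m.+1%:R <= m.+1%:R * p :> R by rewrite ler_peMr.
  by have := ler_norm a; lra.
have [C1 C10 HC1] := weight_integrable a1.
have [C2 C20 HC2] := wint_seg_int p1 a1.
pose K := m.+1%:R `^ p * (64 * pi ^+ 2) : R.
have K0 : 0 < K by rewrite !mulr_gt0 ?powR_gt0 ?exprn_gt0 ?pi_gt0.
pose C := 2 `^ p * (C1 + C2 * K).
have C0 : 0 < C by rewrite mulr_gt0 ?powR_gt0// addr_gt0// mulr_gt0.
exists C => // c c2 c1; pose h := 1 - cabs c; have h0 : 0 < h by rewrite /h; lra.
have h1 : h <= 1 by rewrite /h gerBl cabs_ge0.
pose f := peak m.+1 c; have af : analytic f by exact: analytic_peak.
have adf := analytic_cderiv af; have asf := analytic_seg_int adf.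
have mD := @measurable_disc R.
pose s := m.+1%:R * p - a.
have D1 : (wint (a + p) p (cderiv f) <= (K * h `^ (2 - s))%:E)%E.
  have k0 : 0 <= m.+1%:R `^ p * h `^ (4 - s) by rewrite mulr_ge0 ?powR_ge0.
  have me : measurable_fun D (fun w => ((cabs (1 - conjc c * cplx w) ^+ 4)^-1)%:E).
    apply/measurable_EFinP.
    have -> : (fun w => (cabs (1 - conjc c * cplx w) ^+ 4)^-1) =
       (fun w => cabs ((peak 4 c) (cplx w))).
      by apply/funext => w; rewrite /peak cabsX cabsV exprVn.
    by apply: (@measurable_analytic R (peak 4 c)); exact: analytic_peak.
  have ne w : D w -> (0 <= ((cabs (1 - conjc c * cplx w) ^+ 4)^-1)%:E)%E.
    by move=> _; rewrite lee_fin invr_ge0 exprn_ge0 ?cabs_ge0.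
  apply: (@le_trans _ _ (\int[leb2]_(w in D) ((m.+1%:R `^ p * h `^ (4 - s))%:E *
     ((cabs (1 - conjc c * cplx w) ^+ 4)^-1)%:E))%E).
    apply: ge0_le_integral; [exact: mD| | |exact: measurable_funeM|].
    - by move=> w _; rewrite lee_fin mulr_ge0 ?powR_ge0.
    - by apply/measurable_EFinP; exact: measurable_wint.
    - move=> w Dw; rewrite -EFinM lee_fin; have w1 : cabs (cplx w) < 1 by [].
      have dw0 : 0 < delta w by rewrite -discE.
      have [u1 u2] := peak_denom_ge c1 w1.
      set U := cabs (1 - conjc c * cplx w) in u1 u2 *.
      have U0 : 0 < U by apply: lt_le_trans h0 u1.
      have B1 : cabs (cderiv f (cplx w)) `^ p <= m.+1%:R `^ p * U `^ (- (m.+2%:R * p)).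
        rewrite -mulNr powRrM -powRM ?powR_ge0//.
        apply: ge0_ler_powR; rewrite ?nnegrE ?cabs_ge0 ?mulr_ge0 ?powR_ge0 ?(ltW p0)//.
        rewrite powR_invn ?(ltW U0)// -exprVn; exact: cabs_cderiv_peak.
      have B2 : delta w `^ (a + p) <= U `^ (a + p).
        by apply: ge0_ler_powR; rewrite ?nnegrE ?(ltW U0) ?(ltW dw0)//; lra.
      apply: le_trans (ler_pM (powR_ge0 _ _) (powR_ge0 _ _) B1 B2) _.
      rewrite -!mulrA ler_wpM2l ?powR_ge0// -powRD; last by apply/implyP => _; rewrite gt_eqF.
      have -> : - (m.+2%:R * p) + (a + p) = (4 - s) + - 4%:R.
        by rewrite /s -[m.+2%:R]natr1; ring.
      rewrite powRD; last by apply/implyP => _; rewrite gt_eqF.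
      rewrite powR_invn ?(ltW U0)// ler_wpM2r ?invr_ge0 ?exprn_ge0 ?(ltW U0)//.
      have e0 : 0 <= - (4 - s) by rewrite /s; lra.
      rewrite -[4 - s]opprK powRN [leRHS]powRN lef_pV2 ?posrE ?powR_gt0//.
      by apply: ge0_ler_powR; rewrite ?nnegrE ?(ltW U0) ?(ltW h0).
  rewrite (ge0_integralZl_EFin leb2 mD ne me k0).
  apply: le_trans (lee_wpmul2l _ (peak_denom4_integral c2 c1)) _; first by rewrite lee_fin.
  rewrite -EFinM lee_fin -/h.
  have -> : 2 - s = (4 - s) - 2 by ring.
  by rewrite powRD2// /K le_eqVlt; apply/orP; left; apply/eqP; field; rewrite gt_eqF.
have D2 : (wint a p (seg_int (cderiv f)) <= (C2 * (K * h `^ (2 - s)))%:E)%E.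
  by apply: le_trans (HC2 _ adf) _; rewrite EFinM; apply: lee_wpmul2l; rewrite ?lee_fin ?(ltW C20).
have -> : 2 + a - m.+1%:R * p = 2 - s by rewrite /s; ring.
have e0 : 0 <= - (2 - s) by rewrite /s; lra.
(* The value 1 at the origin is absorbed, as h <= 1 and the exponent is negative. *)
have hs : 1 <= h `^ (2 - s).
  by rewrite -[leLHS](powRr0 h); apply: ger_powR; [rewrite h0|lra].
have mW : measurable_fun D (fun w => (delta w `^ a)%:E).
  by apply/measurable_EFinP; apply: measurable_funTS; exact: measurable_delta_powR.
have mS : measurable_fun D (fun w => (cabs (seg_int (cderiv f) (cplx w)) `^ p * delta w `^ a)%:E).
  by apply/measurable_EFinP; exact: measurable_wint.
have nW w : D w -> (0 <= (delta w `^ a)%:E)%E by rewrite lee_fin powR_ge0.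
have nS w : D w -> (0 <= (cabs (seg_int (cderiv f) (cplx w)) `^ p * delta w `^ a)%:E)%E.
  by rewrite lee_fin mulr_ge0 ?powR_ge0.
have nWS w : D w -> (0 <= (delta w `^ a)%:E + (cabs (seg_int (cderiv f) (cplx w)) `^ p * delta w `^ a)%:E)%E.
  by move=> Dw; rewrite adde_ge0 ?nW ?nS.
have p20 : 0 <= 2 `^ p :> R by exact: powR_ge0.
apply: (@le_trans _ _ (\int[leb2]_(w in D) ((2 `^ p)%:E * ((delta w `^ a)%:E +
   (cabs (seg_int (cderiv f) (cplx w)) `^ p * delta w `^ a)%:E)))%E).
  apply: ge0_le_integral; [exact: mD| | | |].
  - by move=> w _; rewrite lee_fin mulr_ge0 ?powR_ge0.
  - by apply/measurable_EFinP; exact: (measurable_wint a p af).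
  - by apply: measurable_funeM; exact: emeasurable_funD.
  - move=> w Dw; rewrite -EFinD -EFinM lee_fin.
    rewrite -[X in _ * (X + _)]mul1r -mulrDl mulrA ler_wpM2r ?powR_ge0//.
    have E : peak m.+1 c (cplx w) = 1 + seg_int (cderiv f) (cplx w).
      by rewrite (seg_int_cderiv af Dw) /f peak0 addrC subrK.
    have := powR_add_le (ltW p0) ler01 (cabs_ge0 (seg_int (cderiv f) (cplx w))).
    rewrite powR1; apply: le_trans.
    apply: ge0_ler_powR; rewrite ?nnegrE ?cabs_ge0 ?addr_ge0 ?cabs_ge0 ?(ltW p0)//.
    by rewrite E; apply: le_trans (cabsD _ _) _; rewrite cabs1.
rewrite (ge0_integralZl_EFin leb2 mD nWS (emeasurable_funD mW mS) p20).
rewrite (ge0_integralD leb2 mD nW mW nS mS).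
rewrite /C -mulrA EFinM; apply: lee_wpmul2l; first by rewrite lee_fin.
rewrite mulrDl EFinD -mulrA; apply: leeD => //.
by apply: le_trans HC1 _; rewrite lee_fin ler_peMr// ltW.
Qed.

(** In 1 - conj(w) c = (1 - |w|^2) + conj(w) (w - c) the two terms are at most 2 delta w and delta w
    in modulus. *)
Lemma peak_lower (m : nat) (c w : plane R) : D w -> nbr (c, w) ->
  (3 * delta w) `^ (- m%:R) <= cabs (peak m (cplx w) (cplx c)).
Proof.
move=> Dw cw; have dw0 : 0 < delta w by rewrite -discE.
have [dc0 /andP[h1 h2]] := nbr_delta cw.
have w1 : cabs (cplx w) < 1 by [].
have c1 : cabs (cplx c) < 1 by move: dc0; rewrite /delta; lra.
have U0 : 0 < cabs (1 - conjc (cplx w) * cplx c).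
  by apply: lt_le_trans dw0 _; have [] := peak_denom_ge w1 c1.
rewrite cabs_peak !powRN lef_pV2 ?posrE ?powR_gt0 ?mulr_gt0//.
apply: ge0_ler_powR; rewrite ?nnegrE ?(ltW U0) ?mulr_ge0 ?(ltW dw0)//.
have -> : 1 - conjc (cplx w) * cplx c = (1 - cabs (cplx w) ^+ 2)%:C%C +
    conjc (cplx w) * (cplx w - cplx c).
  by rewrite mulrBr conjc_mul rmorphB rmorph1 /=; ring.
apply: le_trans (cabsD _ _) _; rewrite cabsM cabs_conjc cabs_real.
have w0 := cabs_ge0 (cplx w); have wc0 := cabs_ge0 (cplx w - cplx c).
have cw' : cabs (cplx w - cplx c) <= delta w by move: cw; rewrite /nbr /=; lra.
have h3 : cabs (cplx w) * cabs (cplx w - cplx c) <= cabs (cplx w - cplx c).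
  by rewrite ler_piMl// ltW.
have sq : cabs (cplx w) ^+ 2 <= 1 by rewrite expr2; nra.
rewrite ger0_norm ?subr_ge0//.
have : 1 - cabs (cplx w) ^+ 2 <= 2 * delta w by rewrite /delta expr2; nra.
by lra.
Qed.

End peak_norm.

(** * Carleson conditions near the boundary *)

Section tail.
Variable R : realType.
Implicit Types (a b d t x y p q e : R) (f : R[i] -> R[i]) (c w v : plane R)
  (h : plane R -> R).
Local Notation leb2 := (@area R).
Local Notation D := (disc (R := R)).

(** The complement of the disc belongs to it when d > 0, so it is used together with a restriction
    to [D]. *)
Definition collar d : set (plane R) := [set w | delta w < d].

Lemma measurable_collar d : measurable (collar d).
Proof.
have -> : collar d = (@delta R) @^-1` `]-oo, d[.
  by apply/seteqP; split => w; rewrite /collar /= in_itv.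
by rewrite -[X in measurable X]setTI; apply: measurable_delta.
Qed.

(** In |f|^q = |f|^(q-p) |f|^p the first factor is bounded by [growth] and the second by the mean
    value inequality; Fubini then leaves the local mass of [h], which the hypothesis bounds. [C]
    does not depend on [e], so a small local mass gives a small tail. *)
Lemma carleson_collar a p q : 1 <= p -> p <= q -> exists2 C : R, 0 < C &
  forall h e d, measurable_fun D h -> (forall w, D w -> 0 <= h w) -> 0 <= e ->
  (forall w, D w -> delta w < d ->
    (\int[leb2]_(c in [set c | nbr (c, w)]) (h c)%:E <= (e * delta w `^ ((2 + a) * (q / p)))%:E)%E) ->
  forall f N, analytic f -> 0 <= N -> (wint a p f <= N%:E)%E ->
  (\int[leb2]_(c in D) (cabs (f (cplx c)) `^ q * (h c * \1_(collar (d / 2)) c))%:E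
    <= (C * e * N `^ (q / p))%:E)%E.
Proof.
move=> p1 pq; have p0 : 0 < p by lra.
have [K1 K10 HK1] := growth a p1.
have [K2 K20 HK2] := subharmonic p1.
(* Here q = p r + p. The exponents -(2 + a) r from [growth] and -2 from the mean value add up to a -
   s. *)
pose s := (2 + a) * (q / p); pose r := (q - p) / p.
have r0 : 0 <= r by rewrite divr_ge0 ?subr_ge0// ltW.
have M0 : 0 < K1 `^ r * (4 * K2) by rewrite !mulr_gt0 ?powR_gt0.
have M20 : 0 < K1 `^ r * (4 * K2) * 2 `^ `|a - s| by rewrite mulr_gt0 ?powR_gt0.
exists (K1 `^ r * (4 * K2) * 2 `^ `|a - s|) => // h e d mh h0 e0 Hh f N af N0 HN.
have mD := @measurable_disc R.
have Nr0 : 0 <= N `^ r by exact: powR_ge0.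
pose k c : R := \1_(collar (d / 2)) c.
have k0 c : 0 <= k c by rewrite /k indicE.
have mk : measurable_fun D k by apply: measurable_funTS; exact: measurable_indic (measurable_collar _).
pose M := K1 `^ r * (4 * K2) * N `^ r; have MM : 0 <= M by rewrite /M !mulr_ge0 ?powR_ge0 ?(ltW K20).
pose A c := cabs (f (cplx c)) `^ q * (h c * k c).
pose m c := h c * k c * (M * delta c `^ (a - s)).
pose Phi w := cabs (f (cplx w)) `^ p.
pose V := K1 `^ r * (4 * K2) * 2 `^ `|a - s| * e * N `^ r.
have V0 : 0 <= V by rewrite /V !mulr_ge0 ?powR_ge0 ?(ltW K20).
pose v w := V * delta w `^ a.
have mA : measurable_fun D A.
  apply: measurable_funM; last exact: measurable_funM.
  exact: (measurableT_comp (measurable_powR q) (measurable_analytic af)).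
have mm : measurable_fun D m.
  apply: measurable_funM; first exact: measurable_funM.
  apply: measurable_funM => //; apply: measurable_funTS; exact: measurable_delta_powR.
have mPhi : measurable_fun D Phi.
  exact: (measurableT_comp (measurable_powR p) (measurable_analytic af)).
have mv : measurable_fun D v.
  apply: measurable_funM => //; apply: measurable_funTS; exact: measurable_delta_powR.
have A0 c : D c -> 0 <= A c by move=> Dc; rewrite !mulr_ge0 ?powR_ge0 ?h0.
have m0 c : D c -> 0 <= m c.
  by move=> Dc; apply: mulr_ge0; apply: mulr_ge0 => //; [exact: h0|exact: powR_ge0].
have Phi0 c : D c -> 0 <= Phi c by move=> Dc; exact: powR_ge0.
have v0 c : 0 <= v c by exact: mulr_ge0 V0 (powR_ge0 _ _).
have fin c : D c -> cabs (f (cplx c)) `^ p <= K1 * delta c `^ (- (2 + a)) * N.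
  move=> Dc; rewrite -lee_fin EFinM; apply: le_trans (HK1 f c af Dc) _.
  by apply: lee_wpmul2l => //; rewrite lee_fin mulr_ge0 ?powR_ge0// ltW.
have Hm c : D c -> ((A c)%:E <= (m c)%:E * \int[leb2]_(w in pball (cplx c) (delta c / 2)) (Phi w)%:E)%E.
  move=> Dc; have dc0 : 0 < delta c by rewrite -discE.
  have dc20 : 0 < delta c / 2 by lra.
  have cd1 : cabs (cplx c) + delta c / 2 <= 1 by move: dc0; rewrite /delta; lra.
  have [H _] := HK2 f (cplx c) (delta c / 2) af dc20 cd1.
  have B : cabs (f (cplx c)) `^ q <= (K1 * delta c `^ (- (2 + a)) * N) `^ r * cabs (f (cplx c)) `^ p.
    have -> : q = p * r + p by rewrite /r; field; rewrite gt_eqF.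
    rewrite powRD; last by apply/implyP; rewrite gt_eqF//; apply: ltr_wpDl => //; exact: mulr_ge0 (ltW p0) r0.
    rewrite powRrM ler_wpM2r ?powR_ge0//.
    apply: ge0_ler_powR; rewrite ?nnegrE ?powR_ge0 ?fin//.
    by rewrite !mulr_ge0 ?powR_ge0// ltW.
  have B2 : A c <= (h c * k c) * (K1 * delta c `^ (- (2 + a)) * N) `^ r * cabs (f (cplx c)) `^ p.
    by rewrite /A mulrC -[leRHS]mulrA; apply: ler_wpM2l => //; rewrite mulr_ge0 ?h0.
  apply: (@le_trans _ _ (((h c * k c) * (K1 * delta c `^ (- (2 + a)) * N) `^ r)%:E * (cabs (f (cplx c)) `^ p)%:E)%E).
    by rewrite -EFinM lee_fin.
  apply: le_trans (lee_wpmul2l _ H) _.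
    by rewrite lee_fin !mulr_ge0 ?powR_ge0 ?h0.
  rewrite muleA -EFinM le_eqVlt; apply/orP; left; apply/eqP; congr (_%:E * _)%E.
  have -> : (K1 * delta c `^ (- (2 + a)) * N) `^ r = K1 `^ r * N `^ r * delta c `^ (- (2 + a) * r).
    rewrite powRM ?mulr_ge0 ?powR_ge0 ?(ltW K10)// powRM ?powR_ge0 ?(ltW K10)// -powRrM; ring.
  rewrite /m /M; have -> : a - s = - (2 + a) * r - 2.
    by rewrite /s /r; field; rewrite gt_eqF.
  by rewrite powRD2//; field; rewrite gt_eqF.
have Hv w : D w -> (\int[leb2]_(c in [set c | nbr (c, w)]) (m c)%:E <= (v w)%:E)%E.
  move=> Dw; have dw0 : 0 < delta w by rewrite -discE.
  have SD : [set c | nbr (c, w)] `<=` D by move=> c /nbr_delta[]; rewrite discE.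
  have mS := measurable_nbr_r w.
  (* When delta w >= d, no centre in the collar of width d / 2 has [w] in its ball, because delta w
     <= 2 delta c. *)
  have [dw|dw] := ltP (delta w) d; last first.
    apply: (@le_trans _ _ 0%E); last by rewrite lee_fin v0.
    rewrite le_eqVlt; apply/orP; left; apply/eqP; apply: integral0_eq => c cw.
    rewrite /m /k indicE memNset ?mulr0 ?mul0r//.
    by have [_] := nbr_delta cw; rewrite /collar /=; lra.
  pose X := M * (2 `^ `|a - s| * delta w `^ (a - s)).
  have X0 : 0 <= X by exact: mulr_ge0 MM (mulr_ge0 (powR_ge0 _ _) (powR_ge0 _ _)).
  have mhS : measurable_fun [set c | nbr (c, w)] (fun c => (h c)%:E).
    by apply/measurable_EFinP; exact: measurable_funS mD SD mh.
  have hS0 c : [set c | nbr (c, w)] c -> (0 <= (h c)%:E)%E by move=> /SD Dc; rewrite lee_fin h0.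
  apply: (@le_trans _ _ (\int[leb2]_(c in [set c | nbr (c, w)]) (X%:E * (h c)%:E))%E).
    apply: ge0_le_integral; [exact: mS| | |exact: measurable_funeM|].
    - by move=> c /SD Dc; rewrite lee_fin m0.
    - by apply/measurable_EFinP; exact: measurable_funS mD SD mm.
    - move=> c cw; have Dc := SD _ cw; rewrite -EFinM lee_fin /m [X * _]mulrC.
      have [dc0 /andP[h1 h2]] := nbr_delta cw.
      apply: ler_pM.
      - exact: mulr_ge0 (h0 _ Dc) (k0 c).
      - exact: mulr_ge0 MM (powR_ge0 _ _).
      - by rewrite ler_piMr ?h0// /k indicE; case: (_ \in _).
      - rewrite /X; apply: ler_wpM2l MM _ _ _; apply: powR_comparable => //; lra.
  rewrite (ge0_integralZl_EFin leb2 mS hS0 mhS X0).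
  apply: le_trans (lee_wpmul2l _ (Hh w Dw dw)) _; first by rewrite lee_fin.
  rewrite -EFinM lee_fin -/s le_eqVlt; apply/orP; left; apply/eqP.
  have E : delta w `^ a = delta w `^ (a - s) * delta w `^ s.
    by rewrite -powRD ?subrK//; apply/implyP => _; rewrite gt_eqF.
  rewrite /X /v /V /M E; ring.
have := @avg_le _ A m Phi v mA mm mPhi mv A0 m0 Phi0 (fun c _ => v0 c) Hm Hv.
move=> H; apply: le_trans H _.
have n1 w : D w -> (0 <= (cabs (f (cplx w)) `^ p * delta w `^ a)%:E)%E.
  by move=> _; rewrite lee_fin mulr_ge0 ?powR_ge0.
have m1 : measurable_fun D (fun w => (cabs (f (cplx w)) `^ p * delta w `^ a)%:E).
  by apply/measurable_EFinP; exact: measurable_wint.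
have -> : (\int[leb2]_(w in D) (Phi w * v w)%:E = V%:E * wint a p f)%E.
  rewrite /wint -(ge0_integralZl_EFin leb2 mD n1 m1 V0).
  by apply: eq_integral => w _; rewrite -EFinM /Phi /v mulrCA.
apply: le_trans (lee_wpmul2l _ HN) _; first by rewrite lee_fin.
rewrite -EFinM lee_fin le_eqVlt; apply/orP; left; apply/eqP.
have -> : q / p = r + 1 by rewrite /r; field; rewrite gt_eqF.
rewrite powRD; last first.
  by apply/implyP; rewrite gt_eqF//; apply: (lt_le_trans ltr01); rewrite lerDr.
by rewrite powRr1// /V; ring.
Qed.

End tail.

(** * Monotonicity without measurability, and integration against a density *)

Section nonneg_integrals.
Context d (T : measurableType d) (R : realType).
Variable mu : {measure set T -> \bar R}.
Local Open Scope ereal_scope.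
Import HBNNSimple.

(** Read off the definition of the integral as a supremum over simple functions. It is meant for
    integrals over Carleson boxes, whose measurability is never established. *)
Lemma le_integral_nonmeasurable (f g : T -> \bar R) : (forall x, 0 <= f x) ->
  (forall x, f x <= g x) -> \int[mu]_x f x <= \int[mu]_x g x.
Proof.
move=> f0 fg; rewrite !ge0_integralTE//; last by move=> x; exact: le_trans (f0 x) (fg x).
apply: le_ereal_sup => _ [h hf <-]; exists h => // x; exact: le_trans (hf x) (fg x).
Qed.

Lemma subset_integral_nonmeasurable (A B : set T) (f : T -> \bar R) :
  A `<=` B -> (forall x, B x -> 0 <= f x) -> \int[mu]_(x in A) f x <= \int[mu]_(x in B) f x.
Proof.
move=> AB f0; rewrite 2!(integral_mkcond _ f); apply: le_integral_nonmeasurable => x; rewrite !patchE.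
  by case: ifPn => //; rewrite inE => /AB /f0.
case: ifPn => [|_]; last by case: ifPn => //; rewrite inE => /f0.
by rewrite inE => /AB /mem_set ->.
Qed.

Variables (D : set T) (h : T -> R).
Hypotheses (mD : measurable D) (mh : measurable_fun D h) (h0 : forall x, D x -> (0 <= h x)%R).
Local Notation nu := (mdensity mu mD mh h0).

Let integral_indic_density (A E : set T) : measurable A -> A `<=` D -> measurable E ->
  \int[nu]_(x in A) (\1_E x)%:E = \int[mu]_(x in A) (\1_E x * h x)%:E.
Proof.
move=> mA AD mE; rewrite integral_indic//.
transitivity (\int[mu]_(x in E `&` A) (h x)%:E).
  by rewrite /= /mdensity -setIA (setIidl AD).
rewrite integral_mkcondl; apply: eq_integral => x xA; rewrite patchE indicE.
by case: ifPn; rewrite ?mul1r ?mul0r.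
Qed.

Let integral_nnsfun_density (A : set T) (f : {nnsfun T >-> R}) : measurable A -> A `<=` D ->
  \int[nu]_(x in A) (f x)%:E = \int[mu]_(x in A) (f x * h x)%:E.
Proof.
move=> mA AD; have mhA : measurable_fun A h by exact: measurable_funS mD AD mh.
under [LHS]eq_integral do rewrite fimfunE -fsumEFin//.
rewrite [LHS]ge0_integral_fsum//; last 2 first.
  - by move=> r; exact/measurable_EFinP/measurableT_comp.
  - by move=> n x _; rewrite EFinM nnfun_muleindic_ge0.
under [RHS]eq_integral.
  move=> x /[!inE] xA; rewrite EFinM fimfunE -fsumEFin// ge0_mule_fsuml; last first.
    by move=> r; rewrite EFinM nnfun_muleindic_ge0.
  over.
rewrite [RHS]ge0_integral_fsum//; last 2 first.
  - by move=> r; apply: emeasurable_funM; apply/measurable_EFinP => //; exact/measurableT_comp.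
  - move=> n x Ax; apply: mule_ge0; last by rewrite lee_fin (h0 (AD _ Ax)).
    by rewrite EFinM nnfun_muleindic_ge0.
apply: eq_fsbigr => r _.
have [r0|r0] := ltP r 0%R.
  have E0 : f @^-1` [set r] = set0 by exact: preimage_nnfun0.
  by rewrite !integral0_eq// => x _; rewrite E0 indic0 mulr0 ?mul0e.
rewrite (integralZl_indic_nnsfun _ mA) integral_indic_density//.
rewrite -ge0_integralZl_EFin//.
- by apply: eq_integral => x _; rewrite -!EFinM mulrA.
- by move=> x Ax; rewrite lee_fin mulr_ge0 ?(h0 (AD _ Ax)).
- by apply/measurable_EFinP; apply: measurable_funM => //; apply: measurable_indic.
Qed.

(** From indicators to simple functions, then by monotone convergence. This turns integrals against
    [mun] into area integrals. *)
Lemma integral_density (A : set T) (f : T -> R) : measurable A -> A `<=` D ->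
  measurable_fun A f -> (forall x, A x -> (0 <= f x)%R) ->
  \int[nu]_(x in A) (f x)%:E = \int[mu]_(x in A) (f x * h x)%:E.
Proof.
move=> mA AD mf f0; have mhA : measurable_fun A h by exact: measurable_funS mD AD mh.
have mfE : measurable_fun A (EFin \o f) by exact/measurable_EFinP.
pose f_ := nnsfun_approx mA mfE.
have f0E x : A x -> 0 <= (EFin \o f) x by move=> Ax; rewrite /= lee_fin f0.
have cf x : A x -> (f_ n x)%:E @[n --> \oo] --> (f x)%:E by move=> Ax; exact: (cvg_nnsfun_approx mA mfE f0E Ax).
transitivity (limn (fun n => \int[nu]_(x in A) (f_ n x)%:E)).
  rewrite -monotone_convergence//=.
  - by apply: eq_integral => x /[!inE] xA; apply/esym/cvg_lim => //; exact: cf.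
  - by move=> n; apply: measurableT_comp => //; exact: measurable_funTS.
  - by move=> n x _; rewrite lee_fin.
  - by move=> x _ a b ab; rewrite lee_fin//; exact/lefP/nd_nnsfun_approx.
transitivity (limn (fun n => \int[mu]_(x in A) (f_ n x * h x)%:E)).
  by congr (limn _); apply/funext => n; exact: integral_nnsfun_density.
rewrite -monotone_convergence//=.
- apply: eq_integral => x /[!inE] xA; apply/cvg_lim => //; rewrite EFinM.
  under eq_fun do rewrite EFinM.
  by apply: cvgeZr => //; exact: cf.
- move=> n; apply/measurable_EFinP; apply: measurable_funM => //; exact: measurable_funTS.
- by move=> n x Ax; rewrite lee_fin mulr_ge0 ?(h0 (AD _ Ax)).
- move=> x Ax a b ab; rewrite lee_fin; apply: ler_wpM2r; first exact: h0 (AD _ Ax).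
  exact/lefP/nd_nnsfun_approx.
Qed.

End nonneg_integrals.

(** * Bergman norms and mu_n in terms of weighted area integrals *)

Section comparison.
Variable R : realType.
Implicit Types (a b e t x y p q N M : R) (f g : R[i] -> R[i]) (w : plane R).
Local Notation leb2 := (@area R).
Local Notation D := (disc (R := R)).

Lemma delta_comparable e w : D w ->
  (1 - cabs (cplx w) ^+ 2) `^ e <= 2 `^ `|e| * delta w `^ e /\
  delta w `^ e <= 2 `^ `|e| * (1 - cabs (cplx w) ^+ 2) `^ e.
Proof.
move=> Dw; have c0 := cabs_ge0 (cplx w); have c1 : cabs (cplx w) < 1 by [].
by split; apply: powR_comparable; rewrite ?ler1n ?/delta ?expr2//; nra.
Qed.

Lemma integral_dA (A : set (plane R)) (F : plane R -> R) : measurable A ->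
  measurable_fun A F -> (forall w, A w -> 0 <= F w) ->
  (\int[dA R]_(w in A) (F w)%:E = (pi^-1)%:E * \int[leb2]_(w in A) (F w)%:E)%E.
Proof.
move=> mA mF F0; rewrite /dA ge0_integral_mscale//=; last by exact/measurable_EFinP.
by rewrite div1r.
Qed.

(** An arbitrary set and an arbitrary factor [F] are kept, to cover the Bergman integrals and the
    measure mu_n at once. *)
Lemma weight_comparable e : exists2 C : R, 0 < C & forall (A : set (plane R)) (F : plane R -> R),
  measurable A -> A `<=` D -> measurable_fun A F -> (forall w, A w -> 0 <= F w) ->
  (\int[dA R]_(w in A) (F w * (1 - cabs (cplx w) ^+ 2) `^ e)%:E <=
     C%:E * \int[leb2]_(w in A) (F w * delta w `^ e)%:E)%E /\
  (\int[leb2]_(w in A) (F w * delta w `^ e)%:E <=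
     C%:E * \int[dA R]_(w in A) (F w * (1 - cabs (cplx w) ^+ 2) `^ e)%:E)%E.
Proof.
have pi0 : 0 < pi :> R := pi_gt0 R.
have pi1 : 1 <= pi :> R by have := pi_ge2 R; lra.
pose k : R := 2 `^ `|e|; have k0 : 0 < k by exact: powR_gt0.
exists (k * pi); first exact: mulr_gt0.
move=> A F mA AD mF F0; have mD := @measurable_disc R.
have mW : measurable_fun A (fun w => (1 - cabs (cplx w) ^+ 2) `^ e).
  apply: (measurableT_comp (measurable_powR e)); apply: measurable_funB => //.
  apply: measurable_funX; exact: measurable_funTS (@measurable_cabsT R).
have mV : measurable_fun A (fun w => delta w `^ e).
  exact: measurable_funTS (measurable_delta_powR e).
have m1 : measurable_fun A (fun w => F w * (1 - cabs (cplx w) ^+ 2) `^ e) by exact: measurable_funM.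
have m2 : measurable_fun A (fun w => F w * delta w `^ e) by exact: measurable_funM.
have n1 w : A w -> 0 <= F w * (1 - cabs (cplx w) ^+ 2) `^ e.
  by move=> Aw; rewrite mulr_ge0 ?powR_ge0 ?F0.
have n2 w : A w -> 0 <= F w * delta w `^ e by move=> Aw; rewrite mulr_ge0 ?powR_ge0 ?F0.
have key (F1 F2 : plane R -> R) : measurable_fun A F1 -> measurable_fun A F2 ->
    (forall w, A w -> 0 <= F1 w) -> (forall w, A w -> 0 <= F2 w) ->
    (forall w, A w -> F1 w <= k * F2 w) ->
    (\int[leb2]_(w in A) (F1 w)%:E <= k%:E * \int[leb2]_(w in A) (F2 w)%:E)%E.
  move=> mF1 mF2 p1 p2 le12.
  have mF1' : measurable_fun A (EFin \o F1) by exact/measurable_EFinP.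
  have mF2' : measurable_fun A (EFin \o F2) by exact/measurable_EFinP.
  have p2' w : A w -> (0 <= (F2 w)%:E)%E by rewrite lee_fin; exact: p2.
  rewrite -(ge0_integralZl_EFin leb2 mA p2' mF2' (ltW k0)).
  apply: ge0_le_integral; [exact: mA|by move=> w Aw; rewrite lee_fin p1|exact: mF1'| |].
    exact: measurable_funeM.
  by move=> w Aw; rewrite -EFinM lee_fin le12.
have I0 (G : plane R -> R) : (forall w, A w -> 0 <= G w) -> (0 <= \int[leb2]_(w in A) (G w)%:E)%E.
  by move=> G0; apply: integral_ge0 => w Aw; rewrite lee_fin G0.
rewrite (integral_dA mA m1 n1); split.
- have H : (\int[leb2]_(w in A) (F w * (1 - cabs (cplx w) ^+ 2) `^ e)%:E <=
      k%:E * \int[leb2]_(w in A) (F w * delta w `^ e)%:E)%E.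
    apply: key => // w Aw; rewrite mulrCA ler_wpM2l ?F0//.
    by have [] := delta_comparable e (AD _ Aw).
  apply: (@le_trans _ _ ((pi^-1)%:E * (k%:E * \int[leb2]_(w in A) (F w * delta w `^ e)%:E))%E).
    by apply: lee_wpmul2l; rewrite // lee_fin invr_ge0 ltW.
  rewrite muleA -EFinM; apply: lee_wpmul2r; first exact: I0.
  rewrite lee_fin mulrC ler_pM2l//; by apply: (le_trans _ pi1); rewrite invf_le1.
- rewrite muleA -EFinM mulfK ?gt_eqF//; apply: key => // w Aw.
  rewrite mulrCA ler_wpM2l ?F0//.
  by have [] := delta_comparable e (AD _ Aw).
Qed.

Lemma bergman_wint a p : -1 < a -> exists2 C : R, 0 < C & forall f, analytic f ->
  (wint a p f <= C%:E * bergman_int a p f)%E /\ (bergman_int a p f <= C%:E * wint a p f)%E.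
Proof.
move=> a1; have a0 : 0 < a + 1 by lra.
have [C C0 HC] := weight_comparable a; have mD := @measurable_disc R.
exists (C * (a + 1) + C / (a + 1)).
  by rewrite addr_gt0 ?divr_gt0 ?mulr_gt0.
move=> f af.
have mF : measurable_fun D (fun w => cabs (f (cplx w)) `^ p * (a + 1)).
  apply: measurable_funM => //.
  exact: (measurableT_comp (measurable_powR p) (measurable_analytic af)).
have F0 w : D w -> 0 <= cabs (f (cplx w)) `^ p * (a + 1).
  by move=> _; rewrite mulr_ge0 ?powR_ge0 ?(ltW a0).
have [H1 H2] := HC D _ mD (@subset_refl _ D) mF F0.
have E1 : (\int[leb2]_(w in D) (cabs (f (cplx w)) `^ p * (a + 1) * delta w `^ a)%:E =
    (a + 1)%:E * wint a p f)%E.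
  have n1 w : D w -> (0 <= (cabs (f (cplx w)) `^ p * delta w `^ a)%:E)%E.
    by move=> _; rewrite lee_fin mulr_ge0 ?powR_ge0.
  have m1 : measurable_fun D (fun w => (cabs (f (cplx w)) `^ p * delta w `^ a)%:E).
    by apply/measurable_EFinP; exact: measurable_wint.
  rewrite /wint -(ge0_integralZl_EFin leb2 mD n1 m1 (ltW a0)).
  by apply: eq_integral => w _; rewrite -EFinM; congr EFin; ring.
have E2 : (\int[dA R]_(w in D) (cabs (f (cplx w)) `^ p * (a + 1) * (1 - cabs (cplx w) ^+ 2) `^ a)%:E =
    bergman_int a p f)%E.
  by rewrite /bergman_int; apply: eq_integral => w _; rewrite mulrA.
move: H1 H2; rewrite E1 E2 => H1 H2.
have B0 : (0 <= bergman_int a p f)%E.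
  apply: integral_ge0 => w Dw; rewrite lee_fin mulrA mulr_ge0 ?F0 ?powR_ge0//.
have W0 := wint_ge0 a p f.
split.
- rewrite -(@lee_pmul2l _ (a + 1)%:E) ?lte_fin//; apply: le_trans H2 _.
  rewrite muleA -EFinM; apply: lee_wpmul2r => //; rewrite lee_fin.
  have -> : (a + 1) * (C * (a + 1) + C / (a + 1)) = C + (a + 1) * (C * (a + 1)).
    by field; rewrite gt_eqF.
  by rewrite lerDl !mulr_ge0 ?ltW.
- apply: le_trans H1 _; rewrite muleA -EFinM; apply: lee_wpmul2r => //.
  by rewrite lee_fin lerDl divr_ge0 ?ltW.
Qed.

Lemma bergman_int_ge0 a p f : -1 < a -> (0 <= bergman_int a p f)%E.
Proof.
move=> a1; apply: integral_ge0 => w Dw; rewrite lee_fin !mulr_ge0 ?powR_ge0//; lra.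
Qed.

Lemma bergman_normE a p f : -1 < a -> bergman a p f ->
  exists2 M, 0 <= M & bergman_norm a p f = M%:E.
Proof.
move=> a1 [_ fin]; have B0 := bergman_int_ge0 p f a1.
exists (fine (bergman_int a p f) `^ p^-1); first exact: powR_ge0.
by rewrite /bergman_norm -poweR_EFin fineK// ge0_fin_numE.
Qed.

(** Both directions are phrased with real bounds. The first also yields membership in the space,
    since a finite bound on [wint] makes the Bergman integral finite. *)
Lemma bergman_norm_wint a p : 1 <= p -> -1 < a -> exists2 C : R, 0 < C & forall f, analytic f ->
  (forall N, 0 <= N -> (wint a p f <= N%:E)%E ->
     bergman a p f /\ (bergman_norm a p f <= (C * N `^ p^-1)%:E)%E) /\
  (forall M, 0 <= M -> (bergman_norm a p f <= M%:E)%E -> (wint a p f <= (C * M `^ p)%:E)%E).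
Proof.
move=> p1 a1; have p0 : 0 < p by lra.
have [C C0 HC] := bergman_wint p a1.
exists (C + C `^ p^-1); first by rewrite addr_gt0// powR_gt0.
move=> f af; have [H1 H2] := HC f af; have B0 := bergman_int_ge0 p f a1; split.
- move=> N N0 HN.
  have H3 : (bergman_int a p f <= (C * N)%:E)%E.
    by apply: le_trans H2 _; rewrite EFinM; apply: lee_wpmul2l; rewrite // lee_fin ltW.
  have fin : (bergman_int a p f < +oo)%E by apply: le_lt_trans H3 _; rewrite ltry.
  split=> //; rewrite /bergman_norm.
  have finE : bergman_int a p f = (fine (bergman_int a p f))%:E by rewrite fineK// ge0_fin_numE.
  move: H3 B0; rewrite finE poweR_EFin !lee_fin => H3 B0.
  apply: le_trans (_ : (C * N) `^ p^-1 <= _).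
    by apply: ge0_ler_powR; rewrite ?invr_ge0 ?(ltW p0) ?nnegrE// mulr_ge0// ltW.
  by rewrite (powRM _ (ltW C0) N0) ler_wpM2r ?powR_ge0// lerDr ltW.
- move=> M M0 HM; apply: le_trans H1 _.
  rewrite EFinM; apply: (@le_trans _ _ (C%:E * (M `^ p)%:E)%E); last first.
    by rewrite -!EFinM lee_fin ler_wpM2r ?powR_ge0// lerDl powR_ge0.
  apply: lee_wpmul2l; first by rewrite lee_fin ltW.
  move: HM B0; rewrite /bergman_norm; case: (bergman_int a p f) => [r| |//].
    rewrite poweR_EFin !lee_fin => HM r0.
    have := ge0_ler_powR (ltW p0); move=> /(_ (r `^ p^-1) M).
    rewrite !nnegrE powR_ge0 -powRrM mulVf ?gt_eqF// powRr1//; exact.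
  by rewrite poweRyr ?invr_eq0 ?gt_eqF// leye_eq.
Qed.

Lemma mun_comparable g n b q (ag : analytic g) : exists2 C : R, 0 < C &
  forall (A : set (plane R)) (F : plane R -> R), measurable A -> A `<=` D ->
  measurable_fun A F -> (forall w, A w -> 0 <= F w) ->
  (\int[mun n b q ag]_(w in A) (F w)%:E <= C%:E * \int[leb2]_(w in A)
     (F w * (cabs (cderiv g (cplx w)) `^ q * delta w `^ (b + n%:R * q)))%:E)%E /\
  (\int[leb2]_(w in A) (F w * (cabs (cderiv g (cplx w)) `^ q * delta w `^ (b + n%:R * q)))%:E
     <= C%:E * \int[mun n b q ag]_(w in A) (F w)%:E)%E.
Proof.
have [C C0 HC] := weight_comparable (b + n%:R * q).
exists C => // A F mA AD mF F0; have mD := @measurable_disc R.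
have mG : measurable_fun A (fun w => F w * cabs (cderiv g (cplx w)) `^ q).
  apply: measurable_funM => //; apply: measurable_funS mD AD _.
  exact: (measurableT_comp (measurable_powR q) (measurable_analytic (analytic_cderiv ag))).
have G0 w : A w -> 0 <= F w * cabs (cderiv g (cplx w)) `^ q.
  by move=> Aw; rewrite mulr_ge0 ?powR_ge0 ?F0.
have [H1 H2] := HC A _ mA AD mG G0.
have E : (\int[mun n b q ag]_(w in A) (F w)%:E = \int[dA R]_(w in A)
    (F w * cabs (cderiv g (cplx w)) `^ q * (1 - cabs (cplx w) ^+ 2) `^ (b + n%:R * q))%:E)%E.
  rewrite /mun integral_density//.
  by apply: eq_integral => w _; rewrite /mun_density mulrA.
have E2 : (\int[leb2]_(w in A) (F w * (cabs (cderiv g (cplx w)) `^ q * delta w `^ (b + n%:R * q)))%:E =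
  \int[leb2]_(w in A) (F w * cabs (cderiv g (cplx w)) `^ q * delta w `^ (b + n%:R * q))%:E)%E.
  by apply: eq_integral => w _; rewrite mulrA.
by rewrite E E2.
Qed.

End comparison.

(** * Carleson boxes and small discs *)

Section boxes.
Variable R : realType.
Implicit Types (a b e t x y p q L : R) (f g : R[i] -> R[i]) (z : R[i]) (c w : plane R)
  (I : Defs.arc R).
Local Notation leb2 := (@area R).
Local Notation D := (disc (R := R)).

Lemma expiD x y : expi (x + y) = expi x * expi y.
Proof. by rewrite /expi cosD sinD (addrC (sin x * _)). Qed.

Lemma cabs1_sqr z : cabs z = 1 -> (complex.Re z) ^+ 2 + (complex.Im z) ^+ 2 = 1.
Proof.
case: z => x y; rewrite /ComplexField.Normc.normc /= => H.
by rewrite -[LHS]sqr_sqrtr ?H ?expr1n// addr_ge0 ?sqr_ge0.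
Qed.

Lemma polar z : cabs z = 1 -> exists t, z = expi t.
Proof.
move=> /cabs1_sqr; case: z => x y /= H.
have x1 : -1 <= x <= 1.
  by have := sqr_ge0 y; rewrite -ler_norml -(@ler_sqr _ `|x| 1) ?nnegrE// real_normK ?num_real// expr1n; lra.
have E : 1 - x ^+ 2 = y ^+ 2 by lra.
have [y0|y0] := leP 0 y.
- exists (acos x); rewrite /expi sin_acos// acosK ?in_itv//= E sqrtr_sqr ger0_norm//.
- exists (- acos x); rewrite /expi cosN sinN sin_acos// acosK ?in_itv//= E sqrtr_sqr ltr0_norm//.
  by rewrite opprK.
Qed.

(** A nonnegative real part selects the arcsine as the argument, and the sine is increasing on
    [-pi / 2, pi / 2]. *)
Lemma polar_right z (s : R) : cabs z = 1 -> 0 <= complex.Re z -> 0 <= s <= pi / 2 ->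
  `|complex.Im z| <= sin s -> exists t, z = expi t /\ - s <= t <= s.
Proof.
move=> /cabs1_sqr; case: z => x y /= H x0 /andP[s0 s2] ys.
have pi0 := pi_gt0 R.
have y1 : -1 <= y <= 1.
  by have := sqr_ge0 x; rewrite -ler_norml -(@ler_sqr _ `|y| 1) ?nnegrE// real_normK ?num_real// expr1n; lra.
exists (asin y); split.
  rewrite /expi cos_asin// asinK ?in_itv//=.
  have -> : 1 - y ^+ 2 = x ^+ 2 by lra.
  by rewrite sqrtr_sqr ger0_norm.
have A1 := asin_geNpi2 y1; have A2 := asin_lepi2 y1.
move: ys; rewrite ler_norml -sinN => /andP[h1 h2].
have mono u v : - (pi / 2) <= u <= pi / 2 -> - (pi / 2) <= v <= pi / 2 -> sin u <= sin v -> u <= v.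
  by move=> hu hv; rewrite !leNgt; apply: contra => vu; rewrite ltr_sin// in_itv.
have K : sin (asin y) = y by rewrite asinK ?in_itv.
by apply/andP; split; apply: mono; rewrite ?K//; apply/andP; split; lra.
Qed.

(** Arcs shorter than 1/2 give boxes with nonnegative radii [r], so that [r] is the modulus. *)
Lemma box_collar I d : arc_len I < d -> d <= 2^-1 ->
  @cplx R @^-1` carleson_box I `<=` D `&` collar d.
Proof.
move=> Id d2 w [r [t [_ r1 r2 wE]]].
have r0 : 0 <= r by lra.
have cw : cabs (cplx w) = r.
  by rewrite wE cabsM cabs_real ger0_norm// /expi /ComplexField.Normc.normc cos2Dsin2 sqrtr1 mulr1.
by split; rewrite /disc /udisc /collar /delta /= cw//; lra.
Qed.

(** The length [L] stays fixed while [w] approaches the circle. The vanishing condition bounds all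
    short boxes by the same small multiple of the norm, so the box need not match the size of the
    region that it contains. *)
Lemma nbr_box L : 0 < L -> L <= 2^-1 -> exists2 d : R, 0 < d & forall w, D w -> delta w < d ->
  exists2 I, arc_len I = L & [set c | nbr (c, w)] `<=` @cplx R @^-1` carleson_box I.
Proof.
move=> L0 L2; have pi0 := pi_gt0 R.
have Lpi : 0 < pi * L by exact: mulr_gt0.
have Lpi2 : pi * L <= pi / 2 by rewrite ler_pM2l.
have sL : 0 < sin (pi * L).
  by apply: sin_gt0_pi; rewrite Lpi /=; lra.
(* 1 / 4 gives |c| >= 1/2, L / 2 puts [c] into the radial range of the box, and sin (pi L) / 2 puts
   it into the angular range. *)
pose d := Num.min 4^-1 (Num.min (L / 2) (sin (pi * L) / 2)).
exists d; first by rewrite !lt_min invr_gt0 ltr0n !divr_gt0.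
move=> w Dw; rewrite !lt_min => /and3P[d1 d2 d3].
have dw0 : 0 < delta w by rewrite -discE.
have wE : cabs (cplx w) = 1 - delta w by rewrite /delta; ring.
have w0 : 0 < cabs (cplx w) by rewrite wE; lra.
have [t tE] : exists t, (cabs (cplx w))^-1%:C%C * cplx w = expi t.
  apply: polar; rewrite cabsM cabs_real ger0_norm ?invr_ge0 ?(ltW w0)//.
  by rewrite mulVf// gt_eqF.
have lo_hi : t - pi * L < t + pi * L by lra.
have hi_lo : t + pi * L <= (t - pi * L) + 2 * pi by lra.
have arc_lenE x : 0 < x -> (t + x * L - (t - x * L)) / (2 * x) = L.
  by move=> x0; field; rewrite gt_eqF.
exists (Arc true false lo_hi hi_lo).
  exact: (arc_lenE _ pi0).
move=> c cw; have [dc0 /andP[e1 e2]] := nbr_delta cw.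
have cE : cabs (cplx c) = 1 - delta c by rewrite /delta; ring.
have c0 : 0 < cabs (cplx c) by rewrite cE; lra.
pose u := expi t; have u1 : cabs u = 1.
  by rewrite /u /expi /ComplexField.Normc.normc cos2Dsin2 sqrtr1.
have uu : conjc u * u = 1 by rewrite conjc_mul u1 expr1n.
have wu : cplx w = (cabs (cplx w))%:C%C * u.
  rewrite /u -tE mulrA -rmorphM /= mulfV ?mul1r// gt_eqF//.
(* Multiplication by conj(u) rotates [w] onto the positive real axis; the argument of the rotated
   [c] is then controlled by its imaginary part. *)
pose z := (cplx c - cplx w) * conjc u.
have zle : cabs z <= delta w.
  rewrite /z cabsM cabs_conjc u1 mulr1; move: cw; rewrite /nbr /= -cabsN opprB.
  by rewrite -cabsN opprB; lra.
have cu : cplx c * conjc u = (cabs (cplx w))%:C%C + z.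
  rewrite /z mulrBl {2}wu -[_ * u * _]mulrA [u * _]mulrC uu mulr1; ring.
pose v := (cabs (cplx c))^-1%:C%C * (cplx c * conjc u).
have v1 : cabs v = 1.
  rewrite /v !cabsM cabs_conjc u1 mulr1 cabs_real ger0_norm ?invr_ge0 ?(ltW c0)//.
  by rewrite mulVf// gt_eqF.
have Rv : complex.Re v = (cabs (cplx c))^-1 * (cabs (cplx w) + complex.Re z).
  by rewrite /v cu; case: (z) => zx zy /=; ring.
have Iv : complex.Im v = (cabs (cplx c))^-1 * complex.Im z.
  by rewrite /v cu; case: (z) => zx zy /=; ring.
have c2 : (cabs (cplx c))^-1 <= 2.
  by rewrite invf_ple ?posrE// cE; lra.
have ci0 : 0 < (cabs (cplx c))^-1 by rewrite invr_gt0.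
have [s [vE /andP[s1 s2]]] : exists s, v = expi s /\ - (pi * L) <= s <= pi * L.
  apply: polar_right => //.
  - rewrite Rv mulr_ge0 ?(ltW ci0)//; have := normr_Re_le z; rewrite ler_norml wE; lra.
  - by rewrite (ltW Lpi).
  - rewrite Iv normrM (ger0_norm (ltW ci0)).
    apply: le_trans (_ : 2 * delta w <= _); last by lra.
    apply: ler_pM => //; first exact: ltW.
    exact: le_trans (normr_Im_le z) zle.
exists (cabs (cplx c)), (t + s); split.
- exists (t + s) => //=; rewrite in_itv /=; lra.
- by rewrite /arc_len /= (arc_lenE _ pi0) cE; lra.
- by rewrite cE; lra.
- rewrite expiD -vE -/u /v.
  transitivity (((cabs (cplx c)) * (cabs (cplx c))^-1)%:C%C * (conjc u * u) * cplx c).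
    by rewrite uu mulfV ?gt_eqF// rmorph1 !mul1r.
  by rewrite rmorphM /=; ring.
Qed.

End boxes.

(** * The vanishing Carleson condition and small tails *)

Section vanishing.
Variable R : realType.
Implicit Types (a b e t x y p q L N M : R) (f g : R[i] -> R[i]) (z : R[i]) (c w : plane R).
Local Notation leb2 := (@area R).
Local Notation D := (disc (R := R)).

Definition mudens g n b q w : R := cabs (cderiv g (cplx w)) `^ q * delta w `^ (b + n%:R * q).

(* For [h = mudens g n b q], both compactness of [Tgn g n] and the vanishing Carleson
   property of [mun] are equivalent to this. *)
Definition tail_small a p q (h : plane R -> R) : Prop := forall e, 0 < e ->
  exists2 d : R, 0 < d & forall f N, analytic f -> 0 <= N -> (wint a p f <= N%:E)%E ->
  (\int[leb2]_(w in D) (cabs (f (cplx w)) `^ q * (h w * \1_(collar d) w))%:E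
     <= (e * N `^ (q / p))%:E)%E.

Lemma mudens_ge0 g n b q w : 0 <= mudens g n b q w.
Proof. by rewrite mulr_ge0 ?powR_ge0. Qed.

Lemma measurable_mudens g n b q : analytic g -> measurable_fun D (mudens g n b q).
Proof.
move=> ag; apply: measurable_funM; last exact: measurable_funTS (measurable_delta_powR _).
exact: (measurableT_comp (measurable_powR q) (measurable_analytic (analytic_cderiv ag))).
Qed.

Lemma measurable_cabs_powR q f (A : set (plane R)) : analytic f -> measurable A -> A `<=` D ->
  measurable_fun A (fun w => cabs (f (cplx w)) `^ q).
Proof.
move=> af mA AD; apply: measurable_funS (@measurable_disc R) AD _.
exact: (measurableT_comp (measurable_powR q) (measurable_analytic af)).
Qed.

Lemma integral_collar (F : plane R -> R) d :
  (\int[leb2]_(w in D `&` collar d) (F w)%:E = \int[leb2]_(w in D) (F w * \1_(collar d) w)%:E)%E.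
Proof.
rewrite integral_mkcondr; apply: eq_integral => w _; rewrite patchE indicE.
by case: ifPn; rewrite ?mulr1 ?mulr0.
Qed.

Lemma powR_root_mul (C M p q : R) : 0 < p -> 0 <= C -> 0 <= M ->
  (C * M `^ p) `^ (q / p) = C `^ (q / p) * M `^ q.
Proof.
move=> p0 C0 M0; rewrite powRM ?powR_ge0// -powRrM; congr (_ * _ `^ _).
by field; rewrite gt_eqF.
Qed.

Lemma powR_invl x t : 0 <= x -> x^-1 `^ t = (x `^ t)^-1.
Proof. by move=> x0; rewrite -powR_inv1// -powRrM mulN1r powRN. Qed.

(** The homogeneous form N^(q/p) of the tail bound is what produces the factor ||f||^q of the
    vanishing condition. *)
Lemma tail_vanishing a b p q n g (ag : analytic g) : 1 <= p -> -1 < a ->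
  tail_small a p q (mudens g n b q) -> vanishing_carleson a p q (mun n b q ag).
Proof.
move=> p1 a1 Ht e e0; have p0 : 0 < p by lra.
have [Cb Cb0 HCb] := bergman_norm_wint p1 a1.
have [Cm Cm0 HCm] := mun_comparable n b q ag.
have k0 : 0 < Cm * Cb `^ (q / p) by rewrite mulr_gt0 ?powR_gt0.
have [|d d0 Hd] := Ht (e / (Cm * Cb `^ (q / p))); first exact: divr_gt0.
exists (Num.min d 2^-1); first by rewrite lt_min d0 invr_gt0 ltr0n.
move=> I Id f bf _; have [af _] := bf.
have [M M0 ME] := bergman_normE a1 bf; rewrite ME poweR_EFin -EFinM.
have [_ HW] := HCb f af; have := HW M M0; rewrite ME => /(_ (lexx _)) {}HW.
have N0 : 0 <= Cb * M `^ p by rewrite mulr_ge0 ?powR_ge0 ?(ltW Cb0).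
have sub : @cplx R @^-1` carleson_box I `<=` D `&` collar d.
  move=> w /(box_collar Id) []; first by rewrite ge_min lexx orbT.
  by move=> Dw; rewrite /collar /= lt_min => /andP[].
have mDd : measurable (D `&` collar d).
  by apply: measurableI; [exact: measurable_disc|exact: measurable_collar].
apply: le_trans (subset_integral_nonmeasurable _ sub _) _.
  by move=> w _; rewrite lee_fin powR_ge0.
have mF := measurable_cabs_powR q af mDd (@subIsetl _ _ _).
have [H _] := HCm _ _ mDd (@subIsetl _ _ _) mF (fun w _ => powR_ge0 _ _).
apply: le_trans H _; rewrite integral_collar.
under eq_integral do rewrite -mulrA.
apply: le_trans (lee_wpmul2l _ (Hd f _ af N0 HW)) _; first by rewrite lee_fin ltW.
rewrite -EFinM lee_fin powR_root_mul ?(ltW Cb0)// le_eqVlt; apply/orP; left; apply/eqP.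
by field; rewrite !gt_eqF ?powR_gt0.
Qed.

Lemma wint_scale a p (k : R) f : 0 <= k -> analytic f ->
  (wint a p (fun z => (k%:C%C * f z)%R) = (k `^ p)%:E * wint a p f)%E.
Proof.
move=> k0 af; have mD := @measurable_disc R.
have n1 w : D w -> (0 <= (cabs (f (cplx w)) `^ p * delta w `^ a)%:E)%E.
  by move=> _; rewrite lee_fin mulr_ge0 ?powR_ge0.
have m1 : measurable_fun D (fun w => (cabs (f (cplx w)) `^ p * delta w `^ a)%:E).
  by apply/measurable_EFinP; exact: (measurable_wint a p af).
rewrite /wint -(ge0_integralZl_EFin leb2 mD n1 m1 (powR_ge0 _ _)).
apply: eq_integral => w _; rewrite -EFinM cabsM cabs_real (ger0_norm k0).
by rewrite (powRM _ k0 (cabs_ge0 _)) mulrA.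
Qed.

(* Testing on multiples of z |-> (1 - conj(w) z)^-(m+1), which have bounded norm
   and are large throughout the region {c : nbr (c, w)}. *)
Lemma vanishing_nbr a b p q n g (ag : analytic g) : 1 <= p -> p <= q -> -1 < a ->
  vanishing_carleson a p q (mun n b q ag) ->
  exists2 C : R, 0 < C & forall e, 0 < e -> exists2 d : R, 0 < d &
    forall w, D w -> delta w < d -> (\int[leb2]_(c in [set c | nbr (c, w)]) (mudens g n b q c)%:E
      <= (C * e * delta w `^ ((2 + a) * (q / p)))%:E)%E.
Proof.
move=> p1 pq a1 Hv; have p0 : 0 < p by lra.
have q0 : 0 < q by lra.
have [m [Cp Cp0 HCp]] := wint_peak p1 a1.
have [Cb Cb0 HCb] := bergman_norm_wint p1 a1.
have [Cm Cm0 HCm] := mun_comparable n b q ag.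
pose s := 2 + a - m.+1%:R * p.
(* With [wint a p f <= N0], the Bergman norm is at most Cb * N0^(1/p) = 1. *)
pose N0 := Cb `^ (- p); have N00 : 0 < N0 by exact: powR_gt0.
pose C := Cm * (Cp / N0) `^ (q / p) * 3 `^ (m.+1%:R * q).
have C0 : 0 < C by rewrite !mulr_gt0 ?powR_gt0 ?divr_gt0.
exists C => // e e0; have [d0 d00 Hd0] := Hv e e0.
have [||d1 d10 Hd1] := @nbr_box R (Num.min (d0 / 2) 2^-1).
- by rewrite lt_min divr_gt0//= invr_gt0.
- by rewrite ge_min lexx orbT.
exists (Num.min d1 2^-1); first by rewrite lt_min d10 invr_gt0 ltr0n.
move=> w Dw; rewrite lt_min => /andP[dw1 dw2].
have dw0 : 0 < delta w by rewrite -discE.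
have [I IL Isub] := Hd1 w Dw dw1.
have Id0 : arc_len I < d0 by rewrite IL gt_min; apply/orP; left; lra.
have w1 : cabs (cplx w) < 1 by [].
have w2 : 2^-1 <= cabs (cplx w) by move: dw2; rewrite /delta; lra.
pose f0 := peak m.+1 (cplx w); have af0 : analytic f0 by exact: analytic_peak.
(* Scales the peak function so that [wint] is at most [N0]. *)
pose k := (N0 / (Cp * delta w `^ s)) `^ p^-1.
have k0 : 0 < k by rewrite powR_gt0// divr_gt0// mulr_gt0// powR_gt0.
pose f z := k%:C%C * f0 z.
have af : analytic f := analyticM (@analytic_cst _ k%:C%C) af0.
have Wf : (wint a p f <= N0%:E)%E.
  rewrite (wint_scale _ _ (ltW k0) af0).
  apply: le_trans (lee_wpmul2l _ (HCp (cplx w) w2 w1)) _; first by rewrite lee_fin powR_ge0.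
  rewrite -EFinM lee_fin /k -powRrM mulVf ?gt_eqF// powRr1; last first.
    by rewrite divr_ge0 ?mulr_ge0 ?powR_ge0 ?(ltW N00) ?(ltW Cp0).
  by rewrite divfK// gt_eqF// mulr_gt0// powR_gt0.
have [HN _] := HCb f af; have [bf Nf] := HN _ (ltW N00) Wf.
have Nf1 : (bergman_norm a p f <= 1)%E.
  apply: le_trans Nf _; rewrite /N0 -powRrM mulNr mulfV ?gt_eqF// powR_inv1 ?(ltW Cb0)//.
  by rewrite mulfV ?gt_eqF.
have mS := measurable_nbr_r w.
have SD : [set c | nbr (c, w)] `<=` D by move=> c /nbr_delta[]; rewrite discE.
have mF := measurable_cabs_powR q af mS SD.
have [_ H1] := HCm _ _ mS SD mF (fun w _ => powR_ge0 _ _).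
have H2 : (\int[mun n b q ag]_(c in [set c | nbr (c, w)]) (cabs (f (cplx c)) `^ q)%:E <= e%:E)%E.
  apply: le_trans (subset_integral_nonmeasurable _ Isub _) _.
    by move=> c _; rewrite lee_fin powR_ge0.
  apply: le_trans (Hd0 I Id0 f bf Nf1) _; rewrite -[leRHS]mule1.
  apply: lee_wpmul2l; first by rewrite lee_fin ltW.
  have [M M0 ME] := bergman_normE a1 bf; move: Nf1; rewrite ME poweR_EFin !lee_fin => M1.
  have -> : 1 = 1 `^ q :> R by rewrite powR1.
  by apply: ge0_ler_powR; rewrite ?nnegrE ?(ltW q0).
(* A lower bound for |f|^q on the region, by [peak_lower]. *)
pose lam := (k * (3 * delta w) `^ (- m.+1%:R)) `^ q.
have lam0 : 0 < lam by rewrite powR_gt0// mulr_gt0// powR_gt0// mulr_gt0.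
have lamf c : nbr (c, w) -> lam <= cabs (f (cplx c)) `^ q.
  move=> cw; apply: ge0_ler_powR; rewrite ?nnegrE ?cabs_ge0 ?(ltW q0)//.
    by rewrite mulr_ge0 ?powR_ge0 ?(ltW k0).
  rewrite /f cabsM cabs_real (ger0_norm (ltW k0)) ler_pM2l//; exact: peak_lower.
have ng c : [set c | nbr (c, w)] c -> (0 <= (mudens g n b q c)%:E)%E by rewrite lee_fin mudens_ge0.
have mg : measurable_fun [set c | nbr (c, w)] (fun c => (mudens g n b q c)%:E).
  by apply/measurable_EFinP; exact: measurable_funS (@measurable_disc R) SD (measurable_mudens n b q ag).
have H3 : (lam%:E * \int[leb2]_(c in [set c | nbr (c, w)]) (mudens g n b q c)%:E <=
    \int[leb2]_(c in [set c | nbr (c, w)]) (cabs (f (cplx c)) `^ q * mudens g n b q c)%:E)%E.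
  rewrite -(ge0_integralZl_EFin leb2 mS ng mg (ltW lam0)).
  apply: ge0_le_integral; [exact: mS| |exact: measurable_funeM| |].
  - by move=> c cw; apply: mule_ge0; [rewrite lee_fin ltW|exact: ng].
  - apply/measurable_EFinP; apply: measurable_funM => //; exact/measurable_EFinP.
  - move=> c cw; rewrite -EFinM lee_fin; apply: ler_wpM2r (lamf c cw); exact: mudens_ge0.
rewrite -(@lee_pmul2l _ lam%:E) ?lte_fin//.
apply: le_trans H3 _; apply: le_trans H1 _.
apply: le_trans (lee_wpmul2l _ H2) _; first by rewrite lee_fin ltW.
rewrite -!EFinM lee_fin le_eqVlt; apply/orP; left; apply/eqP.
rewrite /lam /C.
(* The powers of delta w cancel: -s q / p from [k] and -(m + 1) q from the peak, against (2 + a) q /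
   p from the claim. *)
have E1 : k `^ q = ((Cp / N0) `^ (q / p))^-1 * delta w `^ (- (s * (q / p))).
  rewrite /k -powRrM [p^-1 * q]mulrC.
  have -> : N0 / (Cp * delta w `^ s) = (Cp / N0)^-1 * (delta w `^ s)^-1.
    by field; rewrite !gt_eqF ?powR_gt0.
  have X0 : 0 <= Cp / N0 by rewrite divr_ge0 ?ltW.
  move: X0; set X := Cp / N0 => X0.
  have Y0 : 0 <= delta w `^ s by exact: powR_ge0.
  have Xi0 : 0 <= X^-1 by rewrite invr_ge0.
  have Yi0 : 0 <= (delta w `^ s)^-1 by rewrite invr_ge0.
  by rewrite (powRM _ Xi0 Yi0) (powR_invl _ X0) (powR_invl _ Y0) -powRrM -!powRN.
rewrite (powRM _ (ltW k0) (powR_ge0 _ _)) E1 -(powRrM (3 * _)).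
rewrite (powRM _ _ (ltW dw0))// mulNr.
have E2 : delta w `^ ((2 + a) * (q / p)) = delta w `^ (s * (q / p)) * delta w `^ (m.+1%:R * q).
  rewrite -powRD; last by apply/implyP => _; rewrite gt_eqF.
  by congr (_ `^ _); rewrite /s; field; rewrite gt_eqF.
rewrite E2 !powRN; field; rewrite !gt_eqF ?powR_gt0 ?divr_gt0//.
Qed.

Lemma vanishing_tail a b p q n g (ag : analytic g) : 1 <= p -> p <= q -> -1 < a ->
  vanishing_carleson a p q (mun n b q ag) -> tail_small a p q (mudens g n b q).
Proof.
move=> p1 pq a1 Hv e e0.
have [C1 C10 HC1] := vanishing_nbr p1 pq a1 Hv.
have [C2 C20 HC2] := carleson_collar a p1 pq.
have C120 : 0 < C2 * C1 by exact: mulr_gt0.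
have [d d0 Hd] := HC1 (e / (C2 * C1)) ltac:(by rewrite divr_gt0).
exists (d / 2); first by rewrite divr_gt0.
move=> f N af N0 HN.
have E0 : 0 <= C1 * (e / (C2 * C1)) by rewrite mulr_ge0 ?divr_ge0 ?(ltW C10) ?(ltW e0) ?(ltW C120).
have := HC2 _ _ d (measurable_mudens n b q ag) (fun w _ => mudens_ge0 g n b q w) E0 Hd f N af N0 HN.
have -> // : C2 * (C1 * (e / (C2 * C1))) = e by field; rewrite !gt_eqF.
Qed.

End vanishing.

(** * Boundedness and compactness *)

Section bounded.
Variable R : realType.
Implicit Types (a b e t x y p q L N M : R) (f g : R[i] -> R[i]) (z : R[i]) (c w : plane R).
Local Notation leb2 := (@area R).
Local Notation D := (disc (R := R)).

Lemma wint_mul_cderiv n b q f g :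
  (wint (b + n%:R * q) q (fun z => (f z * cderiv g z)%R) =
   \int[leb2]_(w in D) (cabs (f (cplx w)) `^ q * mudens g n b q w)%:E)%E.
Proof.
apply: eq_integral => w _.
by rewrite cabsM (powRM _ (cabs_ge0 _) (cabs_ge0 _)) /mudens mulrA.
Qed.

Lemma eq_wint a p f F : (forall z, udisc z -> f z = F z) -> wint a p f = wint a p F.
Proof. by move=> fF; apply: eq_integral => w; rewrite inE => Dw; rewrite fF. Qed.

Lemma analytic_Tgn n f g : analytic g -> analytic f -> analytic (Tgn g n f).
Proof.
move=> ag af; have aG := analyticM af (analytic_cderiv ag).
exact: (@analytic_iter_seg_int _ n _ aG).
Qed.

Lemma Tgn_wint n b q : 1 <= q -> -1 < b -> exists2 C : R, 0 < C &
  forall f g, analytic g -> analytic f ->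
  (wint b q (Tgn g n f) <=
     C%:E * \int[leb2]_(w in D) (cabs (f (cplx w)) `^ q * mudens g n b q w)%:E)%E /\
  (\int[leb2]_(w in D) (cabs (f (cplx w)) `^ q * mudens g n b q w)%:E <=
     C%:E * wint b q (Tgn g n f))%E.
Proof.
move=> q1 b1; have [C1 C10 H1] := wint_iter_seg_int n q1 b1.
have [C2 C20 H2] := wint_iter_cderiv n b q1.
exists (C1 + C2); first exact: addr_gt0.
move=> f g ag af; have aG := analyticM af (analytic_cderiv ag).
rewrite -wint_mul_cderiv; split.
- apply: le_trans (H1 _ aG) _; apply: lee_wpmul2r; first exact: wint_ge0.
  by rewrite lee_fin lerDl ltW.
- rewrite -(@eq_wint _ _ (iter n (@cderiv R) (Tgn g n f))); last first.
    by move=> z z1; exact: (iter_cderiv_seg_int n aG z1).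
  apply: le_trans (H2 _ (analytic_Tgn (n := n) ag af)) _; apply: lee_wpmul2r; first exact: wint_ge0.
  by rewrite lee_fin lerDr ltW.
Qed.

Lemma Tgn_mun n b q g (ag : analytic g) : 1 <= q -> -1 < b -> exists2 C : R, 0 < C &
  forall f, analytic f ->
  (wint b q (Tgn g n f) <= C%:E * \int[mun n b q ag]_(w in D) (cabs (f (cplx w)) `^ q)%:E)%E /\
  (\int[mun n b q ag]_(w in D) (cabs (f (cplx w)) `^ q)%:E <= C%:E * wint b q (Tgn g n f))%E.
Proof.
move=> q1 b1; have [C1 C10 H1] := Tgn_wint n q1 b1.
have [C2 C20 H2] := mun_comparable n b q ag.
exists (C1 * C2); first exact: mulr_gt0.
move=> f af; have [h1 h2] := H1 f g ag af.
have mD := @measurable_disc R.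
have [h3 h4] := H2 D _ mD (@subset_refl _ D)
  (measurable_cabs_powR q af mD (@subset_refl _ D)) (fun w _ => powR_ge0 _ _).
split.
- apply: le_trans h1 _; apply: le_trans (lee_wpmul2l _ h4) _; first by rewrite lee_fin ltW.
  by rewrite muleA.
- apply: le_trans h3 _; apply: le_trans (lee_wpmul2l _ h2) _; first by rewrite lee_fin ltW.
  by rewrite muleA (mulrC C1).
Qed.

Lemma powR_mul_root (K M q : R) : 0 < q -> 0 <= K -> 0 <= M ->
  (K * M `^ q) `^ q^-1 = K `^ q^-1 * M.
Proof.
move=> q0 K0 M0; rewrite (powRM _ K0 (powR_ge0 _ _)) -powRrM mulfV ?gt_eqF//.
by rewrite powRr1.
Qed.

Lemma carleson_bounded n a b p q g (ag : analytic g) : 1 <= p -> p <= q -> -1 < a -> -1 < b ->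
  carleson a p q (mun n b q ag) -> bounded_op (Tgn g n) a p b q.
Proof.
move=> p1 pq a1 b1 [C C0 HC]; have q1 : 1 <= q by lra.
have q0 : 0 < q by lra.
have [Ct Ct0 Ht] := Tgn_mun n ag q1 b1.
have [Cb Cb0 Hb] := bergman_norm_wint q1 b1.
have key f M : bergman a p f -> 0 <= M -> bergman_norm a p f = M%:E ->
    bergman b q (Tgn g n f) /\
    (bergman_norm b q (Tgn g n f) <= (Cb * (Ct * C) `^ q^-1 * M)%:E)%E.
  move=> bf M0 ME; have [af _] := bf; have [h1 _] := Ht f af.
  have := HC f bf; rewrite ME poweR_EFin -EFinM => h2.
  have CM0 : 0 <= Ct * C by rewrite mulr_ge0 ?ltW.
  have N0 : 0 <= Ct * C * M `^ q by rewrite mulr_ge0 ?powR_ge0.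
  have h3 : (wint b q (Tgn g n f) <= (Ct * C * M `^ q)%:E)%E.
    apply: le_trans h1 _; rewrite -mulrA EFinM; apply: lee_wpmul2l => //.
    by rewrite lee_fin ltW.
  have [Hn _] := Hb _ (analytic_Tgn (n := n) ag af).
  have [h4 h5] := Hn _ N0 h3; split=> //.
  by apply: le_trans h5 _; rewrite (powR_mul_root q0 CM0 M0) mulrA.
split.
- move=> f bf; have [M M0 ME] := bergman_normE a1 bf.
  by have [] := key f M bf M0 ME.
- exists (Cb * (Ct * C) `^ q^-1) => f bf; have [M M0 ME] := bergman_normE a1 bf.
  by have [_] := key f M bf M0 ME; rewrite ME -EFinM.
Qed.

Lemma bounded_carleson n a b p q g (ag : analytic g) : 1 <= p -> p <= q -> -1 < a -> -1 < b ->
  bounded_op (Tgn g n) a p b q -> carleson a p q (mun n b q ag).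
Proof.
move=> p1 pq a1 b1 [_ [C HC]]; have q1 : 1 <= q by lra.
have [Ct Ct0 Ht] := Tgn_mun n ag q1 b1.
have [Cb Cb0 Hb] := bergman_norm_wint q1 b1.
(* The operator bound is an arbitrary real number, while a Carleson constant has to be positive. *)
have C10 : 0 < `|C| + 1 by rewrite ltr_wpDl.
exists (Ct * Cb * (`|C| + 1) `^ q); first by rewrite !mulr_gt0 ?powR_gt0.
move=> f bf; have [M M0 ME] := bergman_normE a1 bf; rewrite ME poweR_EFin -EFinM.
have [af _] := bf; have [_ h1] := Ht f af.
have := HC f bf; rewrite ME -EFinM => h2.
have h3 : (bergman_norm b q (Tgn g n f) <= ((`|C| + 1) * M)%:E)%E.
  apply: le_trans h2 _; rewrite lee_fin ler_wpM2r//; have := ler_norm C; lra.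
have [_ Hw] := Hb _ (analytic_Tgn (n := n) ag af).
have CM0 : 0 <= (`|C| + 1) * M by rewrite mulr_ge0 ?(ltW C10).
apply: le_trans h1 _; apply: le_trans (lee_wpmul2l _ (Hw _ CM0 h3)) _.
  by rewrite lee_fin ltW.
by rewrite -EFinM lee_fin (powRM _ (ltW C10) M0) !mulrA.
Qed.

End bounded.

(** * Exhaustion of the disc, bounds on compact parts, and linearity *)

Section local.
Variable R : realType.
Implicit Types (a b d e t x y p q N M : R) (f g F : R[i] -> R[i]) (z : R[i]) (c w : plane R)
  (G : plane R -> R).
Local Notation leb2 := (@area R).
Local Notation D := (disc (R := R)).

(** Monotone convergence along the sets {delta >= 1 / (k + 1)}, which exhaust the disc. *)
Lemma cvg_integral_exhaust G : measurable_fun D G -> (forall w, D w -> 0 <= G w) ->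
  (\int[leb2]_(w in D) (G w * \1_(~` collar k.+1%:R^-1) w)%:E)%E @[k --> \oo] -->
  (\int[leb2]_(w in D) (G w)%:E)%E.
Proof.
move=> mG G0; have mD := @measurable_disc R.
have -> : (\int[leb2]_(w in D) (G w)%:E =
    \int[leb2]_(w in D) limn (fun k => (G w * \1_(~` collar k.+1%:R^-1) w)%:E))%E.
  apply: eq_integral => w; rewrite inE => Dw; apply/esym/cvg_lim => //.
  apply: cvg_near_cst; have dw0 : 0 < delta w by rewrite -discE.
  have [m _ mP] := @near_infty_natSinv_lt R (PosNum dw0).
  exists m => // k /= mk; rewrite indicE mem_set ?mulr1//= => H.
  by have := lt_trans H (mP k mk); rewrite ltxx.
apply: cvg_monotone_convergence => //.
- move=> k; apply/measurable_EFinP; apply: measurable_funM => //.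
  by apply: measurable_funTS; apply: measurable_indic; apply: measurableC; exact: measurable_collar.
- by move=> k w Dw; rewrite lee_fin mulr_ge0 ?G0//.
- move=> w Dw m k mk; rewrite lee_fin ler_wpM2l ?G0// !indicE ler_nat.
  have [/=|] := boolP (w \in ~` collar m.+1%:R^-1); last by case: (_ \in _).
  rewrite inE /= => /negP; rewrite -leNgt => H; rewrite mem_set//= => H2.
  have H3 : k.+1%:R^-1 <= m.+1%:R^-1 :> R by rewrite lef_pV2 ?posrE// ler_nat.
  by have := lt_le_trans H2 (le_trans H3 H); rewrite ltxx.
Qed.

Lemma integral_exhaust_le G N : measurable_fun D G -> (forall w, D w -> 0 <= G w) ->
  (forall d, 0 < d -> d <= 1 ->
     (\int[leb2]_(w in D) (G w * \1_(~` collar d) w)%:E <= N%:E)%E) ->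
  (\int[leb2]_(w in D) (G w)%:E <= N%:E)%E.
Proof.
move=> mG G0 H; have cG := cvg_integral_exhaust mG G0.
rewrite -(cvg_lim _ cG)//; apply: lime_le; first by apply/cvg_ex; eexists; exact: cG.
by apply: nearW => k; apply: H; rewrite ?invr_gt0// invf_le1// ler1n.
Qed.

(** The integral over a collar is the total minus that over an exhausting set; finiteness of the
    total makes the subtraction legitimate. *)
Lemma integral_collar_small G : measurable_fun D G -> (forall w, D w -> 0 <= G w) ->
  (\int[leb2]_(w in D) (G w)%:E < +oo)%E -> forall e, 0 < e -> exists2 d, 0 < d &
    (\int[leb2]_(w in D) (G w * \1_(collar d) w)%:E <= e%:E)%E.
Proof.
move=> mG G0 fin e e0; have mD := @measurable_disc R.
have cG := cvg_integral_exhaust mG G0.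
have I0 : (0 <= \int[leb2]_(w in D) (G w)%:E)%E.
  by apply: integral_ge0 => w Dw; rewrite lee_fin G0.
move: fin I0 cG; case E : (\int[leb2]_(w in D) (G w)%:E)%E => [I| |] // _ I0 cG.
have /fine_cvgP[[m1 _ H1] /cvgrPdist_lt /(_ e e0) [m2 _ H2]] := cG.
pose k := maxn m1 m2; exists k.+1%:R^-1; first by rewrite invr_gt0.
have := H1 k (leq_maxl _ _); have /= := H2 k (leq_maxr _ _).
set A := (X in fine X) => HA /= fA.
have S : (\int[leb2]_(w in D) (G w)%:E = A + \int[leb2]_(w in D) (G w * \1_(collar k.+1%:R^-1) w)%:E)%E.
  have mc : measurable_fun D (\1_(collar k.+1%:R^-1) : plane R -> R).
    by apply: measurable_funTS; apply: measurable_indic; exact: measurable_collar.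
  have mc' : measurable_fun D (\1_(~` collar k.+1%:R^-1) : plane R -> R).
    by apply: measurable_funTS; apply: measurable_indic; apply: measurableC; exact: measurable_collar.
  rewrite /A -(ge0_integralD leb2 mD)//.
  - apply: eq_integral => w _; rewrite -EFinD -mulrDr; congr EFin.
    rewrite !indicE in_setC; case: (_ \in _) => /=; ring.
  - by move=> w Dw; rewrite lee_fin mulr_ge0 ?G0//.
  - by apply/measurable_EFinP; exact: measurable_funM.
  - by move=> w Dw; rewrite lee_fin mulr_ge0 ?G0//.
  - by apply/measurable_EFinP; exact: measurable_funM.
have fA' : A \is a fin_num := fA; clear fA; clearbody A.
move: S HA; rewrite E -(fineK fA') /=.
case: (\int[leb2]_(w in D) (G w * \1_(collar k.+1%:R^-1) w)%:E)%E => [J| |]; rewrite ?leeNy_eq//.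
by rewrite -EFinD => -[->]; rewrite lee_fin addrC addKr => /ltW; apply: le_trans; rewrite ler_norm.
Qed.

Lemma integral_split_collar G d B : measurable_fun D G -> (forall w, D w -> 0 <= G w) ->
  0 <= B -> (forall w, D w -> d <= delta w -> G w <= B) ->
  (\int[leb2]_(w in D) (G w)%:E <=
     \int[leb2]_(w in D) (G w * \1_(collar d) w)%:E + (B * 4)%:E)%E.
Proof.
move=> mG G0 B0 GB; have mD := @measurable_disc R.
have mc : measurable_fun D (fun w => (G w * \1_(collar d) w)%:E).
  apply/measurable_EFinP; apply: measurable_funM => //.
  by apply: measurable_funTS; apply: measurable_indic; exact: measurable_collar.
have nc w : D w -> (0 <= (G w * \1_(collar d) w)%:E)%E by move=> Dw; rewrite lee_fin mulr_ge0 ?G0//.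
have nB w : D w -> (0 <= B%:E)%E by rewrite lee_fin.
have mB : measurable_fun D (fun _ : plane R => B%:E) by exact: measurable_cst.
apply: (@le_trans _ _ (\int[leb2]_(w in D) ((G w * \1_(collar d) w)%:E + B%:E))%E).
  apply: ge0_le_integral; [exact: mD|by move=> w Dw; rewrite lee_fin G0|exact/measurable_EFinP| |].
    exact: emeasurable_funD.
  move=> w Dw; rewrite -EFinD lee_fin indicE; have [dw|dw] := ltP (delta w) d.
    by rewrite mem_set// mulr1 lerDl.
  by rewrite memNset ?mulr0 ?add0r ?GB// /collar /=; apply/negP; rewrite -leNgt.
rewrite (ge0_integralD leb2 mD nc mc nB mB); apply: leeD => //.
rewrite integral_cst// EFinM; apply: lee_wpmul2l; first by rewrite lee_fin.
exact: area_disc.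
Qed.

Lemma powR_bounded d e : 0 < d -> exists2 B, 0 < B & forall x, d <= x -> x <= 1 -> x `^ e <= B.
Proof.
(* 1 covers the exponents e >= 0, and d^e the negative ones. *)
move=> d0; exists (1 + d `^ e); first by rewrite addr_gt0// powR_gt0.
move=> x dx x1; have x0 : 0 < x by exact: lt_le_trans dx.
have [e0|e0] := leP 0 e.
  apply: le_trans (_ : 1 <= _); last by rewrite lerDl powR_ge0.
  have -> : 1 = 1 `^ e :> R by rewrite powR1.
  by apply: ge0_ler_powR; rewrite ?nnegrE ?(ltW x0).
apply: le_trans (_ : d `^ e <= _); last by rewrite lerDr.
rewrite -[e]opprK !(powRN _ (- e)) lef_pV2 ?posrE ?powR_gt0//.
by apply: ge0_ler_powR; rewrite ?nnegrE ?(ltW x0) ?(ltW d0) ?oppr_ge0 ?(ltW e0).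
Qed.

Lemma mudens_bounded g n b q d : analytic g -> 0 <= q -> 0 < d -> exists2 B, 0 < B &
  forall w, D w -> d <= delta w -> mudens g n b q w <= B.
Proof.
move=> ag q0 d0; have d1 : 1 - d < 1 by lra.
have [B1 B10 H1] := analytic_bounded (analytic_cderiv ag) d1.
have [B2 B20 H2] := powR_bounded (b + n%:R * q) d0.
exists (B1 `^ q * B2); first by rewrite mulr_gt0 ?powR_gt0.
move=> w Dw dw; apply: ler_pM; rewrite ?powR_ge0//.
- apply: ge0_ler_powR; rewrite ?nnegrE ?cabs_ge0 ?(ltW B10)//.
  by apply: H1; exact: cabs_le_delta.
- by apply: H2 => //; rewrite /delta gerBl cabs_ge0.
Qed.

(** One bound for a whole ball of functions, by [growth]: this is the hypothesis of [montel]. *)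
Lemma wint_local_bound a p r N : 1 <= p -> -1 < a -> r < 1 -> 0 <= N -> exists B, forall f,
  analytic f -> (wint a p f <= N%:E)%E -> forall z, cabs z <= r -> cabs (f z) <= B.
Proof.
move=> p1 a1 r1 N0; have [K K0 HK] := growth a p1; have p0 : 0 < p by lra.
exists ((K * (1 - r) `^ (- (2 + a)) * N) `^ p^-1) => f af HN z zr.
apply: powR_le_root; rewrite ?cabs_ge0//.
pose c : plane R := (complex.Re z, complex.Im z).
have cz : cplx c = z by rewrite /cplx /c; case: (z).
have Dc : D c by rewrite /disc /udisc /= cz; exact: le_lt_trans r1.
have r0 : 0 < 1 - r by lra.
have dc : 1 - r <= delta c by rewrite /delta cz; lra.
have := HK f c af Dc; rewrite cz => H.
rewrite -lee_fin EFinM; apply: le_trans H _.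
apply: le_trans (lee_wpmul2l _ HN) _.
  by rewrite lee_fin mulr_ge0 ?powR_ge0 ?(ltW K0).
rewrite -!EFinM lee_fin ler_wpM2r// ler_pM2l// !powRN lef_pV2 ?posrE ?powR_gt0//; last by lra.
by apply: ge0_ler_powR; rewrite ?nnegrE//; lra.
Qed.

Lemma wintB a p f F : 0 <= p -> analytic f -> analytic F ->
  (wint a p (fun z => (f z - F z)%R) <= (2 `^ p)%:E * (wint a p f + wint a p F))%E.
Proof.
move=> p0 af aF; have mD := @measurable_disc R.
have n0 (h : R[i] -> R[i]) w : D w -> (0 <= (cabs (h (cplx w)) `^ p * delta w `^ a)%:E)%E.
  by move=> _; rewrite lee_fin mulr_ge0 ?powR_ge0.
have mf : measurable_fun D (fun w => (cabs (f (cplx w)) `^ p * delta w `^ a)%:E).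
  by apply/measurable_EFinP; exact: (measurable_wint a p af).
have mF : measurable_fun D (fun w => (cabs (F (cplx w)) `^ p * delta w `^ a)%:E).
  by apply/measurable_EFinP; exact: (measurable_wint a p aF).
have nS w : D w -> (0 <= (cabs (f (cplx w)) `^ p * delta w `^ a)%:E + (cabs (F (cplx w)) `^ p * delta w `^ a)%:E)%E.
  by move=> Dw; rewrite adde_ge0// n0.
rewrite /wint -(ge0_integralD leb2 mD (n0 f) mf (n0 F) mF).
rewrite -(ge0_integralZl_EFin leb2 mD nS (emeasurable_funD mf mF) (powR_ge0 _ _)).
apply: ge0_le_integral; [exact: mD|exact: (n0 (fun z => f z - F z))| | |].
- by apply/measurable_EFinP; exact: (measurable_wint a p (analyticB af aF)).
- by apply: measurable_funeM; exact: emeasurable_funD.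
- move=> w Dw; rewrite -EFinD -EFinM lee_fin -mulrDl mulrA ler_wpM2r ?powR_ge0//.
  apply: le_trans (powR_add_le p0 (cabs_ge0 _) (cabs_ge0 _)).
  apply: ge0_ler_powR; rewrite ?nnegrE ?cabs_ge0 ?addr_ge0 ?cabs_ge0//.
  by apply: le_trans (cabsD _ _) _; rewrite cabsN.
Qed.

Lemma seg_int_sub f F z : analytic f -> analytic F -> udisc z ->
  seg_int (fun v => f v - F v) z = seg_int f z - seg_int F z.
Proof.
move=> af aF z1; rewrite !seg_intE.
have cf h : analytic h -> ccont 0 1 (fun t => h (t%:C%C * z)).
  by move=> ah; apply: ccont_radial => // v v1; exact: analytic_ccts.
rewrite -mulrN -mulrDr -mulN1r -(cintZ _ (cf _ aF)) -cintD; [|exact: cf|].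
  by congr (_ * _); apply: eq_cint => t _; rewrite mulN1r.
apply: ccontZ; exact: cf.
Qed.

Lemma eq_seg_int f F z : (forall v, udisc v -> f v = F v) -> udisc z -> seg_int f z = seg_int F z.
Proof.
move=> fF z1; rewrite !seg_intE; congr (_ * _); apply: eq_cint => t t01.
by rewrite fF//; exact: udisc_scale.
Qed.

Lemma iter_seg_int_sub n f F z : analytic f -> analytic F -> udisc z ->
  iter n (@seg_int R) (fun v => f v - F v) z = iter n (@seg_int R) f z - iter n (@seg_int R) F z.
Proof.
move=> af aF; elim: n z => [//|n IH] z z1; rewrite !iterS (eq_seg_int IH z1).
exact: (seg_int_sub (@analytic_iter_seg_int _ n _ af) (@analytic_iter_seg_int _ n _ aF) z1).
Qed.

(** Turns the distance of two images into the norm of the image of a difference, to which the tail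
    estimates apply. *)
Lemma Tgn_sub n g f F z : analytic g -> analytic f -> analytic F -> udisc z ->
  Tgn g n (fun v => f v - F v) z = Tgn g n f z - Tgn g n F z.
Proof.
move=> ag af aF z1; have adg := analytic_cderiv ag.
rewrite /Tgn -(iter_seg_int_sub n (analyticM af adg) (analyticM aF adg) z1).
congr (iter n _ _ z); apply/funext => w; exact: mulrBl.
Qed.

End local.

(** * Small tails imply compactness *)

Section compact.
Variable R : realType.
Implicit Types (a b d e t x y p q N M : R) (f g F : R[i] -> R[i]) (z v : R[i]) (c w : plane R).
Local Notation leb2 := (@area R).
Local Notation D := (disc (R := R)).

Lemma cvge0P (s : nat -> \bar R) : (forall k, (0 <= s k)%E) ->
  s @ \oo --> 0%E <-> forall e, 0 < e -> exists m : nat, forall k, (m <= k)%N -> (s k <= e%:E)%E.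
Proof.
move=> s0; split.
- move=> /fine_cvgP[[m1 _ H1] /cvgrPdist_lt H] e e0; have [m2 _ H2] := H e e0.
  exists (maxn m1 m2) => k; rewrite geq_max => /andP[k1 k2].
  have f1 := H1 k k1; have := H2 k k2; rewrite /= sub0r normrN -(fineK f1) lee_fin.
  by move=> /ltW; apply: le_trans; rewrite ler_norm.
- move=> H; have fin e k : (s k <= e%:E)%E -> s k \is a fin_num.
    by move=> sk; rewrite ge0_fin_numE//; apply: le_lt_trans sk _; rewrite ltry.
  apply/fine_cvgP; split.
    have [m Hm] := H 1 ltr01; exists m => // k /= mk; exact: fin (Hm k mk).
  apply/cvgrPdist_lt => e e0; have [|m Hm] := H (e / 2); first by rewrite divr_gt0.
  exists m => // k /= mk; have sk := Hm k mk; rewrite sub0r normrN ger0_norm ?fine_ge0//.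
  have fk := fin _ _ sk; by move: sk; rewrite -{1}(fineK fk) lee_fin; lra.
Qed.

Lemma eq_bergman_norm a p f F : (forall z, udisc z -> f z = F z) ->
  bergman_norm a p f = bergman_norm a p F.
Proof.
move=> fF; rewrite /bergman_norm; suff -> : bergman_int a p f = bergman_int a p F by [].
by apply: eq_integral => w; rewrite inE => Dw; rewrite fF.
Qed.

Lemma bergman_norm_ge0 a p f : (0 <= bergman_norm a p f)%E.
Proof. exact: poweR_ge0. Qed.

(** In place of Fatou's lemma: on {delta >= d} some u_m is within 1 of [F], so that |F|^p <= 2^p
    (|u_m|^p + 1) there, and the resulting bound does not depend on [d]. *)
Lemma wint_limit a p N : 1 <= p -> -1 < a -> exists N', forall (u : nat -> R[i] -> R[i]) F,
  (forall k, analytic (u k)) -> (forall k, (wint a p (u k) <= N%:E)%E) -> analytic F ->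
  (forall r e, r < 1 -> 0 < e -> exists m, forall k, (m <= k)%N ->
     forall z, cabs z <= r -> cabs (u k z - F z) < e) ->
  (wint a p F <= N'%:E)%E.
Proof.
move=> p1 a1; have p0 : 0 <= p by lra.
have [C C0 HC] := weight_integrable a1; exists (2 `^ p * (N + C)).
move=> u F au Hu aF cu; have mD := @measurable_disc R.
apply: integral_exhaust_le.
- exact: measurable_wint.
- by move=> w _; rewrite mulr_ge0 ?powR_ge0.
move=> d d0 d1; have [|m Hm] := cu (1 - d) 1 _ ltr01; first by lra.
have um := Hm m (leqnn m).
have nu w : D w -> (0 <= (cabs (u m (cplx w)) `^ p * delta w `^ a)%:E)%E.
  by move=> _; rewrite lee_fin mulr_ge0 ?powR_ge0.
have mu : measurable_fun D (fun w => (cabs (u m (cplx w)) `^ p * delta w `^ a)%:E).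
  by apply/measurable_EFinP; exact: (measurable_wint a p (au m)).
have nW w : D w -> (0 <= (delta w `^ a)%:E)%E by move=> _; rewrite lee_fin powR_ge0.
have mW : measurable_fun D (fun w => (delta w `^ a)%:E).
  by apply/measurable_EFinP; apply: measurable_funTS; exact: measurable_delta_powR.
have nS w : D w -> (0 <= (cabs (u m (cplx w)) `^ p * delta w `^ a)%:E + (delta w `^ a)%:E)%E.
  by move=> Dw; rewrite adde_ge0 ?nu ?nW.
apply: (@le_trans _ _ (\int[leb2]_(w in D) ((2 `^ p)%:E *
    ((cabs (u m (cplx w)) `^ p * delta w `^ a)%:E + (delta w `^ a)%:E)))%E).
  apply: ge0_le_integral; [exact: mD| | | |].
  - by move=> w _; rewrite lee_fin !mulr_ge0 ?powR_ge0.
  - apply/measurable_EFinP; apply: measurable_funM; first exact: (measurable_wint a p aF).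
    by apply: measurable_funTS; apply: measurable_indic; apply: measurableC; exact: measurable_collar.
  - by apply: measurable_funeM; exact: emeasurable_funD.
  - move=> w Dw; rewrite -EFinD -EFinM lee_fin indicE.
    have [|_] := boolP (w \in _); last first.
      by rewrite mulr0 mulr_ge0 ?powR_ge0// addr_ge0 ?mulr_ge0 ?powR_ge0.
    rewrite inE /= => /negP; rewrite -leNgt => dw.
    rewrite mulr1 -[X in _ <= _ * (_ + X)]mul1r -mulrDl mulrA ler_wpM2r ?powR_ge0//.
    have wd : cabs (cplx w) <= 1 - d by move: dw; rewrite /delta; lra.
    have := powR_add_le p0 (cabs_ge0 (u m (cplx w))) (@ler01 R); rewrite powR1; apply: le_trans.
    apply: ge0_ler_powR; rewrite ?nnegrE ?cabs_ge0 ?addr_ge0 ?cabs_ge0//.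
    have -> : F (cplx w) = u m (cplx w) + - (u m (cplx w) - F (cplx w)) by ring.
    apply: le_trans (cabsD _ _) _; rewrite cabsN lerD2l ltW//; exact: um.
rewrite (ge0_integralZl_EFin leb2 mD nS (emeasurable_funD mu mW) (powR_ge0 _ _)).
rewrite (ge0_integralD leb2 mD nu mu nW mW) EFinM; apply: lee_wpmul2l; first by rewrite lee_fin powR_ge0.
by rewrite EFinD; apply: leeD => //; exact: Hu.
Qed.

Lemma measurable_powR_mudens g n b q f : analytic g -> analytic f ->
  measurable_fun D (fun w => cabs (f (cplx w)) `^ q * mudens g n b q w).
Proof.
move=> ag af; apply: measurable_funM; last exact: measurable_mudens.
exact: (measurable_cabs_powR q af (@measurable_disc R) (@subset_refl _ D)).
Qed.

Lemma tail_maps n a b p q g : analytic g -> 1 <= p -> p <= q -> -1 < a -> -1 < b ->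
  tail_small a p q (mudens g n b q) -> maps_into (Tgn g n) a p b q.
Proof.
move=> ag p1 pq a1 b1 Ht f bf; have [af _] := bf.
have q1 : 1 <= q by lra. have q0 : 0 <= q by lra.
have [Cb Cb0 HCb] := bergman_norm_wint p1 a1.
have [Cq Cq0 HCq] := bergman_norm_wint q1 b1.
have [Ct Ct0 HCt] := Tgn_wint n q1 b1.
have [M M0 ME] := bergman_normE a1 bf.
have [_ HW] := HCb f af; have := HW M M0; rewrite ME => /(_ (lexx _)) {}HW.
have N0 : 0 <= Cb * M `^ p by rewrite mulr_ge0 ?powR_ge0 ?(ltW Cb0).
(* The tail bound with [e = 1] controls a collar; off the collar both |f| and the density are
   bounded. *)
have [d d0 Hd] := Ht 1 ltr01; have {}Hd := Hd f _ af N0 HW.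
have d1 : 1 - d < 1 by lra.
have [B1 B10 HB1] := analytic_bounded af d1.
have [B2 B20 HB2] := mudens_bounded n b ag q0 d0.
have B0 : 0 <= B1 `^ q * B2 by rewrite mulr_ge0 ?powR_ge0 ?(ltW B20).
have F0 w : D w -> 0 <= cabs (f (cplx w)) `^ q * mudens g n b q w.
  by move=> _; rewrite mulr_ge0 ?powR_ge0 ?mudens_ge0.
have FB w : D w -> d <= delta w -> cabs (f (cplx w)) `^ q * mudens g n b q w <= B1 `^ q * B2.
  move=> Dw dw; apply: ler_pM; rewrite ?powR_ge0 ?mudens_ge0 ?HB2//.
  apply: ge0_ler_powR; rewrite ?nnegrE ?cabs_ge0 ?(ltW B10)//.
  by apply: HB1; exact: cabs_le_delta.
have H := integral_split_collar (measurable_powR_mudens n b q ag af) F0 B0 FB.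
have H2 : (\int[leb2]_(w in D) (cabs (f (cplx w)) `^ q * mudens g n b q w)%:E <=
    (1 * (Cb * M `^ p) `^ (q / p) + B1 `^ q * B2 * 4)%:E)%E.
  apply: le_trans H _; rewrite EFinD; apply: leeD => //.
  by under eq_integral do rewrite -mulrA.
have [h1 _] := HCt f g ag af.
have [Hn _] := HCq _ (analytic_Tgn (n := n) ag af).
have := Hn (Ct * (1 * (Cb * M `^ p) `^ (q / p) + B1 `^ q * B2 * 4)).
move=> H3; have [||//] := H3.
- by rewrite mulr_ge0 ?(ltW Ct0)// addr_ge0 ?mulr_ge0 ?powR_ge0 ?(ltW B20).
- apply: le_trans h1 _; rewrite EFinM; apply: lee_wpmul2l => //.
  by rewrite lee_fin ltW.
Qed.

Lemma powR_div_root (C q e : R) : 0 < C -> 0 < q -> 0 < e ->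
  C * ((e / C) `^ q) `^ q^-1 = e.
Proof.
move=> C0 q0 e0; rewrite -powRrM mulfV ?gt_eqF// powRr1; last by rewrite divr_ge0 ?ltW.
by rewrite mulrC divfK// gt_eqF.
Qed.

Lemma tail_compact n a b p q g : analytic g -> 1 <= p -> p <= q -> -1 < a -> -1 < b ->
  tail_small a p q (mudens g n b q) -> compact_op (Tgn g n) a p b q.
Proof.
move=> ag p1 pq a1 b1 Ht; have q1 : 1 <= q by lra. have q0 : 0 < q by lra.
have p0 : 0 <= p by lra.
have maps := tail_maps ag p1 pq a1 b1 Ht; split; first exact: maps.
move=> u bu [M HM].
have au k : analytic (u k) by have [] := bu k.
have [Cb Cb0 HCb] := bergman_norm_wint p1 a1.
have [Cq Cq0 HCq] := bergman_norm_wint q1 b1.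
have [Ct Ct0 HCt] := Tgn_wint n q1 b1.
have M0 : 0 <= M by rewrite -lee_fin; apply: le_trans (HM 0%N); exact: bergman_norm_ge0.
pose N := Cb * M `^ p.
have N0 : 0 <= N by exact: mulr_ge0 (ltW Cb0) (powR_ge0 _ _).
have uN k : (wint a p (u k) <= N%:E)%E.
  by have [_ HW] := HCb _ (au k); exact: HW M M0 (HM k).
have [|phi [F [phiI aF cF]]] := montel au.
  move=> r r1; have [B HB] := wint_local_bound p1 a1 r1 N0.
  by exists B => k z zr; apply: (HB (u k) (au k) (uN k) z zr).
have [N' HN'] := wint_limit N p1 a1.
have WF := HN' (u \o phi) F (fun k => au (phi k)) (fun k => uN (phi k)) aF cF.
have N'0 : 0 <= N' by rewrite -lee_fin; exact: le_trans (wint_ge0 _ _ _) WF.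
have bF : bergman a p F by have [HF _] := HCb _ aF; have [] := HF N' N'0 WF.
(* The images converge to the image of the Montel limit, which lies in the space by [wint_limit]. *)
exists phi, (Tgn g n F); split; [exact: phiI|exact: (maps F bF)|].
apply/cvge0P; first by move=> k; exact: bergman_norm_ge0.
move=> e e0.
pose N2 := 2 `^ p * (N + N').
have N20 : 0 <= N2 by rewrite mulr_ge0 ?powR_ge0 ?addr_ge0.
(* The target for the integral of |u_k - F|^q against the density; half of it is spent on the
   collar, half on the rest of the disc. *)
pose eta := (e / Cq) `^ q / Ct.
have eta0 : 0 < eta by rewrite divr_gt0// powR_gt0// divr_gt0.
pose X := N2 `^ (q / p); have X0 : 0 < X + 1 by rewrite ltr_wpDl ?powR_ge0.
have e10 : 0 < eta / 2 / (X + 1).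
  by apply: divr_gt0 (X0); exact: divr_gt0 eta0 (ltr0n _ 2).
have [d d0 Hd] := Ht _ e10.
have d1 : 1 - d < 1 by lra.
have [B B0 HB] := mudens_bounded n b ag (ltW q0) d0.
(* Then s^q * B * 4 = eta / 2, where 4 bounds the area of the disc. *)
pose s := (eta / (8 * B)) `^ q^-1.
have s0 : 0 < s by rewrite powR_gt0// divr_gt0// mulr_gt0.
have [m Hm] := cF (1 - d) s d1 s0; exists m => k mk.
pose v z := u (phi k) z - F z.
have av : analytic v by exact: (analyticB (au _) aF).
have Wv : (wint a p v <= N2%:E)%E.
  apply: le_trans (wintB a p0 (au _) aF) _; rewrite EFinM EFinD.
  by apply: lee_wpmul2l; [rewrite lee_fin powR_ge0|apply: leeD => //; exact: uN].
have F0 w : D w -> 0 <= cabs (v (cplx w)) `^ q * mudens g n b q w.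
  by move=> _; rewrite mulr_ge0 ?powR_ge0 ?mudens_ge0.
have sB0 : 0 <= s `^ q * B by rewrite mulr_ge0 ?powR_ge0 ?(ltW B0).
have FB w : D w -> d <= delta w -> cabs (v (cplx w)) `^ q * mudens g n b q w <= s `^ q * B.
  move=> Dw dw; apply: ler_pM; rewrite ?powR_ge0 ?mudens_ge0 ?HB//.
  apply: ge0_ler_powR; rewrite ?nnegrE ?cabs_ge0 ?(ltW s0) ?(ltW q0)//.
  by apply/ltW/(Hm k mk); exact: cabs_le_delta.
have H := integral_split_collar (measurable_powR_mudens n b q ag av) F0 sB0 FB.
have H2 : (\int[leb2]_(w in D) (cabs (v (cplx w)) `^ q * mudens g n b q w)%:E <= eta%:E)%E.
  apply: le_trans H _; have -> : eta = eta / 2 + s `^ q * B * 4.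
    rewrite /s -powRrM mulVf ?gt_eqF// powRr1; last first.
      by rewrite divr_ge0 ?(ltW eta0) ?mulr_ge0 ?(ltW B0).
    by field; rewrite gt_eqF.
  rewrite EFinD; apply: leeD => //.
  under eq_integral do rewrite -mulrA.
  apply: le_trans (Hd v N2 av N20 Wv) _; rewrite lee_fin -/X.
  have X1 : (X + 1)^-1 * X <= 1 by rewrite mulrC ler_pdivrMr// mul1r lerDl.
  have E2 : 0 <= eta / 2 by exact: ltW (divr_gt0 eta0 (ltr0n _ 2)).
  by rewrite -mulrA; exact: ler_piMr E2 X1.
have [h1 _] := HCt v g ag av.
have W3 : (wint b q (Tgn g n v) <= ((e / Cq) `^ q)%:E)%E.
  apply: le_trans h1 _; apply: le_trans (lee_wpmul2l _ H2) _; first by rewrite lee_fin ltW.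
  by rewrite -EFinM lee_fin /eta mulrC divfK// gt_eqF.
have [Hn _] := HCq _ (analytic_Tgn (n := n) ag av).
have [_ H3] := Hn _ (powR_ge0 _ _) W3.
have E z : udisc z -> Tgn g n v z = Tgn g n (u (phi k)) z - Tgn g n F z.
  by move=> z1; exact: (Tgn_sub n ag (au (phi k)) aF z1).
have EN := eq_bergman_norm b q E.
apply: (@le_trans _ _ (bergman_norm b q (Tgn g n v))); first by rewrite EN.
by apply: le_trans H3 _; rewrite lee_fin powR_div_root.
Qed.

End compact.

(** * Compactness implies small tails *)

Section necessity.
Variable R : realType.
Implicit Types (a b d e t x y p q N M : R) (f g F : R[i] -> R[i]) (z v : R[i]) (c w : plane R).
Local Notation leb2 := (@area R).
Local Notation D := (disc (R := R)).

(** Both sides scale alike in [f], which reduces the claim to [N = 1]. The case [N = 0] admits no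
    scaling; there [growth] forces [f] to vanish on the disc. *)
Lemma tail_normalize a p q e d (h : plane R -> R) : 1 <= p -> p <= q ->
  measurable_fun D h -> (forall w, 0 <= h w) ->
  (forall f, analytic f -> (wint a p f <= 1)%E ->
    (\int[leb2]_(w in D) (cabs (f (cplx w)) `^ q * (h w * \1_(collar d) w))%:E <= e%:E)%E) ->
  forall f N, analytic f -> 0 <= N -> (wint a p f <= N%:E)%E ->
  (\int[leb2]_(w in D) (cabs (f (cplx w)) `^ q * (h w * \1_(collar d) w))%:E
     <= (e * N `^ (q / p))%:E)%E.
Proof.
move=> p1 pq mh h0 H f N af N0 HN; have p0 : 0 < p by lra.
have q0 : 0 < q by lra. have mD := @measurable_disc R.
have qp0 : q / p != 0 by rewrite gt_eqF// divr_gt0.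
have [N00|N00] := eqVneq N 0.
  rewrite N00 powR0// mulr0 integral0_eq// => w Dw.
  have [K K0 HK] := growth a p1; have := HK f w af Dw.
  have W0 : wint a p f = 0%E by apply/eqP; rewrite eq_le wint_ge0 andbT; move: HN; rewrite N00.
  rewrite W0 mule0 lee_fin => fw; have : cabs (f (cplx w)) `^ p = 0.
    by apply/eqP; rewrite eq_le fw powR_ge0.
  by move/powR_eq0_eq0 => ->; rewrite powR0 ?mul0r// gt_eqF.
have {}N0 : 0 < N by rewrite lt_neqAle eq_sym N00.
pose k := N `^ (- p^-1); have k0 : 0 < k by exact: powR_gt0.
pose F z := k%:C%C * f z.
have aF : analytic F := analyticM (@analytic_cst _ k%:C%C) af.
have WF : (wint a p F <= 1)%E.
  rewrite (wint_scale a p (ltW k0) af).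
  apply: le_trans (lee_wpmul2l _ HN) _; first by rewrite lee_fin powR_ge0.
  by rewrite -EFinM lee_fin /k -powRrM mulNr mulVf ?gt_eqF// powR_inv1 ?(ltW N0)// mulVf.
have mf : measurable_fun D (fun w => (cabs (f (cplx w)) `^ q * (h w * \1_(collar d) w))%:E).
  apply/measurable_EFinP; apply: measurable_funM.
    exact: (measurable_cabs_powR q af mD (@subset_refl _ D)).
  apply: measurable_funM => //; apply: measurable_funTS; apply: measurable_indic.
  exact: measurable_collar.
have nf w : D w -> (0 <= (cabs (f (cplx w)) `^ q * (h w * \1_(collar d) w))%:E)%E.
  by move=> _; rewrite lee_fin !mulr_ge0 ?powR_ge0 ?h0.
have kq0 : 0 < k `^ q by exact: powR_gt0.
have E : (\int[leb2]_(w in D) (cabs (F (cplx w)) `^ q * (h w * \1_(collar d) w))%:E =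
  (k `^ q)%:E * \int[leb2]_(w in D) (cabs (f (cplx w)) `^ q * (h w * \1_(collar d) w))%:E)%E.
  rewrite -(ge0_integralZl_EFin leb2 mD nf mf (ltW kq0)).
  apply: eq_integral => w _; rewrite -EFinM /F cabsM cabs_real (ger0_norm (ltW k0)).
  by rewrite (powRM _ (ltW k0) (cabs_ge0 _)) -mulrA.
have := H F aF WF; rewrite E -(@lee_pmul2l _ (N `^ (q / p))%:E) ?lte_fin ?powR_gt0//.
rewrite muleA -EFinM.
have -> : N `^ (q / p) * k `^ q = 1.
  rewrite /k -powRrM -powRD; last by apply/implyP => _; rewrite gt_eqF.
  by rewrite mulNr [p^-1 * q]mulrC subrr powRr0.
by rewrite mul1e -EFinM mulrC.
Qed.

Lemma homo_ltn_ge (phi : nat -> nat) : {homo phi : i j / (i < j)%N} -> forall k, (k <= phi k)%N.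
Proof.
by move=> H; elim=> // k IH; apply: leq_ltn_trans IH _; exact: H.
Qed.

Lemma collarS d1 d2 : d1 <= d2 -> collar d1 `<=` collar d2.
Proof. by move=> d12 w; rewrite /collar /=; move/lt_le_trans; apply. Qed.

Lemma compact_tail n a b p q g : analytic g -> 1 <= p -> p <= q -> -1 < a -> -1 < b ->
  compact_op (Tgn g n) a p b q -> tail_small a p q (mudens g n b q).
Proof.
move=> ag p1 pq a1 b1 [_ Hc] e e0; have mD := @measurable_disc R.
have q1 : 1 <= q by lra. have q0 : 0 < q by lra.
apply: contrapT => Hn.
(* Failure of the tail condition at every width 1 / (k + 1) yields a bounded sequence whose tails
   stay above [e]; compactness will contradict it. *)
have H k : exists f, [/\ analytic f, (wint a p f <= 1)%E &
    (e%:E < \int[leb2]_(w in D) (cabs (f (cplx w)) `^ q *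
      (mudens g n b q w * \1_(collar k.+1%:R^-1) w))%:E)%E].
  apply: contrapT => Hk; apply: Hn; exists k.+1%:R^-1; first by rewrite invr_gt0.
  apply: tail_normalize => //; first exact: measurable_mudens.
    by move=> w; exact: mudens_ge0.
  move=> f af Wf; rewrite leNgt; apply/negP => lt; apply: Hk; exists f; split.
  - exact: af.
  - exact: Wf.
  - exact: lt.
have [u Hu] := choice H => {H Hn}.
have au k : analytic (u k) by have [] := Hu k.
have [Cb Cb0 HCb] := bergman_norm_wint p1 a1.
have [Cq Cq0 HCq] := bergman_norm_wint q1 b1.
have [C2 C20 HC2] := wint_iter_cderiv n b q1.
have nu k : bergman a p (u k) /\ (bergman_norm a p (u k) <= (Cb * 1 `^ p^-1)%:E)%E.
  by have [HW _] := HCb _ (au k); have [_ W1 _] := Hu k; exact: (HW 1 ler01 W1).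
have nM : exists M, forall k, (bergman_norm a p (u k) <= M%:E)%E.
  by exists (Cb * 1 `^ p^-1) => k; exact: (nu k).2.
have [phi [F [phiI bF cF]]] := Hc u (fun k => (nu k).1) nM.
have {}cF := (cvge0P (fun k => bergman_norm_ge0 _ _ _)).1 cF.
have [aF _] := bF; have [MF MF0 MFE] := bergman_normE b1 bF.
pose G := iter n (@cderiv R) F; pose E := b + n%:R * q.
have aG : analytic G by exact: (@analytic_iter_cderiv _ n _ aF).
have WG : (wint E q G < +oo)%E.
  apply: le_lt_trans (HC2 F aF) _.
  have [_ HW] := HCq F aF; have := HW MF MF0; rewrite MFE => /(_ (lexx _)) WF.
  apply: le_lt_trans (lee_wpmul2l _ WF) _; first by rewrite lee_fin ltW.
  by rewrite -EFinM ltry.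
(* Two terms of size [e1], times the 2^q of [powR_add_le], add up to e / 2. *)
pose e1 := e / (4 * 2 `^ q).
have q20 : 0 < 4 * 2 `^ q :> R by rewrite mulr_gt0 ?powR_gt0.
have e10 : 0 < e1 by exact: divr_gt0.
have [d d0 Hd] := integral_collar_small (measurable_wint E q aG)
  (fun w _ => mulr_ge0 (powR_ge0 _ _) (powR_ge0 _ _)) WG e10.
have CC0 : 0 < C2 * Cq by exact: mulr_gt0.
(* A function of norm at most [e2] has an n-th derivative with weighted integral at most C2 * Cq *
   e2^q = e1. *)
pose e2 := (e1 / (C2 * Cq)) `^ q^-1; have e20 : 0 < e2 by rewrite powR_gt0// divr_gt0.
have [m Hm] := cF e2 e20.
have [m2 _ Hm2] := @near_infty_natSinv_lt R (PosNum d0).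
(* Large enough for the convergence, and [phi k >= k] puts the collar of width 1 / (phi k + 1)
   inside the collar of width [d]. *)
pose k := maxn m m2; have mk : (m <= k)%N by exact: leq_maxl.
have phik : (phi k).+1%:R^-1 <= d.
  by apply/ltW/(Hm2 (phi k)); apply: (leq_trans (leq_maxr m m2)); exact: homo_ltn_ge.
have [_ _] := Hu (phi k); apply/negP; rewrite -leNgt.
set f := u (phi k); have af : analytic f := au (phi k).
have aT : analytic (Tgn g n f) := analytic_Tgn (n := n) ag af.
pose P z := Tgn g n f z - F z; have aP : analytic P := analyticB aT aF.
pose Q := iter n (@cderiv R) P.
have aQ : analytic Q := @analytic_iter_cderiv _ n _ aP.
have WQ : (wint E q Q <= e1%:E)%E.
  apply: le_trans (HC2 P aP) _.
  have [_ HW] := HCq P aP; have {}HW := HW e2 (ltW e20) (Hm k mk).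
  apply: le_trans (lee_wpmul2l _ HW) _; first by rewrite lee_fin ltW.
  rewrite -EFinM lee_fin /e2 -powRrM mulVf ?gt_eqF// powRr1; last first.
    by rewrite divr_ge0 ?(ltW CC0) ?(ltW e10).
  have -> : C2 * (Cq * (e1 / (C2 * Cq))) = e1 by field; rewrite !gt_eqF.
  exact: lexx.
have afg := analyticM af (analytic_cderiv ag).
(* On the disc f g' is the n-th derivative of [Tgn g n f = P + F]: [Q] is small on the whole disc,
   and [G], being fixed, is small near the circle. *)
have QE z : udisc z -> f z * cderiv g z = Q z + G z.
  move=> z1; rewrite /Q /P (iter_cderiv_sub n aT aF z1) -/G subrK.
  by rewrite /Tgn (iter_cderiv_seg_int n afg z1).
have nQ w : D w -> (0 <= (cabs (Q (cplx w)) `^ q * delta w `^ E)%:E)%E.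
  by move=> _; rewrite lee_fin mulr_ge0 ?powR_ge0.
have mQ : measurable_fun D (fun w => (cabs (Q (cplx w)) `^ q * delta w `^ E)%:E).
  by apply/measurable_EFinP; exact: (measurable_wint E q aQ).
have mcol d' : measurable_fun D (\1_(collar d') : plane R -> R).
  by apply: measurable_funTS; apply: measurable_indic; exact: measurable_collar.
have nG w : D w -> (0 <= (cabs (G (cplx w)) `^ q * delta w `^ E * \1_(collar d) w)%:E)%E.
  by move=> _; rewrite lee_fin !mulr_ge0 ?powR_ge0.
have mG : measurable_fun D (fun w => (cabs (G (cplx w)) `^ q * delta w `^ E * \1_(collar d) w)%:E).
  by apply/measurable_EFinP; apply: measurable_funM (mcol d); exact: (measurable_wint E q aG).
have nS w : D w -> (0 <= (cabs (Q (cplx w)) `^ q * delta w `^ E)%:E +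
    (cabs (G (cplx w)) `^ q * delta w `^ E * \1_(collar d) w)%:E)%E.
  by move=> Dw; apply: adde_ge0; [exact: nQ|exact: nG].
apply: (@le_trans _ _ (\int[leb2]_(w in D) ((2 `^ q)%:E * ((cabs (Q (cplx w)) `^ q * delta w `^ E)%:E +
    (cabs (G (cplx w)) `^ q * delta w `^ E * \1_(collar d) w)%:E)))%E).
  apply: ge0_le_integral; [exact: mD| | | |].
  - by move=> w _; rewrite lee_fin !mulr_ge0 ?powR_ge0 ?mudens_ge0.
  - apply/measurable_EFinP; apply: measurable_funM.
      exact: (measurable_cabs_powR q af mD (@subset_refl _ D)).
    exact: measurable_funM (measurable_mudens n b q ag) (mcol _).
  - by apply: measurable_funeM; exact: emeasurable_funD.
  - move=> w Dw; rewrite -EFinD -EFinM lee_fin.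
    have -> : cabs (f (cplx w)) `^ q * (mudens g n b q w * \1_(collar (phi k).+1%:R^-1) w) =
        cabs (Q (cplx w) + G (cplx w)) `^ q * delta w `^ E * \1_(collar (phi k).+1%:R^-1) w.
      by rewrite -(QE _ Dw) cabsM (powRM _ (cabs_ge0 _) (cabs_ge0 _)) /mudens !mulrA.
    rewrite indicE; have [|_] := boolP (w \in _); last first.
      by rewrite mulr0 !mulr_ge0 ?powR_ge0// addr_ge0 ?mulr_ge0 ?powR_ge0.
    rewrite inE => /(collarS phik) dw; rewrite indicE (mem_set dw) !mulr1 -mulrDl mulrA.
    rewrite ler_wpM2r ?powR_ge0//.
    apply: le_trans (powR_add_le (ltW q0) (cabs_ge0 _) (cabs_ge0 _)).
    by apply: ge0_ler_powR; rewrite ?nnegrE ?cabs_ge0 ?addr_ge0 ?cabs_ge0 ?(ltW q0) ?cabsD.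
rewrite (ge0_integralZl_EFin leb2 mD nS (emeasurable_funD mQ mG) (powR_ge0 _ _)).
rewrite (ge0_integralD leb2 mD nQ mQ nG mG).
apply: (@le_trans _ _ ((2 `^ q)%:E * (e1%:E + e1%:E))%E).
  by apply: lee_wpmul2l; [rewrite lee_fin powR_ge0|exact: leeD].
rewrite -EFinD -EFinM lee_fin /e1.
have -> : 2 `^ q * (e / (4 * 2 `^ q) + e / (4 * 2 `^ q)) = e / 2.
  by field; rewrite gt_eqF ?powR_gt0.
by lra.
Qed.

End necessity.

Theorem theorem3p2 (R : realType) (n : nat) (p q alpha beta : R)
    (g : R[i] -> R[i]) (ag : analytic g) :
  (0 < n)%N -> 1 <= p -> p <= q -> -1 < alpha -> -1 < beta ->
  q / p <= (beta + 2) / (alpha + 2) ->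
  (bounded_op (Tgn g n) alpha p beta q <->
   carleson alpha p q (mun n beta q ag)) /\
  (compact_op (Tgn g n) alpha p beta q <->
   vanishing_carleson alpha p q (mun n beta q ag)).
Proof.
move=> _ p1 pq a1 b1 _; split; split.
- exact: bounded_carleson.
- exact: carleson_bounded.
- move=> cT; apply: tail_vanishing => //; exact: (compact_tail ag p1 pq a1 b1 cT).
- move=> vT; exact: (tail_compact ag p1 pq a1 b1 (vanishing_tail p1 pq a1 vT)).
Qed.
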